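(* Let $\theta\in(0,2\pi)$, $z\in\mathbb C$ with $z\notin\mathbb Z$ and $\operatorname{Re}z>-1$, and let $\mathbf p=[p_1,p_2,p_3,p_4]^\top\in\mathbb C^4$. Suppose the density $\phi$ on the wedge is $$\phi(t)=[p_1,p_2]^\top t^z\ (0\le t\le1),\qquad \phi(t)=[p_3,p_4]^\top(-t)^z\ (-1\le t\le0).$$ Let $h(t)=-\tfrac12\phi(t)+\mathcal D[\phi](t)$ be the left-hand side of the boundary integral equation on the wedge, and let $\tilde h(t)=[h_1(t),h_2(t),h_1(-t),h_2(-t)]^\top$. Then, with the explicit matrices $\mathbf A(z,\theta)$ and $\mathbf F(k,z,\theta)$, $k=0,1,2,\dots$, given in the context, $$\tilde h(t)=\left[\mathbf A(z,\theta)\,t^z+\sum_{k=0}^\infty\mathbf F(k,z,\theta)\,t^k\right]\mathbf p,\qquad 0<t<1.$$ Furthermore, if $\mathbf p\neq0$ and $h$ is smooth, then the singular exponent $z$ must satisfy $\det\mathbf A(z,\theta)=0$, which yields the transcendental equation $$\left(z^2\sin^2\theta-\sin^2((2\pi-\theta)z)\right)\left(z^2\sin^2\theta-c^2\sin^2(\theta z)\right)=0,\qquad c=\frac{\lambda+3\mu}{\lambda+\mu},$$ and the coefficient vector satisfies $\mathbf p\in\ker\mathbf A(z,\theta)$.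
   Context: $\lambda,\mu$ are real constants (Lamé parameters) with $\mu>0$, $\lambda+\mu>0$. The wedge $\Gamma=OA\cup OB$ with opening angle $\theta$ is parameterized by arclength: $\gamma(t)=(t,0)$ for $0\le t\le1$ (edge $OA$), $\gamma(t)=(-t\cos\theta,-t\sin\theta)$ for $-1\le t\le0$ (edge $OB$). Unit tangents and normals: $\tau=(1,0)$, $n=(0,-1)$ on $OA$; $\tau=(-\cos\theta,-\sin\theta)$, $n=(-\sin\theta,\cos\theta)$ on $OB$. Functions on $\Gamma$ are written as functions of $t\in[-1,1]$; ''$h$ is smooth'' means that $\tilde h$ is smooth up to $t=0$. With $r=x-y$, $|r|$ its norm, $\mathbf L=\begin{bmatrix}0&1\\-1&0\end{bmatrix}$, the kernel is $$\mathbf D(x,y)=\frac{\mu}{\lambda+2\mu}\left[\frac{n(y)\cdot r}{2\pi|r|^2}\mathbf I+\frac{\tau(y)\cdot r}{2\pi|r|^2}\mathbf L\right]+\frac{\lambda+\mu}{\lambda+2\mu}\frac{(n(y)\cdot r)\,r\otimes r}{\pi|r|^4},$$ and $\mathcal D[\phi](t)=\mathrm{p.v.}\int_\Gamma\mathbf D(\gamma(t),y)\phi(y)\,ds_y$ (Cauchy principal value). For $t>0$, $t^z=e^{z\ln t}$ with $\ln t$ real. Put $c_1=\frac{\mu}{2(\lambda+2\mu)}$, $c_2=\frac{\lambda+\mu}{\lambda+2\mu}$, $S=\sin(z(\pi-\theta))$, $C=\cos(z(\pi-\theta))$, $q=\csc(\pi z)$. The columns of $\mathbf A(z,\theta)$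 are $$\mathbf A_1=\begin{bmatrix}-\frac12\\-c_1\cot(\pi z)\\-c_1qS+\frac14c_2q[-(z+2)S+z\sin(\pi z-(z-2)\theta)]\\-c_1qC+\frac12c_2zq\sin\theta\sin(\pi z-(z-1)\theta)\end{bmatrix},$$ $$\mathbf A_2=\begin{bmatrix}c_1\cot(\pi z)\\-\frac12\\c_1qC+\frac12c_2zq\sin\theta\sin(\pi z-(z-1)\theta)\\-c_1qS+\frac14c_2q[(z-2)S-z\sin(\pi z-(z-2)\theta)]\end{bmatrix},$$ $$\mathbf A_3=\begin{bmatrix}-c_1qS+\frac14c_2q[(z-2)S-z\sin(\pi z-(z+2)\theta)]\\c_1qC-\frac12c_2zq\sin\theta\sin(\pi z-(z+1)\theta)\\-\frac12\\c_1\cot(\pi z)\end{bmatrix},$$ $$\mathbf A_4=\begin{bmatrix}-c_1qC-\frac12c_2zq\sin\theta\sin(\pi z-(z+1)\theta)\\-c_1qS+\frac14c_2q[-(z+2)S+z\sin(\pi z-(z+2)\theta)]\\-c_1\cot(\pi z)\\-\frac12\end{bmatrix}.$$ The matrices $\mathbf F(k,z,\theta)$ are as follows. For $k\ge4$ the columns are $$\mathbf F_1(k)=\begin{bmatrix}0\\-\frac{c_1}{\pi(k-z)}\\\frac{c_2k\sin((k-2)\theta)+[4c_1-c_2(2+k)]\sin(k\theta)}{4\pi(k-z)}\\-\frac{2c_1\cos(k\theta)+c_2k\sin\theta\sin((1-k)\theta)}{2\pi(k-z)}\end{bmatrix},\quad \mathbf F_2(k)=\begin{bmatrix}\frac{c_1}{\pi(k-z)}\\0\\\frac{2c_1\cos(k\theta)-c_2k\sin\theta\sin((1-k)\theta)}{2\pi(k-z)}\\\frac{-c_2k\sin((k-2)\theta)+[4c_1+c_2(k-2)]\sin(k\theta)}{4\pi(k-z)}\end{bmatrix},$$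 $$\mathbf F_3(k)=\begin{bmatrix}\frac{[4c_1+c_2(k-2)]\sin(k\theta)-c_2k\sin((k+2)\theta)}{4\pi(k-z)}\\\frac{2c_1\cos(k\theta)-c_2k\sin\theta\sin((1+k)\theta)}{2\pi(k-z)}\\0\\\frac{c_1}{\pi(k-z)}\end{bmatrix},\quad \mathbf F_4(k)=\begin{bmatrix}-\frac{2c_1\cos(k\theta)+c_2k\sin\theta\sin((1+k)\theta)}{2\pi(k-z)}\\\frac{[4c_1-c_2(2+k)]\sin(k\theta)+c_2k\sin((k+2)\theta)}{4\pi(k-z)}\\-\frac{c_1}{\pi(k-z)}\\0\end{bmatrix}.$$ For $k=0,1,2$: $$\mathbf F(0,z,\theta)=\begin{bmatrix}0&-\frac{c_1}{\pi z}&0&\frac{c_1}{\pi z}\\\frac{c_1}{\pi z}&0&-\frac{c_1}{\pi z}&0\\0&-\frac{c_1}{\pi z}&0&\frac{c_1}{\pi z}\\\frac{c_1}{\pi z}&0&-\frac{c_1}{\pi z}&0\end{bmatrix},$$ $$\mathbf F(1,z,\theta)=\begin{bmatrix}0&\frac{c_1}{\pi(1-z)}&\frac{c_1\sin\theta}{\pi(1-z)}&\frac{c_1\cos\theta}{\pi(-1+z)}\\\frac{c_1}{\pi(-1+z)}&0&\frac{c_1\cos\theta}{\pi(1-z)}&\frac{c_1\sin\theta}{\pi(1-z)}\\\frac{c_1\sin\theta}{\pi(1-z)}&\frac{c_1\cos\theta}{\pi(1-z)}&0&\frac{c_1}{\pi(-1+z)}\\\frac{c_1\cos\theta}{\pi(-1+z)}&\frac{c_1\sin\theta}{\pi(1-z)}&\frac{c_1}{\pi(1-z)}&0\end{bmatrix},$$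 $$\mathbf F(2,z,\theta)=\begin{bmatrix}0&-\frac{c_1}{\pi(-2+z)}&\frac{(-c_1+c_2+c_2\cos2\theta)\sin2\theta}{\pi(-2+z)}&\frac{c_1\cos2\theta+c_2\sin^22\theta}{\pi(-2+z)}\\\frac{c_1}{\pi(-2+z)}&0&\frac{-c_1\cos2\theta+c_2\sin^22\theta}{\pi(-2+z)}&\frac{(-c_1+c_2-c_2\cos2\theta)\sin2\theta}{\pi(-2+z)}\\\frac{(-c_1+2c_2)\sin2\theta}{\pi(-2+z)}&-\frac{c_1\cos2\theta}{\pi(-2+z)}&0&\frac{c_1}{\pi(-2+z)}\\\frac{c_1\cos2\theta}{\pi(-2+z)}&-\frac{c_1\sin2\theta}{\pi(-2+z)}&-\frac{c_1}{\pi(-2+z)}&0\end{bmatrix}.$$ For $k=3$ the columns are $$\mathbf F_1(3)=\begin{bmatrix}0\\\frac{c_1}{\pi(-3+z)}\\\frac{-c_2\sin\theta+(-c_1+c_2)\sin3\theta}{\pi(-3+z)}\\\frac{-c_2\cos\theta+(c_1+c_2)\cos3\theta}{\pi(-3+z)}\end{bmatrix},\quad \mathbf F_2(3)=\begin{bmatrix}-\frac{c_1}{\pi(-3+z)}\\0\\\frac{-c_2\cos\theta+(-c_1+c_2)\cos3\theta}{\pi(-3+z)}\\-\frac{c_1\sin3\theta}{\pi(-3+z)}\end{bmatrix},$$ $$\mathbf F_3(3)=\begin{bmatrix}\frac{-4c_2\sin\theta-(4c_1+c_2)\sin3\theta+3c_2\sin5\theta}{4\pi(-3+z)}\\\frac{-2c_1\cos3\theta+3c_2\sin\theta\sin4\theta}{2\pi(-3+z)}\\0\\-\frac{c_1}{\pi(-3+z)}\end{bmatrix},\quad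 \mathbf F_4(3)=\begin{bmatrix}\frac{2c_1\cos3\theta+3c_2\sin\theta\sin4\theta}{2\pi(-3+z)}\\\frac{(-4c_1+5c_2)\sin3\theta-3c_2\sin5\theta}{4\pi(-3+z)}\\\frac{c_1}{\pi(-3+z)}\\0\end{bmatrix}.$$
   Formalization: The matrices F(k), k ≥ 1, printed in the context have wrong c_2 terms, so the expansion fails as stated; here F(k) for every k ≥ 1 is the form printed for k ≥ 4 with c_2 replaced by -c_2. F(0), A and all other parts are as given. *)

(* Defs.v *)
(* MathComp-Analysis: R is a realType, complex numbers are R[i]. *)
From HB Require Import structures.
From mathcomp Require Import all_boot all_order all_algebra.
From mathcomp Require Import all_classical all_reals all_analysis.
From mathcomp Require Export complex.
Set Implicit Arguments.
Unset Strict Implicit.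
Unset Printing Implicit Defensive.
Import Order.TTheory GRing.Theory Num.Theory.
Import numFieldNormedType.Exports.
Local Open Scope classical_set_scope.
Local Open Scope ring_scope.
Local Open Scope complex_scope.

(* R[i] gets the topology of its modulus; matrices over R[i] inherit it. *)
HB.instance Definition _ (R : realType) := NormedModule.copy R[i] R[i]^o.

Definition cexp (R : realType) (z : R[i]) : R[i] :=
  (expR (complex.Re z))%:C * (cos (complex.Im z) +i* sin (complex.Im z)).

Definition csin (R : realType) (z : R[i]) : R[i] :=
  (cexp ('i * z) - cexp (- ('i * z))) / (2 * 'i).

Definition ccos (R : realType) (z : R[i]) : R[i] :=
  (cexp ('i * z) + cexp (- ('i * z))) / 2.

Definition ccot (R : realType) (z : R[i]) : R[i] := ccos z / csin z.

Definition ccsc (R : realType) (z : R[i]) : R[i] := (csin z)^-1.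

(* t^z for t > 0; for t <= 0 the value is irrelevant. *)
Definition cpow (R : realType) (t : R) (z : R[i]) : R[i] :=
  cexp (z * (ln t)%:C).

Definition cintegral (R : realType) (D : set R) (f : R -> R[i]) : R[i] :=
  (\int[lebesgue_measure]_(s in D) complex.Re (f s))
  +i* (\int[lebesgue_measure]_(s in D) complex.Im (f s)).

Definition cintegrable (R : realType) (D : set R) (f : R -> R[i]) : Prop :=
  lebesgue_measure.-integrable D (EFin \o (fun s => complex.Re (f s))) /\
  lebesgue_measure.-integrable D (EFin \o (fun s => complex.Im (f s))).

Section Geometry.
Variable R : realType.
Implicit Types (u v r : 'cV[R]_2) (theta s t : R).

Definition vec2 (T : nmodType) (a b : T) : 'cV[T]_2 := \col_i [:: a; b]`_i.

Definition dot u v : R := (u^T *m v) 0 0.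

(* The canonical norm of 'cV[R]_2 is the max norm, hence this one. *)
Definition enorm u : R := Num.sqrt (dot u u).

(* Signed arclength t in [-1, 1]: OA is t >= 0, OB is t < 0. *)
Definition wedge_pt theta t : 'cV[R]_2 :=
  if 0 <= t then vec2 t 0 else vec2 (- t * cos theta) (- t * sin theta).

Definition wedge_tangent theta t : 'cV[R]_2 :=
  if 0 <= t then vec2 1 0 else vec2 (- cos theta) (- sin theta).

Definition wedge_normal theta t : 'cV[R]_2 :=
  if 0 <= t then vec2 0 (-1) else vec2 (- sin theta) (cos theta).

Definition Lmx : 'M[R]_2 := row_mx (vec2 0 (-1)) (vec2 1 0).

(* n and tau are the unit normal and tangent at y. *)
Definition kernelD (lambda mu : R) (x y n tau : 'cV[R]_2) : 'M[R]_2 :=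
  let r := x - y in
  (mu / (lambda + 2 * mu)) *:
    ((dot n r / (2 * pi * enorm r ^+ 2)) *: 1%:M
     + (dot tau r / (2 * pi * enorm r ^+ 2)) *: Lmx)
  + ((lambda + mu) / (lambda + 2 * mu) * (dot n r / (pi * enorm r ^+ 4)))
      *: (r *m r^T).

End Geometry.

Section Operator.
Variable R : realType.
Variables (lambda mu theta : R).
Implicit Types (phi : R -> 'cV[R[i]]_2) (t e : R).

Definition layer_integrand phi t (s : R) : 'cV[R[i]]_2 :=
  map_mx (real_complex R)
    (kernelD lambda mu (wedge_pt theta t) (wedge_pt theta s)
       (wedge_normal theta s) (wedge_tangent theta s)) *m phi s.

(* The wedge minus the open Euclidean e-ball around the target point. *)
Definition punctured_wedge t e : set R :=
  [set s | -1 <= s <= 1 /\ e <= enorm (wedge_pt theta t - wedge_pt theta s)].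

Definition layer_trunc phi t e : 'cV[R[i]]_2 :=
  \col_i cintegral (punctured_wedge t e) (fun s => layer_integrand phi t s i 0).

Definition layer phi t : 'cV[R[i]]_2 :=
  lim (layer_trunc phi t e @[e --> 0^'+]).

(* Without this, [lim] and the Lebesgue integral return dummy values. *)
Definition layer_exists phi t : Prop :=
  (forall e (i : 'I_2), 0 < e ->
     cintegrable (punctured_wedge t e) (fun s => layer_integrand phi t s i 0))
  /\ cvg (layer_trunc phi t e @[e --> 0^'+]).

Definition bie_lhs phi t : 'cV[R[i]]_2 := - 2^-1 *: phi t + layer phi t.

End Operator.

Definition wedge_density (R : realType) (z : R[i]) (p : 'cV[R[i]]_4) (t : R)
    : 'cV[R[i]]_2 :=
  if 0 <= t then cpow t z *: usubmx (p : 'cV_(2 + 2))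
  else cpow (- t) z *: dsubmx (p : 'cV_(2 + 2)).

Definition fold_wedge (R : realType) (h : R -> 'cV[R[i]]_2) (t : R)
  : 'cV[R[i]]_4 := col_mx (h t) (h (- t)).

(* C^oo on ]0, 1[, every derivative having a finite limit at 0. The point
   t = 1 is left out: D[phi] is in general logarithmically singular at the
   ends of the wedge. *)
Definition smooth_up_to_0 (R : realType) (f : R -> R) : Prop :=
  forall n, (forall t, 0 < t < 1 -> derivable (derive1n n f) t 1)
            /\ cvg (derive1n n f t @[t --> 0^'+]).

Definition wedge_smooth (R : realType) (h : R -> 'cV[R[i]]_2) : Prop :=
  forall i : 'I_4,
    smooth_up_to_0 (fun t => complex.Re (fold_wedge h t i 0)) /\
    smooth_up_to_0 (fun t => complex.Im (fold_wedge h t i 0)).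

Section Matrices.
Variable R : realType.
Variables (lambda mu : R).
Implicit Types (z : R[i]) (theta : R).

Definition lame_c1 : R := mu / (2 * (lambda + 2 * mu)).
Definition lame_c2 : R := (lambda + mu) / (lambda + 2 * mu).

(* The 4 x 4 matrix with the given list of columns. *)
Definition mx_of_cols (T : nmodType) (cs : seq (seq T)) : 'M[T]_4 :=
  \matrix_(i, j) (nth [::] cs j)`_i.

Definition wedgeA z theta : 'M[R[i]]_4 :=
  let c1 := lame_c1%:C in
  let c2 := lame_c2%:C in
  let th := theta%:C in
  let piz := (pi : R)%:C * z in
  let S := csin (z * (pi - theta)%:C) in
  let C := ccos (z * (pi - theta)%:C) in
  let q := ccsc piz in
  let sth := (sin theta)%:C in
  let half := 2^-1 : R[i] in
  let quarter := 4^-1 : R[i] in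
  mx_of_cols
  [:: [:: - half;
          - (c1 * ccot piz);
          - (c1 * q * S) + quarter * c2 * q *
            (- (z + 2) * S + z * csin (piz - (z - 2) * th));
          - (c1 * q * C) +
            half * c2 * z * q * sth * csin (piz - (z - 1) * th)];
      [:: c1 * ccot piz;
          - half;
          c1 * q * C +
            half * c2 * z * q * sth * csin (piz - (z - 1) * th);
          - (c1 * q * S) + quarter * c2 * q *
            ((z - 2) * S - z * csin (piz - (z - 2) * th))];
      [:: - (c1 * q * S) + quarter * c2 * q *
            ((z - 2) * S - z * csin (piz - (z + 2) * th));
          c1 * q * C -
            half * c2 * z * q * sth * csin (piz - (z + 1) * th);
          - half;
          c1 * ccot piz];
      [:: - (c1 * q * C) -
            half * c2 * z * q * sth * csin (piz - (z + 1) * th);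
          - (c1 * q * S) + quarter * c2 * q *
            (- (z + 2) * S + z * csin (piz - (z + 2) * th));
          - (c1 * ccot piz);
          - half]].

Definition wedgeF0 z : 'M[R[i]]_4 :=
  let a := lame_c1%:C / ((pi : R)%:C * z) in
  (mx_of_cols [:: [:: 0; - a; 0; a];
                  [:: a; 0; - a; 0];
                  [:: 0; - a; 0; a];
                  [:: a; 0; - a; 0]])^T.

(* The closed form of F(k) with free constants c1, c2. *)
Definition wedgeF_form (c1 c2 : R) (k : nat) z theta : 'M[R[i]]_4 :=
  let kr := k%:R : R in
  let d := (pi : R)%:C * (k%:R - z) in
  let a := c1%:C / d in
  let sk := sin (kr * theta) in
  let ck := cos (kr * theta) in
  mx_of_cols
  [:: [:: 0;
          - a;
          (c2 * kr * sin ((kr - 2) * theta)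
            + (4 * c1 - c2 * (2 + kr)) * sk)%:C / (4 * d);
          - ((2 * c1 * ck
            + c2 * kr * sin theta * sin ((1 - kr) * theta))%:C / (2 * d))];
      [:: a;
          0;
          (2 * c1 * ck
            - c2 * kr * sin theta * sin ((1 - kr) * theta))%:C / (2 * d);
          (- (c2 * kr * sin ((kr - 2) * theta))
            + (4 * c1 + c2 * (kr - 2)) * sk)%:C / (4 * d)];
      [:: ((4 * c1 + c2 * (kr - 2)) * sk
            - c2 * kr * sin ((kr + 2) * theta))%:C / (4 * d);
          (2 * c1 * ck
            - c2 * kr * sin theta * sin ((1 + kr) * theta))%:C / (2 * d);
          0;
          a];
      [:: - ((2 * c1 * ck
            + c2 * kr * sin theta * sin ((1 + kr) * theta))%:C / (2 * d));
          ((4 * c1 - c2 * (2 + kr)) * sk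
            + c2 * kr * sin ((kr + 2) * theta))%:C / (4 * d);
          - a;
          0]].

(* Erratum. The source prints wedgeF_form lame_c1 lame_c2 k for k >= 4 and
   separate matrices for k = 1, 2, 3; both have wrong c2 terms. Already the
   trace of the upper right 2 x 2 block must be
   (2 c1 + c2) sin (k theta) / (pi (k - z)), since the trace of kernelD is
   (2 c1 + c2) (n . r) / (pi |r|^2) and
   t sin theta / (1 - 2 t cos theta + t^2) = \sum_k t^k sin (k theta).
   With -c2 in place of c2, the form printed for k >= 4 gives the right
   coefficient of t^k for every k >= 1. *)
Definition wedgeF (k : nat) z theta : 'M[R[i]]_4 :=
  if k is 0%N then wedgeF0 z
  else wedgeF_form lame_c1 (- lame_c2) k z theta.

End Matrices.

(* Main.v *)
Require Import Defs.
From mathcomp Require Import all_boot all_order all_algebra.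
From mathcomp Require Import all_classical all_reals all_analysis.
From mathcomp Require Import measurable_realfun ring lra.

(** Fix t in ]0, 1[ and put w = t e^(i theta). As a function of the position s of the
    source on its leg, the kernel is rational: on the leg of the target its only
    pole is t, and between different legs its poles are w and the conjugate of w,
    of order at most two. All integrals in the layer potential are therefore
    combinations of the Cauchy transform
      J(w) = \int_0^1 s^z / (s - w) ds
    at w and its conjugate ([cauchyJ]), of the corresponding integrals with a double
    pole, which integration by parts reduces to J, and of a principal value at t.
    The matrix [kernel_mx a b c d e] is linear in its five arguments and becomes the
    layer potential when these five integrals are inserted. The matrices A and F(k)
    are values of the same linear expression ([wedgeA_kernel], [wedgeF_kernel]), so
    the expansion reduces to a scalar identity, [mellin_formula],
      J(t e^(i x)) + \sum_k (t e^(i x))^k / (k - z)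
        = - pi csc(pi z) e^(i z (x - pi)) t^z,    0 < x < 2 pi,
    and to its principal value counterpart [mellin_pv].

    The identity needs no contour integration. As a function of the angle x, J solves
    a linear differential equation of first order with integrating factor
    e^(- i z x). Once the first N terms of the series are added, the product with the
    integrating factor has a derivative of size t^N ([cauchyE_derive]), so it is
    nearly constant on ]0, 2 pi[. Its limits at the two ends follow from the Plemelj
    formulas ([cauchyJ_right0]); that they nearly agree determines the sum at x = 0,
    and constancy then gives all other x. For the Plemelj formulas, s^z is written as
    t^z plus s - t times an integrable function: the second part is continuous at
    x = 0 by domination, since |s - t| <= |s - t e^(i x)|, and the first is an
    explicit logarithm.

    If h is smooth, then both h and the power series are polynomials in t up to
    O(t^n) for every n ([taylor_bigO0], [power_series_bigO0]), hence so is v t^z for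
    each entry v of A p. A dilation argument removes the monomials one by one without
    losing t^z ([cpow_partial_sum_eq0]), and v t^z = O(t^n) with n > Re z gives
    v = 0. Thus A p = 0, and det A = 0 because p is not zero.

    Finally A commutes with the reflection in the bisector of the wedge, so it splits
    into two 2 x 2 blocks, on symmetric and on antisymmetric vectors
    ([reflect_rows]). Their determinants are, up to the factor 4 sin(pi z)^2,
      (c2 z sin(theta) - e c2 sin((2 pi - theta) z))
        (c2 z sin(theta) - e (1 + 2 c1) sin(theta z)),    e = 1, -1
    ([det_factor]). One of them vanishes when A has a kernel, and the product of all
    four factors is c2^4 times the stated transcendental function. *)

Set Implicit Arguments.
Unset Strict Implicit.
Unset Printing Implicit Defensive.
Import Order.TTheory GRing.Theory Num.Theory.
Import numFieldNormedType.Exports.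
Local Open Scope classical_set_scope.
Local Open Scope ring_scope.
Local Open Scope complex_scope.
Local Notation Re := complex.Re.
Local Notation Im := complex.Im.
Local Notation cabs := ComplexField.Normc.normc.
#[local] Arguments cpow : simpl never.
#[local] Arguments cexp : simpl never.
#[local] Arguments ComplexField.Normc.normc : simpl never.

(** * Complex arithmetic through real and imaginary parts *)

Section ComplexArith.
Variable R : realType.
Implicit Types (x y z : R[i]).

Lemma eqc x y : Re x = Re y -> Im x = Im y -> x = y.
Proof. by case: x y => [a b] [c d] /= -> ->. Qed.

Lemma ReD x y : Re (x + y) = Re x + Re y. Proof. by case: x y => [a b] [c d]. Qed.
Lemma ImD x y : Im (x + y) = Im x + Im y. Proof. by case: x y => [a b] [c d]. Qed.
Lemma ReN x : Re (- x) = - Re x. Proof. by case: x. Qed.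
Lemma ImN x : Im (- x) = - Im x. Proof. by case: x. Qed.
Lemma ReB x y : Re (x - y) = Re x - Re y. Proof. by rewrite ReD ReN. Qed.
Lemma ImB x y : Im (x - y) = Im x - Im y. Proof. by rewrite ImD ImN. Qed.
Lemma ReM x y : Re (x * y) = Re x * Re y - Im x * Im y.
Proof. by case: x y => [a b] [c d]. Qed.
Lemma ImM x y : Im (x * y) = Re x * Im y + Im x * Re y.
Proof. by case: x y => [a b] [c d]. Qed.
Lemma Re_realM (a : R) x : Re (a%:C * x) = a * Re x.
Proof. by rewrite ReM /= mul0r subr0. Qed.
Lemma Im_realM (a : R) x : Im (a%:C * x) = a * Im x.
Proof. by rewrite ImM /= mul0r addr0. Qed.
Lemma ReV x : Re x^-1 = Re x / (Re x ^+ 2 + Im x ^+ 2).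
Proof. by case: x. Qed.
Lemma ImV x : Im x^-1 = - (Im x / (Re x ^+ 2 + Im x ^+ 2)).
Proof. by case: x. Qed.

Lemma cabsE x : cabs x = Num.sqrt (Re x ^+ 2 + Im x ^+ 2).
Proof. by case: x. Qed.
Lemma sqr_cabs x : cabs x ^+ 2 = Re x ^+ 2 + Im x ^+ 2.
Proof. by rewrite cabsE sqr_sqrtr // addr_ge0 ?sqr_ge0. Qed.
Lemma cabs_ge0 x : 0 <= cabs x. Proof. by rewrite cabsE sqrtr_ge0. Qed.
Lemma cabsM x y : cabs (x * y) = cabs x * cabs y.
Proof. exact: ComplexField.Normc.normcM. Qed.
Lemma cabsV x : cabs x^-1 = (cabs x)^-1.
Proof. exact: ComplexField.Normc.normcV. Qed.
Lemma cabsD x y : cabs (x + y) <= cabs x + cabs y.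
Proof. exact: le_normcD. Qed.
Lemma cabsN x : cabs (- x) = cabs x. Proof. by rewrite !cabsE ReN ImN !sqrrN. Qed.
Lemma cabs_distC x y : cabs (x - y) = cabs (y - x).
Proof. by rewrite -cabsN opprB. Qed.
Lemma cabs_real (a : R) : cabs a%:C = `|a|.
Proof. by rewrite cabsE /= expr0n addr0 sqrtr_sqr. Qed.
Lemma cabs0 : cabs (0 : R[i]) = 0. Proof. by rewrite -[0]/((0 : R)%:C) cabs_real normr0. Qed.
Lemma cabs1 : cabs (1 : R[i]) = 1. Proof. by rewrite -[1]/((1 : R)%:C) cabs_real normr1. Qed.
Lemma cabsX x n : cabs (x ^+ n) = cabs x ^+ n.
Proof. by elim: n => [|n IH]; rewrite ?cabs1 // !exprS cabsM IH. Qed.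
Lemma cabs_eq0 x : (cabs x == 0) = (x == 0).
Proof.
apply/eqP/eqP => [/ComplexField.Normc.eq0_normc //|->]; exact: cabs0.
Qed.
Lemma cabs_gt0 x : (0 < cabs x) = (x != 0).
Proof. by rewrite lt_neqAle cabs_ge0 andbT eq_sym cabs_eq0. Qed.
Lemma normRe_le x : `|Re x| <= cabs x.
Proof. by rewrite cabsE -sqrtr_sqr ler_wsqrtr // lerDl sqr_ge0. Qed.
Lemma normIm_le x : `|Im x| <= cabs x.
Proof. by rewrite cabsE -sqrtr_sqr ler_wsqrtr // lerDr sqr_ge0. Qed.
Lemma cabs_le x : cabs x <= `|Re x| + `|Im x|.
Proof.
rewrite cabsE -[leRHS]ger0_norm ?addr_ge0 // -sqrtr_sqr ler_wsqrtr //.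
rewrite sqrrD !real_normK ?num_real // lerD2r lerDl.
by rewrite mulrn_wge0 ?mulr_ge0.
Qed.

(** * The complex exponential *)

Lemma cexp0 : cexp (0 : R[i]) = 1.
Proof. by rewrite /cexp /= expR0 cos0 sin0 mul1r. Qed.

Lemma cexpD x y : cexp (x + y) = cexp x * cexp y.
Proof.
rewrite /cexp ReD ImD expRD cosD sinD.
by apply: eqc; rewrite !(ReM, ImM) /=; ring.
Qed.

Lemma cexpN_mul x : cexp x * cexp (- x) = 1.
Proof. by rewrite -cexpD subrr cexp0. Qed.

Lemma cexp_neq0 x : cexp x != 0.
Proof.
by apply/eqP => x0; move: (cexpN_mul x); rewrite x0 mul0r => /esym/eqP;
  rewrite oner_eq0.
Qed.

Lemma cexpN x : cexp (- x) = (cexp x)^-1.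
Proof.
by apply: (mulfI (cexp_neq0 x)); rewrite cexpN_mul divff // cexp_neq0.
Qed.

Lemma cexpMn x n : cexp (n%:R * x) = cexp x ^+ n.
Proof.
elim: n => [|n IH]; first by rewrite mul0r cexp0.
by rewrite -natr1 mulrDl mul1r cexpD IH exprSr.
Qed.

Lemma cabs_cexp x : cabs (cexp x) = expR (Re x).
Proof.
rewrite /cexp cabsM cabs_real ger0_norm ?expR_ge0 // cabsE /=.
by rewrite cos2Dsin2 sqrtr1 mulr1.
Qed.

Lemma cexp_i (a : R) : cexp ('i * a%:C) = cos a +i* sin a.
Proof.
rewrite /cexp !(ReM, ImM) /= !(mul0r, mulr0, mul1r, mulr1, subr0, add0r, addr0).
by rewrite oppr0 expR0 mul1r.
Qed.

Lemma cexp_Ni (a : R) : cexp (- ('i * a%:C)) = cos a -i* sin a.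
Proof.
by rewrite -mulrN -rmorphN cexp_i cosN sinN.
Qed.

Lemma mulii : 'i * 'i = -1 :> R[i].
Proof. by rewrite -expr2 sqr_i. Qed.

Lemma cabs_i : cabs ('i : R[i])%R = 1.
Proof. by rewrite cabsE /= expr0n expr1n add0r sqrtr1. Qed.

Lemma i_neq0 : 'i != 0 :> R[i].
Proof. by rewrite eq_complex /= oner_eq0 andbF. Qed.

Lemma two_neq0 : 2 != 0 :> R[i]. Proof. by rewrite pnatr_eq0. Qed.

Lemma cabs_cpow (s : R) z : cabs (cpow s z) = expR (Re z * ln s).
Proof. by rewrite cabs_cexp ReM /= mulr0 subr0. Qed.

Lemma cpowD1 (s : R) z : 0 < s -> cpow s (z + 1) = s%:C * cpow s z.
Proof.
move=> s0; rewrite /cpow mulrDl mul1r cexpD mulrC; congr (_ * _).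
by rewrite /cexp /= sin0 cos0 lnK ?posrE // mulr1.
Qed.

End ComplexArith.

(** * Componentwise limits and derivatives *)

(** Stated on the two parts, so that the theory of limits of real functions applies. *)
Definition ccvg (R : realType) (T : Type) (F : set_system T) (f : T -> R[i])
    (l : R[i]) : Prop :=
  (Re (f x) @[x --> F] --> Re l) /\ (Im (f x) @[x --> F] --> Im l).

Section ComplexCvg.
Variable R : realType.
Variables (T : Type) (F : set_system T).
Context {FF : Filter F}.
Implicit Types (f g : T -> R[i]) (l m : R[i]).

Lemma cvg_sqr (h : T -> R) (a : R) : h x @[x --> F] --> a ->
  h x ^+ 2 @[x --> F] --> a ^+ 2.
Proof. by move=> ha; exact: (cvg_comp _ _ ha (@exprn_continuous _ 2 a)). Qed.

Lemma ccvg_cst l : ccvg F (fun=> l) l.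
Proof. by split; exact: cvg_cst. Qed.

Lemma ccvg_real (h : T -> R) (a : R) : h x @[x --> F] --> a ->
  ccvg F (fun x => (h x)%:C) a%:C.
Proof. by move=> ha; split => //=; exact: cvg_cst. Qed.

Lemma ccvgD f g l m : ccvg F f l -> ccvg F g m -> ccvg F (fun x => f x + g x) (l + m).
Proof.
move=> [fl1 fl2] [gm1 gm2]; split.
- by rewrite ReD; under eq_fun do rewrite ReD; exact: cvgD.
- by rewrite ImD; under eq_fun do rewrite ImD; exact: cvgD.
Qed.

Lemma ccvgN f l : ccvg F f l -> ccvg F (fun x => - f x) (- l).
Proof.
move=> [fl1 fl2]; split.
- by rewrite ReN; under eq_fun do rewrite ReN; exact: cvgN.
- by rewrite ImN; under eq_fun do rewrite ImN; exact: cvgN.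
Qed.

Lemma ccvgB f g l m : ccvg F f l -> ccvg F g m -> ccvg F (fun x => f x - g x) (l - m).
Proof. by move=> fl gm; apply: ccvgD => //; exact: ccvgN. Qed.

Lemma ccvgM f g l m : ccvg F f l -> ccvg F g m -> ccvg F (fun x => f x * g x) (l * m).
Proof.
move=> [fl1 fl2] [gm1 gm2]; split.
- by rewrite ReM; under eq_fun do rewrite ReM; apply: cvgB; exact: cvgM.
- by rewrite ImM; under eq_fun do rewrite ImM; apply: cvgD; exact: cvgM.
Qed.

Lemma ccvgMl f l m : ccvg F f l -> ccvg F (fun x => m * f x) (m * l).
Proof. by apply: ccvgM; exact: ccvg_cst. Qed.

Lemma ccvgV f l : l != 0 -> ccvg F f l -> ccvg F (fun x => (f x)^-1) l^-1.
Proof.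
move=> l0 [fl1 fl2].
have n0 : Re l ^+ 2 + Im l ^+ 2 != 0 by rewrite -sqr_cabs expf_neq0 // cabs_eq0.
have n1 : (Re (f x) ^+ 2 + Im (f x) ^+ 2)^-1 @[x --> F] -->
    (Re l ^+ 2 + Im l ^+ 2)^-1.
  by apply: cvgV => //; apply: cvgD; exact: cvg_sqr.
split.
- by rewrite ReV; under eq_fun do rewrite ReV; exact: cvgM.
- by rewrite ImV; under eq_fun do rewrite ImV; apply: cvgN; exact: cvgM.
Qed.

Lemma ccvgX f l n : ccvg F f l -> ccvg F (fun x => f x ^+ n) (l ^+ n).
Proof.
move=> fl; elim: n => [|n IH]; first exact: ccvg_cst.
by under eq_fun do rewrite exprS; rewrite exprS; exact: ccvgM.
Qed.

Lemma ccvg_sum (I : Type) (r : seq I) (f : I -> T -> R[i]) (l : I -> R[i]) :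
  (forall i, ccvg F (f i) (l i)) ->
  ccvg F (fun x => \sum_(i <- r) f i x) (\sum_(i <- r) l i).
Proof.
move=> fl; elim: r => [|i r IH].
  by rewrite big_nil; under eq_fun do rewrite big_nil; exact: ccvg_cst.
by rewrite big_cons; under eq_fun do rewrite big_cons; exact: ccvgD.
Qed.

Lemma ccvg_unique {PF : ProperFilter F} f l m : ccvg F f l -> ccvg F f m -> l = m.
Proof.
move=> [fl1 fl2] [fm1 fm2]; apply: eqc.
- by apply: cvg_unique fl1 fm1 => //; exact: Rhausdorff.
- by apply: cvg_unique fl2 fm2 => //; exact: Rhausdorff.
Qed.

Lemma ccvg_cexp f l : ccvg F f l -> ccvg F (fun x => cexp (f x)) (cexp l).
Proof.
move=> [fl1 fl2]; apply: ccvgM.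
  apply: ccvg_real; exact: (cvg_comp _ _ fl1 (@continuous_expR R _)).
split => /=.
  exact: (cvg_comp _ _ fl2 (@continuous_cos R _)).
exact: (cvg_comp _ _ fl2 (@continuous_sin R _)).
Qed.

Lemma ccvg_squeeze f (b : T -> R) l : (\forall x \near F, cabs (f x - l) <= b x) ->
  b x @[x --> F] --> 0 -> ccvg F f l.
Proof.
move=> fb b0.
have h (g : T -> R) (a : R) :
    (\forall x \near F, `|g x - a| <= b x) -> g x @[x --> F] --> a.
  move=> ga; apply/cvgrPdist_lt => e e0.
  have bn := (cvgr0Pnorm_lt _).1 b0 _ e0; near=> x.
  rewrite distrC (@le_lt_trans _ _ (b x)) //; first by near: x; exact: ga.
  by rewrite (@le_lt_trans _ _ `|b x|) ?ler_norm //; near: x; exact: bn.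
split; apply: h; near=> x.
- rewrite -ReB (le_trans (normRe_le _)) //; near: x; exact: fb.
- rewrite -ImB (le_trans (normIm_le _)) //; near: x; exact: fb.
Unshelve. all: by end_near. Qed.

Lemma ccvg_cabs f l : ccvg F f l -> cabs (f x) @[x --> F] --> cabs l.
Proof.
move=> [fl1 fl2]; rewrite cabsE; under eq_fun do rewrite cabsE.
have h : (Re (f x) ^+ 2 + Im (f x) ^+ 2) @[x --> F] --> Re l ^+ 2 + Im l ^+ 2.
  exact: (cvgD (cvg_sqr fl1) (cvg_sqr fl2)).
exact: (cvg_comp _ _ h (@sqrt_continuous R _)).
Qed.

End ComplexCvg.

Definition is_cderive (R : realType) (x : R) (f : R -> R[i]) (l : R[i]) : Prop :=
  is_derive x 1 (fun u => Re (f u)) (Re l) /\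
  is_derive x 1 (fun u => Im (f u)) (Im l).

Section ComplexDerive.
Variable R : realType.
Implicit Types (f g : R -> R[i]) (x : R) (l m : R[i]).

Lemma is_cderive_cst x l : is_cderive x (fun=> l) 0.
Proof. by split; exact: is_derive_cst. Qed.

Lemma is_cderive_real x (h : R -> R) (a : R) : is_derive x 1 h a ->
  is_cderive x (fun u => (h u)%:C) a%:C.
Proof. by move=> ha; split => //=; exact: is_derive_cst. Qed.

Lemma is_cderiveD x f g l m : is_cderive x f l -> is_cderive x g m ->
  is_cderive x (fun u => f u + g u) (l + m).
Proof.
move=> [fl1 fl2] [gm1 gm2]; split.
- by rewrite ReD; under eq_fun do rewrite ReD; exact: is_deriveD.
- by rewrite ImD; under eq_fun do rewrite ImD; exact: is_deriveD.
Qed.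

Lemma is_cderiveM x f g l m : is_cderive x f l -> is_cderive x g m ->
  is_cderive x (fun u => f u * g u) (l * g x + f x * m).
Proof.
move=> [fl1 fl2] [gm1 gm2]; split.
- under eq_fun do rewrite ReM.
  have d1 := is_deriveM fl1 gm1; have d2 := is_deriveM fl2 gm2.
  apply: is_derive_eq (is_deriveB d1 d2) _.
  by rewrite !(ReD, ReM) /GRing.scale /=; ring.
- under eq_fun do rewrite ImM.
  have d1 := is_deriveM fl1 gm2; have d2 := is_deriveM fl2 gm1.
  apply: is_derive_eq (is_deriveD d1 d2) _.
  by rewrite !(ImD, ImM) /GRing.scale /=; ring.
Qed.

Lemma is_cderive_eq x f l m : is_cderive x f l -> l = m -> is_cderive x f m.
Proof. by move=> ? <-. Qed.

Lemma is_cderiveMl x f l m : is_cderive x f l -> is_cderive x (fun u => m * f u) (m * l).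
Proof.
move=> fl; apply: is_cderive_eq (is_cderiveM (is_cderive_cst x m) fl) _.
by rewrite mul0r add0r.
Qed.

Lemma is_cderiveN x f l : is_cderive x f l -> is_cderive x (fun u => - f u) (- l).
Proof.
move=> [fl1 fl2]; split.
- by rewrite ReN; under eq_fun do rewrite ReN; exact: is_deriveN.
- by rewrite ImN; under eq_fun do rewrite ImN; exact: is_deriveN.
Qed.

Lemma is_cderiveB x f g l m : is_cderive x f l -> is_cderive x g m ->
  is_cderive x (fun u => f u - g u) (l - m).
Proof. by move=> fl gm; apply: is_cderiveD => //; exact: is_cderiveN. Qed.

Lemma is_cderiveV x f l : f x != 0 -> is_cderive x f l ->
  is_cderive x (fun u => (f u)^-1) (- l / f x ^+ 2).
Proof.
move=> fx0 [fl1 fl2].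
have n0 : Re (f x) ^+ 2 + Im (f x) ^+ 2 != 0.
  by rewrite -sqr_cabs expf_neq0 // cabs_eq0.
have dn := is_deriveD (is_deriveM fl1 fl1) (is_deriveM fl2 fl2).
rewrite [X in is_derive _ _ X](_ : _ =
  (fun u => Re (f u) ^+ 2 + Im (f u) ^+ 2)) in dn; last first.
  by apply/funext => u /=; rewrite !expr2.
have dV := @is_deriveV _ (fun u => Re (f u) ^+ 2 + Im (f u) ^+ 2) _ _ _ n0 dn.
split.
- under eq_fun do rewrite ReV.
  apply: is_derive_eq (is_deriveM fl1 dV) _.
  rewrite /GRing.scale /= -[(f x ^+ 2)^-1]exprVn [_^-1 ^+ 2]expr2 !(ReM, ImM, ReN, ImN, ReV, ImV).
  by field.
- under eq_fun do rewrite ImV.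
  apply: is_derive_eq (is_deriveN (is_deriveM fl2 dV)) _.
  rewrite /GRing.scale /= -[(f x ^+ 2)^-1]exprVn [_^-1 ^+ 2]expr2 !(ReM, ImM, ReN, ImN, ReV, ImV).
  by field.
Qed.

Lemma is_cderive_cexp x f l : is_cderive x f l ->
  is_cderive x (fun u => cexp (f u)) (l * cexp (f x)).
Proof.
move=> [fl1 fl2].
have de := is_derive1_comp (@is_derive_expR R (Re (f x))) fl1.
have dc := is_derive1_comp (@is_derive_cos R (Im (f x))) fl2.
have ds := is_derive1_comp (@is_derive_sin R (Im (f x))) fl2.
split.
- under eq_fun do rewrite /cexp ReM /= mul0r subr0.
  apply: is_derive_eq (is_deriveM de dc) _.
  by rewrite /cexp /GRing.scale /= !(ReM, ImM) /=; ring.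
- under eq_fun do rewrite /cexp ImM /= mul0r addr0.
  apply: is_derive_eq (is_deriveM de ds) _.
  by rewrite /cexp /GRing.scale /= !(ReM, ImM) /=; ring.
Qed.

Lemma is_cderive_cpow (s : R) z : 0 < s ->
  is_cderive s (fun u => cpow u z) (z * cpow s z / s%:C).
Proof.
move=> s0; have d1 := is_cderive_real (is_derive1_ln s0).
apply: is_cderive_eq (is_cderive_cexp (is_cderiveMl z d1)) _.
by rewrite /cpow rmorphV ?unitfE ?gt_eqF //; ring.
Qed.

Lemma is_cderive_ccvg x f l : is_cderive x f l -> ccvg (nbhs x) f (f x).
Proof.
move=> [[d1 _] [d2 _]]; split.
- exact/differentiable_continuous/derivable1_diffP.
- exact/differentiable_continuous/derivable1_diffP.
Qed.

(** There is no mean value theorem for complex values; bounding the two parts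
    separately costs the factor 2. *)
Lemma cmvt_bound f (df : R -> R[i]) (a b M : R) : a <= b ->
  (forall x, a <= x <= b -> is_cderive x f (df x)) ->
  (forall x, a <= x <= b -> cabs (df x) <= M) ->
  cabs (f b - f a) <= 2 * M * (b - a).
Proof.
move=> ab fdf dfM.
have h (g dg : R -> R) : (forall x, a <= x <= b -> is_derive x 1 g (dg x)) ->
    (forall x, a <= x <= b -> `|dg x| <= M) -> `|g b - g a| <= M * (b - a).
  move=> gdg dgM; have [||c cab ->] := @MVT_segment _ g dg a b ab.
  - by move=> x; rewrite in_itv /= => /andP[ax xb]; apply: gdg; rewrite !ltW.
  - apply: derivable_within_continuous => x; rewrite in_itv /= => xab.
    by have [] := gdg x xab.
  - move: cab; rewrite in_itv /= => cab.
    by rewrite normrM (@ger0_norm _ (b - a)) ?subr_ge0 // ler_wpM2r ?subr_ge0 ?dgM.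
apply: le_trans (cabs_le _) _; rewrite ReB ImB.
have -> : 2 * M * (b - a) = M * (b - a) + M * (b - a) by ring.
apply: lerD.
- apply: (h (fun x => Re (f x)) (fun x => Re (df x))) => x xab; first by case: (fdf x xab).
  exact: le_trans (normRe_le _) (dfM _ xab).
- apply: (h (fun x => Im (f x)) (fun x => Im (df x))) => x xab; first by case: (fdf x xab).
  exact: le_trans (normIm_le _) (dfM _ xab).
Qed.

End ComplexDerive.

(** * Complex-valued Lebesgue integrals *)

Section ComplexIntegral.
Variable R : realType.
Notation mu := (@lebesgue_measure R).
Implicit Types (D E : set R) (f g : R -> R[i]).

Lemma cintegrableS D E f : measurable D -> measurable E -> D `<=` E ->
  cintegrable E f -> cintegrable D f.
Proof. by move=> mD mE DE [h1 h2]; split; [apply: integrableS h1|apply: integrableS h2].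
Qed.

Lemma eq_cintegrable D f g : measurable D -> {in D, f =1 g} ->
  cintegrable D f -> cintegrable D g.
Proof.
move=> mD fg [h1 h2]; split.
- by apply: eq_integrable h1 => // s sD /=; rewrite fg.
- by apply: eq_integrable h2 => // s sD /=; rewrite fg.
Qed.

Lemma eq_cintegral D f g : {in D, f =1 g} -> cintegral D f = cintegral D g.
Proof.
move=> fg; rewrite /cintegral; congr (_ +i* _).
- by apply: eq_Rintegral => s sD; rewrite fg.
- by apply: eq_Rintegral => s sD; rewrite fg.
Qed.

Lemma cintegrableD D f g : measurable D -> cintegrable D f -> cintegrable D g ->
  cintegrable D (fun s => f s + g s).
Proof.
move=> mD [f1 f2] [g1 g2]; split.
- rewrite (_ : _ \o _ = ((EFin \o (fun s => Re (f s))) \+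
    (EFin \o (fun s => Re (g s))))%E); last by apply/funext => s /=; rewrite ReD.
  exact: integrableD.
- rewrite (_ : _ \o _ = ((EFin \o (fun s => Im (f s))) \+
    (EFin \o (fun s => Im (g s))))%E); last by apply/funext => s /=; rewrite ImD.
  exact: integrableD.
Qed.

Lemma cintegralD D f g : measurable D -> cintegrable D f -> cintegrable D g ->
  cintegral D (fun s => f s + g s) = cintegral D f + cintegral D g.
Proof.
move=> mD [f1 f2] [g1 g2]; apply: eqc; rewrite ?ReD ?ImD /=.
- by under eq_Rintegral do rewrite ReD; rewrite RintegralD.
- by under eq_Rintegral do rewrite ImD; rewrite RintegralD.
Qed.

Lemma cintegrableZ D f (a : R[i]) : measurable D -> cintegrable D f ->
  cintegrable D (fun s => a * f s).
Proof.
move=> mD [f1 f2]; split.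
- rewrite (_ : _ \o _ = (fun s => (Re a)%:E * (EFin \o (fun s => Re (f s))) s) \-
    (fun s => (Im a)%:E * (EFin \o (fun s => Im (f s))) s))%E; last first.
    by apply/funext => s /=; rewrite ReM.
  by apply: integrableB => //; exact: integrableZl.
- rewrite (_ : _ \o _ = (fun s => (Re a)%:E * (EFin \o (fun s => Im (f s))) s) \+
    (fun s => (Im a)%:E * (EFin \o (fun s => Re (f s))) s))%E; last first.
    by apply/funext => s /=; rewrite ImM.
  by apply: integrableD => //; exact: integrableZl.
Qed.

Lemma integrable_scale D (h : R -> R) (a : R) : measurable D ->
  mu.-integrable D (EFin \o h) -> mu.-integrable D (EFin \o (fun s => a * h s)).
Proof.
move=> mD ih; rewrite (_ : _ \o _ = (fun s => a%:E * (EFin \o h) s)%E) //.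
exact: integrableZl.
Qed.

Lemma cintegralZ D f (a : R[i]) : measurable D -> cintegrable D f ->
  cintegral D (fun s => a * f s) = a * cintegral D f.
Proof.
move=> mD [f1 f2]; apply: eqc; rewrite ?ReM ?ImM /=.
- under eq_Rintegral do rewrite ReM.
  by rewrite RintegralB ?RintegralZl //; exact: integrable_scale.
- under eq_Rintegral do rewrite ImM.
  by rewrite RintegralD ?RintegralZl //; exact: integrable_scale.
Qed.

Lemma cintegrableN D f : measurable D -> cintegrable D f ->
  cintegrable D (fun s => - f s).
Proof.
move=> mD fi; apply: (@eq_cintegrable _ (fun s => -1 * f s)) => //.
- by move=> s _; rewrite mulN1r.
- exact: cintegrableZ.
Qed.

Lemma cintegralN D f : measurable D -> cintegrable D f ->
  cintegral D (fun s => - f s) = - cintegral D f.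
Proof.
move=> mD fi; rewrite -mulN1r -cintegralZ //.
by apply: eq_cintegral => s _; rewrite mulN1r.
Qed.

Lemma cintegrableB D f g : measurable D -> cintegrable D f -> cintegrable D g ->
  cintegrable D (fun s => f s - g s).
Proof. by move=> mD fi gi; apply: cintegrableD => //; exact: cintegrableN. Qed.

Lemma cintegralB D f g : measurable D -> cintegrable D f -> cintegrable D g ->
  cintegral D (fun s => f s - g s) = cintegral D f - cintegral D g.
Proof.
by move=> mD fi gi; rewrite cintegralD ?cintegralN //; exact: cintegrableN.
Qed.

Lemma cintegrable_setU D E f : measurable D -> measurable E ->
  cintegrable D f -> cintegrable E f -> cintegrable (D `|` E) f.
Proof.
move=> mD mE [d1 d2] [e1 e2].
have h (k : R -> R) : mu.-integrable D (EFin \o k) ->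
    mu.-integrable E (EFin \o k) -> mu.-integrable (D `|` E) (EFin \o k).
  move=> /integrableP[m1 i1] /integrableP[m2 i2]; apply/integrableP; split.
    by apply/measurable_funU.
  have mDE : measurable (D `|` E) by exact: measurableU.
  apply: (@le_lt_trans _ _
    (\int[mu]_(x in D) `|(EFin \o k) x| + \int[mu]_(x in E) `|(EFin \o k) x|))%E.
    have eDE : D `|` (E `\` D) = D `|` E.
      apply/seteqP; split => s /=; first by move=> [|[]]; [left|right].
      by move=> [|Es]; [left|have [|] := pselect (D s); [left|right]].
    rewrite -eDE ge0_integral_setU //.
    - apply: leeD => //; apply: ge0_subset_integral => //.
        exact: measurableD.
      by apply: measurableT_comp.
    - exact: measurableD.
    - by rewrite eDE; apply: measurableT_comp => //; exact/measurable_funU.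
    - by apply/disj_setPS => s [sD [_ nsD]].
  by rewrite lte_add_pinfty.
by split; exact: h.
Qed.

Lemma cintegral_setU D E f : measurable D -> measurable E ->
  cintegrable D f -> cintegrable E f -> [disjoint D & E] ->
  cintegral (D `|` E) f = cintegral D f + cintegral E f.
Proof.
move=> mD mE fD fE DE; have [u1 u2] := cintegrable_setU mD mE fD fE.
by apply: eqc; rewrite ?ReD ?ImD /= Rintegral_setU.
Qed.

(** The factor f carries the singularities; the bounded factor g need only be
    measurable. *)
Lemma cintegrable_bounded_mul D f g (M : R) : measurable D -> cintegrable D f ->
  measurable_fun D (fun s => Re (g s)) -> measurable_fun D (fun s => Im (g s)) ->
  (forall s, D s -> cabs (g s) <= M) ->
  cintegrable D (fun s => f s * g s).
Proof.
move=> mD [f1 f2] m1 m2 gM.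
have b (h : R -> R) : (forall s, D s -> `|h s| <= cabs (g s)) -> [bounded h s | s in D].
  move=> hg; exists M; split; first exact: num_real.
  move=> N MN s /= Ds; rewrite (le_trans (hg s Ds)) // (le_trans (gM s Ds)) //.
  exact: ltW.
have b1 : [bounded Re (g s) | s in D] by apply: b => s _; exact: normRe_le.
have b2 : [bounded Im (g s) | s in D] by apply: b => s _; exact: normIm_le.
split.
- rewrite (_ : _ \o _ = ((EFin \o (fun s => Re (f s))) \* (EFin \o (fun s => Re (g s))))
    \- ((EFin \o (fun s => Im (f s))) \* (EFin \o (fun s => Im (g s)))))%E; last first.
    by apply/funext => s /=; rewrite ReM.
  by apply: integrableB => //; exact: integrableMl.
- rewrite (_ : _ \o _ = ((EFin \o (fun s => Re (f s))) \* (EFin \o (fun s => Im (g s))))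
    \+ ((EFin \o (fun s => Im (f s))) \* (EFin \o (fun s => Re (g s)))))%E; last first.
    by apply/funext => s /=; rewrite ImM.
  by apply: integrableD => //; exact: integrableMl.
Qed.

Lemma cintegrable_continuous (a b : R) f :
  (forall s, a <= s <= b -> ccvg (nbhs s) f (f s)) -> cintegrable `[a, b] f.
Proof.
move=> cf; split.
- apply: continuous_compact_integrable; first exact: segment_compact.
  by apply: continuous_in_subspaceT => s /[!inE] /=; rewrite in_itv => /cf[].
- apply: continuous_compact_integrable; first exact: segment_compact.
  by apply: continuous_in_subspaceT => s /[!inE] /=; rewrite in_itv => /cf[].
Qed.

Lemma cFTC (F f : R -> R[i]) (a b : R) : a < b ->
  (forall s, a <= s <= b -> is_cderive s F (f s)) ->
  (forall s, a <= s <= b -> ccvg (nbhs s) f (f s)) ->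
  cintegral `[a, b] f = F b - F a.
Proof.
move=> ab dF cf.
have h (G g : R -> R) : (forall s, a <= s <= b -> is_derive s 1 G (g s)) ->
   (forall s, a <= s <= b -> g x @[x --> s] --> g s) ->
   \int[mu]_(s in `[a, b]) g s = G b - G a.
  move=> dG cg; rewrite /Rintegral (@continuous_FTC2 _ g G) //.
  - by apply: continuous_in_subspaceT => s /[!inE] /=; rewrite in_itv => /cg.
  - have cG s : a <= s <= b -> {for s, continuous G}.
      move=> /dG[d _]; exact/differentiable_continuous/derivable1_diffP.
    split.
    + by move=> s; rewrite in_itv /= => /andP[a1 b1]; case: (dG s) => //; rewrite !ltW.
    + apply: cvg_at_right_filter; apply: cG; rewrite lexx ltW //.
    + apply: cvg_at_left_filter; apply: cG; rewrite lexx ltW //.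
  - move=> s; rewrite in_itv /= => /andP[a1 b1]; rewrite derive1E.
    by apply: derive_val; apply: dG; rewrite !ltW.
apply: eqc; rewrite ?ReB ?ImB /=.
- by apply: (h (fun s => Re (F s))) => s sab; [case: (dF s sab)|case: (cf s sab)].
- by apply: (h (fun s => Im (F s))) => s sab; [case: (dF s sab)|case: (cf s sab)].
Qed.

Lemma cintegral_cvg_left (a b : R) f : a < b -> cintegrable `[a, b] f ->
  ccvg a^'+ (fun x => cintegral `[x, b] f) (cintegral `[a, b] f).
Proof.
move=> ab [f1 f2].
have h (g : R -> R) : mu.-integrable `[a, b] (EFin \o g) ->
   (\int[mu]_(s in `[x, b]) g s) @[x --> a^'+] --> \int[mu]_(s in `[a, b]) g s.
  move=> ig; have c0 := parameterized_integral_cvg_left ab ig.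
  have c1 : (\int[mu]_(s in `[a, b]) g s - parameterized_integral mu a x g)
      @[x --> a^'+] --> \int[mu]_(s in `[a, b]) g s - 0.
    by apply: cvgB; [exact: cvg_cst|exact: cvg_at_right_filter].
  rewrite subr0 in c1; apply: cvg_trans c1; apply: near_eq_cvg; near=> x.
  have ax : a < x by near: x; exact: nbhs_right_gt.
  have xb : x < b by near: x; exact: nbhs_right_lt.
  rewrite /parameterized_integral Rintegral_itvB ?bnd_simp //; last exact: ltW.
  rewrite Rintegral_itv_obnd_cbnd //.
  apply: integrableS ig => //; apply: subset_itvr; rewrite bnd_simp; exact: ltW.
by split; exact: h.
Unshelve. all: by end_near. Qed.

Lemma cintegral_reflect D f : measurable D ->
  cintegrable (-%R @^-1` D) (fun s => f (- s)) ->
  cintegrable D f /\ cintegral D f = cintegral (-%R @^-1` D) (fun s => f (- s)).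
Proof.
move=> mD [i1 i2].
pose D' : set R := -%R @^-1` D.
have mN : measurable_fun [set: R] (-%R : R -> R) by [].
have mD' : measurable D' by rewrite -[D']setTI; exact: mN.
have h (g : R -> R) : mu.-integrable D' (EFin \o (fun s => g (- s))) ->
    mu.-integrable D (EFin \o g) /\
    \int[mu]_(s in D) g s = \int[mu]_(s in D') g (- s).
  move=> ig.
  have mg : measurable_fun D g.
    have mgN : measurable_fun D' (fun s => g (- s)).
      by move/integrableP: (ig) => [/measurable_EFinP].
    rewrite (_ : g = (fun s => g (- s)) \o -%R); last first.
      by apply/funext => s /=; rewrite opprK.
    apply: (measurable_comp mD' _ mgN) => //.
    by move=> _ [s Ds <-]; rewrite /D' /= opprK.
  pose G := (EFin \o g) \_ D.
  have mG : measurable_fun [set: R] G.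
    by apply/(measurable_restrictT _ mD)/measurable_EFinP.
  have GD s : D s -> G s = (g s)%:E by move=> Ds; rewrite /G patchE mem_set.
  have iG : mu.-integrable D' (G \o -%R).
    by apply: eq_integrable ig => // s /[!inE] Ds /=; rewrite GD.
  have phi : forall f1 : R -> \bar R, (\int[pushforward mu (-%R : R -> measurableTypeR R)]_(s in D) f1 s =
      \int[mu]_(s in D) f1 s)%E.
    move=> f1; apply: eq_measure_integral => A mA _; exact: lebesgue_measureN.
  have ip := @integrable_pushforward _ _ (measurableTypeR R) (measurableTypeR R) R (-%R) mN mu D G mG iG mD.
  have eip := @integral_pushforward _ _ (measurableTypeR R) (measurableTypeR R) R (-%R) mN mu D G mG iG mD.
  split.
    apply/integrableP; split; first exact/measurable_EFinP.
    move/integrableP: ip => [_]; rewrite phi.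
    rewrite (_ : (\int[mu]_(x in D) `|G x| = \int[mu]_(x in D) `|(EFin \o g) x|)%E) //.
    by apply: eq_integral => s /[!inE] Ds; rewrite GD.
  rewrite /Rintegral; congr fine.
  transitivity (\int[mu]_(s in D) G s)%E.
    by apply: eq_integral => s /[!inE] Ds; rewrite GD.
  rewrite -phi eip; apply: eq_integral => s /[!inE] Ds /=; exact: GD.
have [? e1] := h (fun s => Re (f s)) i1; have [? e2] := h (fun s => Im (f s)) i2.
by split=> //; rewrite /cintegral e1 e2.
Qed.

End ComplexIntegral.

(** * The weight s^z on the unit interval *)

Section PowerWeight.
Variable R : realType.
Notation mu := (@lebesgue_measure R).
Implicit Types (s t : R) (z : R[i]).

Lemma cpow_polar s z : cpow s z =
  (expR (Re z * ln s))%:C * (cos (Im z * ln s) +i* sin (Im z * ln s)).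
Proof.
rewrite /cpow (_ : z * (ln s)%:C = (Re z * ln s) +i* (Im z * ln s)) //.
by apply: eqc; rewrite ?(ReM, ImM) /=; ring.
Qed.

Lemma Re_cpow s z : Re (cpow s z) = expR (Re z * ln s) * cos (Im z * ln s).
Proof. by rewrite cpow_polar ReM /= mul0r subr0. Qed.

Lemma Im_cpow s z : Im (cpow s z) = expR (Re z * ln s) * sin (Im z * ln s).
Proof. by rewrite cpow_polar ImM /= mul0r addr0. Qed.

Lemma measurable_Re_cpow z (D : set R) : measurable_fun D (fun s => Re (cpow s z)).
Proof.
apply: measurable_funTS; under eq_fun do rewrite Re_cpow.
have ml c : measurable_fun [set: R] (fun s : R => c * ln s).
  by apply: measurable_funM => //; exact: measurable_ln.
apply: measurable_funM.
  exact: measurableT_comp (@measurable_expR R) (ml _).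
apply: measurableT_comp (ml _).
exact: continuous_measurable_fun (@continuous_cos R).
Qed.

Lemma measurable_Im_cpow z (D : set R) : measurable_fun D (fun s => Im (cpow s z)).
Proof.
apply: measurable_funTS; under eq_fun do rewrite Im_cpow.
have ml c : measurable_fun [set: R] (fun s : R => c * ln s).
  by apply: measurable_funM => //; exact: measurable_ln.
apply: measurable_funM.
  exact: measurableT_comp (@measurable_expR R) (ml _).
apply: measurableT_comp (ml _).
exact: continuous_measurable_fun (@continuous_sin R).
Qed.

Lemma ccvg_cpow s z : 0 < s -> ccvg (nbhs s) (fun u => cpow u z) (cpow s z).
Proof. by move=> s0; exact: is_cderive_ccvg (is_cderive_cpow z s0). Qed.

Lemma cpow_cvg0 z : 0 < Re z -> ccvg 0^'+ (fun s => cpow s z) 0.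
Proof.
move=> z0; apply: (@ccvg_squeeze _ _ _ _ _ (fun s => s `^ Re z)).
  apply: filterS (nbhs_right_gt (0 : R)) => s s0.
  by rewrite subr0 cabs_cpow /powR gt_eqF.
exact: powR_cvg0.
Qed.

(** The antiderivative of s^a bounds the integrals over [1/(n+1), 1] uniformly
    in n because a > -1. *)
Lemma integrable_pow (a : R) : -1 < a ->
  mu.-integrable `[0, 1] (EFin \o (fun s => expR (a * ln s))).
Proof.
move=> a1; have b0 : 0 < a + 1 by rewrite -ltrBlDr sub0r.
pose f s := expR (a * ln s); pose G s := expR ((a + 1) * ln s) / (a + 1).
have mf (D : set R) : measurable_fun D (EFin \o f).
  apply/measurable_EFinP; apply: measurable_funTS.
  apply: measurableT_comp (@measurable_expR R) _.
  by apply: measurable_funM => //; exact: measurable_ln.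
have dG s : 0 < s -> is_derive s 1 G (f s).
  move=> s0; have dl := is_derive1_ln s0.
  have d1 := is_deriveZ (a + 1) dl.
  have d2 := @is_derive1_comp R (@expR R) (fun u => (a + 1) * ln u) s _ _ (@is_derive_expR R _) d1.
  have d3 := is_deriveM d2 (@is_derive_cst R R R (a + 1)^-1 s 1).
  apply: is_derive_eq d3 _.
  rewrite /GRing.scale /= /f mulrDl mul1r expRD lnK ?posrE //.
  by field; rewrite !gt_eqF.
have cf s : 0 < s -> f x @[x --> s] --> f s.
  move=> s0; have := ccvg_cabs (ccvg_cpow a%:C s0).
  by rewrite cabs_cpow; under eq_fun do rewrite cabs_cpow; exact.
pose F (n : nat) : set R := `[n.+1%:R^-1, 1]%classic.
have n0 (n : nat) : 0 < n.+1%:R^-1 :> R by rewrite invr_gt0 ltr0n.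
have n1 (n : nat) : n.+1%:R^-1 <= 1 :> R by rewrite invf_le1 ?ltr0n // ler1n.
have intF n : (\int[mu]_(s in F n) (EFin \o f) s <= ((a + 1)^-1)%:E)%E.
  rewrite /F; have := n1 n; rewrite le_eqVlt => /orP[/eqP ->|nlt].
    by rewrite set_itv1 integral_set1 lee_fin invr_ge0 ltW.
  rewrite (@continuous_FTC2 _ f G) //.
  - rewrite -EFinB lee_fin /G ln1 mulr0 expR0 mul1r gerBl divr_ge0 ?expR_ge0 // ltW //.
  - apply: continuous_in_subspaceT => s /[!inE] /=; rewrite in_itv /= => /andP[s1 _].
    by apply: cf; exact: lt_le_trans s1.
  - have cG s : 0 < s -> {for s, continuous G}.
      move=> /dG[d _]; exact/differentiable_continuous/derivable1_diffP.
    split.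
    + move=> s; rewrite in_itv /= => /andP[s1 _].
      by have [] := dG s (lt_trans (n0 n) s1).
    + by apply: cvg_at_right_filter; exact: cG.
    + by apply: cvg_at_left_filter; exact: cG.
  - move=> s; rewrite in_itv /= => /andP[s1 _]; rewrite derive1E.
    by apply: derive_val; apply: dG; exact: lt_trans s1.
have UF : \bigcup_n F n = `]0, 1]%classic.
  apply/seteqP; split => s /=.
    move=> [n _]; rewrite /F /= !in_itv /= => /andP[h ->]; rewrite andbT.
    exact: lt_le_trans h.
  rewrite in_itv /= => /andP[s0 s1].
  exists (Num.bound s^-1) => //; rewrite /F /= in_itv /= s1 andbT.
  rewrite -[leRHS]invrK lef_pV2 ?posrE ?invr_gt0 ?ltr0n //.
  have si : 0 <= s^-1 by rewrite invr_ge0 ltW.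
  rewrite -natr1 (le_trans (ltW (archi_boundP si))) // lerDl //.
have int01 : (\int[mu]_(s in `]0%R, 1%R]) (EFin \o f) s <= ((a + 1)^-1)%:E)%E.
  rewrite -UF; have h : (\int[mu]_(x in F i) (EFin \o f) x)%E @[i --> \oo] -->
     (\int[mu]_(x in \bigcup_i F i) (EFin \o f) x)%E.
    apply: (@ge0_nondecreasing_set_cvg_integral _ (measurableTypeR R) R F (EFin \o f) mu).
    - move=> m n mn; rewrite subsetEset /F; apply: subset_itvr.
      by rewrite bnd_simp lef_pV2 ?posrE ?ltr0n // ler_nat.
    - by move=> n; exact: measurable_itv.
    - by move=> n; exact: mf.
    - by move=> n s _; rewrite lee_fin expR_ge0.
  rewrite -(cvg_lim _ h) //; apply: lime_le; first by apply/cvg_ex; eexists; exact: h.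
  exact: nearW.
apply/integrableP; split; first exact: mf.
rewrite -integral_itv_obnd_cbnd; last by apply: measurableT_comp => //; exact: mf.
apply: le_lt_trans (_ : (_ <= ((a + 1)^-1)%:E)%E) _; last by rewrite ltry.
rewrite (_ : (\int[mu]_(x in `]0%R, 1%R]) `|(EFin \o (fun s : R => expR (a * ln s))) x|)%E =
   (\int[mu]_(s in `]0%R, 1%R]) (EFin \o f) s)%E) //.
by apply: eq_integral => s _ /=; rewrite ger0_norm ?expR_ge0.
Qed.

Lemma cintegrable_cpow z : -1 < Re z -> cintegrable `[0, 1] (fun s => cpow s z).
Proof.
move=> z1; have ip := integrable_pow z1.
split.
- apply: (le_integrable _ _ _ ip) => //.
    by apply/measurable_EFinP; exact: measurable_Re_cpow.
  move=> s _.
  have : `|Re (cpow s z)| <= `|expR (Re z * ln s)|.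
    by rewrite (ger0_norm (expR_ge0 _)) -cabs_cpow normRe_le.
  by rewrite -lee_fin.
- apply: (le_integrable _ _ _ ip) => //.
    by apply/measurable_EFinP; exact: measurable_Im_cpow.
  move=> s _.
  have : `|Im (cpow s z)| <= `|expR (Re z * ln s)|.
    by rewrite (ger0_norm (expR_ge0 _)) -cabs_cpow normIm_le.
  by rewrite -lee_fin.
Qed.

Lemma cintegrable_cpow_mul z (k : R -> R[i]) :
  (forall s, 0 <= s <= 1 -> ccvg (nbhs s) k (k s)) -> -1 < Re z ->
  cintegrable `[0, 1] (fun s => cpow s z * k s).
Proof.
move=> ck z1.
have ck1 : {within `[0, 1], continuous (fun s => Re (k s))}.
  by apply: continuous_in_subspaceT => s /[!inE] /=; rewrite in_itv => /ck[].
have ck2 : {within `[0, 1], continuous (fun s => Im (k s))}.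
  by apply: continuous_in_subspaceT => s /[!inE] /=; rewrite in_itv => /ck[].
have cab : {within `[0, 1], continuous (fun s => cabs (k s))}.
  by apply: continuous_in_subspaceT => s /[!inE] /=; rewrite in_itv => /ck /ccvg_cabs.
have [M [_ kM]] : bounded_set ((fun s => cabs (k s)) @` `[0, 1]).
  by apply: compact_bounded; apply: continuous_compact => //; exact: segment_compact.
apply: (@cintegrable_bounded_mul _ _ _ _ (M + 1)) => //.
- exact: cintegrable_cpow.
- exact: subspace_continuous_measurable_fun.
- exact: subspace_continuous_measurable_fun.
- move=> s ss; have := kM (M + 1); rewrite ltrDl ltr01.
  move=> /(_ isT (cabs (k s))) /=; rewrite ger0_norm ?cabs_ge0 //.
  by apply; exists s.
Qed.

(** Integration by parts against s^z; the boundary term at 0 vanishes because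
    Re z > -1. *)
Lemma cpow_parts z (k dk : R -> R[i]) : -1 < Re z ->
  (forall s, 0 <= s <= 1 -> is_cderive s k (dk s)) ->
  (forall s, 0 <= s <= 1 -> ccvg (nbhs s) dk (dk s)) ->
  cintegral `[0, 1] (fun s => cpow s z * (s%:C * dk s + (z + 1) * k s)) = k 1.
Proof.
move=> z1 dkk cdk.
have ck s : 0 <= s <= 1 -> ccvg (nbhs s) k (k s).
  by move=> ss; exact: is_cderive_ccvg (dkk s ss).
pose f s := s%:C * dk s + (z + 1) * k s.
have cs s : ccvg (nbhs s) (fun u : R => u%:C) s%:C by apply: ccvg_real; exact: cvg_id.
have cf s : 0 <= s <= 1 -> ccvg (nbhs s) f (f s).
  move=> ss; apply: ccvgD; first by apply: ccvgM; [exact: cs|exact: cdk].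
  by apply: ccvgMl; exact: ck.
have ci := cintegrable_cpow_mul cf z1.
have h1 := cintegral_cvg_left ltr01 ci.
pose G s := cpow s (z + 1) * k s.
have dG s : 0 < s <= 1 -> is_cderive s G (cpow s z * f s).
  move=> /andP[s0 s1]; have ss : 0 <= s <= 1 by rewrite ltW.
  apply: is_cderive_eq (is_cderiveM (is_cderive_cpow _ s0) (dkk s ss)) _.
  rewrite cpowD1 // /f; field.
  by rewrite eq_complex /= gt_eqF.
have h2 : ccvg 0^'+ (fun x => cintegral `[x, 1] (fun s => cpow s z * f s)) (k 1).
  have e1 : G 1 = k 1 by rewrite /G /cpow ln1 mulr0 cexp0 mul1r.
  have : ccvg 0^'+ (fun x => G 1 - G x) (k 1 - 0 * k 0).
    apply: ccvgB; first by rewrite e1; exact: ccvg_cst.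
    apply: ccvgM; first by apply: cpow_cvg0; rewrite ReD /= -ltrBlDr sub0r.
    have [c1 c2] : ccvg (nbhs 0) k (k 0) by apply: ck; rewrite lexx ler01.
    by split; exact: cvg_at_right_filter.
  rewrite mul0r subr0 => -[l1 l2].
  have nr : \forall x \near 0^'+, G 1 - G x = cintegral `[x, 1] (fun s => cpow s z * f s).
    near=> x.
    have x0 : 0 < x by near: x; exact: nbhs_right_gt.
    have x1 : x < 1 by near: x; exact: nbhs_right_lt.
    rewrite (@cFTC _ G) // => s /andP[xs s1].
      by apply: dG; rewrite (lt_le_trans x0 xs).
    have s0 := lt_le_trans x0 xs.
    by apply: ccvgM; [exact: ccvg_cpow|apply: cf; rewrite ltW].
  split.
  - by apply: cvg_trans l1; apply: near_eq_cvg; near=> x; congr Re; near: x.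
  - by apply: cvg_trans l2; apply: near_eq_cvg; near=> x; congr Im; near: x.
exact: ccvg_unique h1 h2.
Unshelve. all: by end_near. Qed.

End PowerWeight.

(** * Limits and derivatives under the integral sign *)

Section UnderIntegral.
Variable R : realType.
Notation mu := (@lebesgue_measure R).

Lemma measurable_invr (D : set R) : measurable_fun D (fun x : R => x^-1).
Proof.
apply: measurable_funTS.
have -> : [set: R] = [set x | x != 0] `|` [set 0].
  by apply/seteqP; split => x //= _; case: (eqVneq x 0); [right|left].
have o : open [set x : R | x != 0].
  rewrite (_ : [set x : R | x != 0] = ~` [set 0]); last first.
    by apply/seteqP; split => x /= /eqP.
  by apply: closed_openC; exact: closed_eq.
apply/measurable_funU => //; first exact: open_measurable.
split; last exact: measurable_fun_set1.
apply: open_continuous_measurable_fun => // x /[!inE] x0.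
exact: inv_continuous.
Qed.

Lemma ccont_under (D : set R) (f : R -> R -> R[i]) (a u v : R) (G : R -> R) :
  measurable D -> u < a < v ->
  (forall x, u < x < v -> cintegrable D (f x)) ->
  (forall x s, u < x < v -> D s -> ccvg (nbhs x) (f^~ s) (f x s)) ->
  mu.-integrable D (EFin \o G) ->
  (forall x s, u < x < v -> D s -> cabs (f x s) <= G s) ->
  ccvg (nbhs a) (fun x => cintegral D (f x)) (cintegral D (f a)).
Proof.
move=> mD auv fi fc Gi fG.
have I x : (`]u, v[%classic : set R) x = (u < x < v) :> Prop by rewrite /= in_itv.
have aI : a \in (`]u, v[%classic : set R) by rewrite inE I.
split.
- apply: (@continuity_under_integral R _ _ mu (fun x s => Re (f x s)) D mD u v _ _ G) => //.
  + by move=> x; rewrite I => /fi[].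
  + apply: aeW => s Ds x /[!inE]; rewrite I => xuv; by have [] := fc x s xuv Ds.
  + by move=> x; rewrite I => xuv; apply: aeW => s Ds; apply: le_trans (normRe_le _) (fG x s xuv Ds).
- apply: (@continuity_under_integral R _ _ mu (fun x s => Im (f x s)) D mD u v _ _ G) => //.
  + by move=> x; rewrite I => /fi[].
  + apply: aeW => s Ds x /[!inE]; rewrite I => xuv; by have [] := fc x s xuv Ds.
  + by move=> x; rewrite I => xuv; apply: aeW => s Ds; apply: le_trans (normIm_le _) (fG x s xuv Ds).
Qed.

Lemma cdiff_under (D : set R) (f df : R -> R -> R[i]) (a u v : R) (G : R -> R) :
  measurable D -> u < a < v ->
  (forall x, u < x < v -> cintegrable D (f x)) ->
  (forall x s, u < x < v -> D s -> is_cderive x (f^~ s) (df x s)) ->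
  (forall s, 0 <= G s) -> mu.-integrable D (EFin \o G) ->
  (forall x s, u < x < v -> D s -> cabs (df x s) <= G s) ->
  is_cderive a (fun x => cintegral D (f x)) (cintegral D (df a)).
Proof.
move=> mD auv fi dfx G0 Gi fG.
have I x : (`]u, v[%classic : set R) x = (u < x < v) :> Prop by rewrite /= in_itv.
have aI : (`]u, v[%classic : set R) a by rewrite I.
have h (g dg : R -> R -> R) :
    (forall x, u < x < v -> mu.-integrable D (EFin \o g x)) ->
    (forall x s, u < x < v -> D s -> is_derive x 1 (g^~ s) (dg x s)) ->
    (forall x s, u < x < v -> D s -> `|dg x s| <= G s) ->
    is_derive a 1 (fun x => \int[mu]_(s in D) g x s) (\int[mu]_(s in D) dg a s).
  move=> gi gdg dgG.
  have d1 x s : u < x < v -> D s -> partial1of2 g x s = dg x s.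
    move=> xuv Ds; rewrite /partial1of2 derive1E; apply: derive_val; exact: gdg.
  have c1 : forall x, (`]u, v[%classic : set R) x -> mu.-integrable D (EFin \o g x).
    by move=> x; rewrite I; exact: gi.
  have c2 : forall x s, (`]u, v[%classic : set R) x -> D s -> derivable (g^~ s) x 1.
    by move=> x s; rewrite I => xuv Ds; case: (gdg x s xuv Ds).
  have c3 : forall x s, (`]u, v[%classic : set R) x -> D s -> `|partial1of2 g x s| <= G s.
    by move=> x s; rewrite I => xuv Ds; rewrite d1 //; exact: dgG.
  have e1 := @differentiation_under_integral R _ _ mu g D mD a u v aI c1 c2 G G0 Gi c3.
  have e2 := @derivable_under_integral R _ _ mu g D mD a u v aI c1 c2 G G0 Gi c3.
  apply: DeriveDef => //; rewrite -derive1E e1.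
  by apply: eq_Rintegral => s /[!inE] Ds; rewrite d1.
split.
- apply: (h (fun x s => Re (f x s)) (fun x s => Re (df x s))).
  + by move=> x /fi[].
  + by move=> x s xuv Ds; case: (dfx x s xuv Ds).
  + by move=> x s xuv Ds; apply: le_trans (normRe_le _) (fG x s xuv Ds).
- apply: (h (fun x s => Im (f x s)) (fun x s => Im (df x s))).
  + by move=> x /fi[].
  + by move=> x s xuv Ds; case: (dfx x s xuv Ds).
  + by move=> x s xuv Ds; apply: le_trans (normIm_le _) (fG x s xuv Ds).
Qed.

End UnderIntegral.

(** * Circles about the corner *)

Definition circ (R : realType) (t x : R) : R[i] := t%:C * cexp ('i * x%:C).
#[local] Arguments circ : simpl never.

Section Circle.
Variable R : realType.
Notation mu := (@lebesgue_measure R).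
Implicit Types (s t x : R) (z w : R[i]).

Lemma Re_circ t x : Re (circ t x) = t * cos x.
Proof. by rewrite /circ cexp_i ReM /= mul0r subr0. Qed.
Lemma Im_circ t x : Im (circ t x) = t * sin x.
Proof. by rewrite /circ cexp_i ImM /= mul0r addr0. Qed.

Lemma cabs_circ t x : 0 <= t -> cabs (circ t x) = t.
Proof.
move=> t0; rewrite cabsE Re_circ Im_circ !exprMn -mulrDr cos2Dsin2 mulr1.
by rewrite sqrtr_sqr ger0_norm.
Qed.

Lemma circ0 t : circ t 0 = t%:C.
Proof. by rewrite /circ mulr0 cexp0 mulr1. Qed.

Lemma circ_2piB t x : circ t (2 * pi - x) = circ t (- x).
Proof.
by apply: eqc; rewrite ?(Re_circ, Im_circ) ?(cosB, sinB) mulr_natl cos2pi sin2pi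
  ?cosN ?sinN; ring.
Qed.

Lemma is_cderive_circ t x : is_cderive x (circ t) ('i * circ t x).
Proof.
have d0 : is_derive x 1 (fun u : R => u) (1 : R) by exact: is_derive_id.
have d1 := is_cderive_real d0.
apply: is_cderive_eq (is_cderiveMl t%:C (is_cderive_cexp (is_cderiveMl ('i : R[i])%R d1))) _.
by rewrite /circ (_ : (1 : R)%:C = 1) //; ring.
Qed.

Lemma sqr_dist_circ s t x :
  cabs (s%:C - circ t x) ^+ 2 = (s - t) ^+ 2 + 2 * s * t * (1 - cos x).
Proof.
rewrite sqr_cabs ReB ImB Re_circ Im_circ /= sub0r sqrrN.
rewrite (_ : (t * sin x) ^+ 2 = t ^+ 2 * (1 - cos x ^+ 2)); first by ring.
by rewrite exprMn -(cos2Dsin2 x) addrC addKr.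
Qed.

Lemma dist_circ_ge s t x : 0 <= s -> 0 <= t -> `|s - t| <= cabs (s%:C - circ t x).
Proof.
move=> s0 t0; rewrite -(@ler_pXn2r _ 2) ?nnegrE ?cabs_ge0 // sqr_dist_circ.
rewrite real_normK ?num_real // lerDl !mulr_ge0 // subr_ge0 cos_le1 //.
Qed.

(** Uniform in s, hence a dominating function for the Cauchy kernel and for its
    derivative in the angle. *)
Lemma dist_circ_ge_cos s t x : 0 <= s -> 0 <= t ->
  t ^+ 2 * ((1 - cos x) / 2) <= cabs (s%:C - circ t x) ^+ 2.
Proof.
move=> s0 t0; rewrite sqr_dist_circ.
have c1 : cos x <= 1 by exact: cos_le1.
have c2 : -1 <= cos x by exact: cos_geN1.
have st : 0 <= s * t by exact: mulr_ge0.
have d0 : 0 <= (1 - cos x) / 2 by lra.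
have d1 : (1 - cos x) / 2 <= 1 by lra.
set d := (1 - cos x) / 2 in d0 d1 *.
have -> : 1 - cos x = 2 * d by rewrite /d; field.
rewrite -subr_ge0; have [d2|d2] := leP d (2^-1).
  rewrite (_ : _ - _ = (s - t * (1 - 2 * d)) ^+ 2 + t ^+ 2 * (d * (3 - 4 * d))); last by ring.
  by rewrite addr_ge0 ?sqr_ge0 // mulr_ge0 ?sqr_ge0 // mulr_ge0 //; lra.
rewrite (_ : _ - _ = s ^+ 2 + 2 * (s * t) * (2 * d - 1) + t ^+ 2 * (1 - d)); last by ring.
by rewrite !addr_ge0 ?sqr_ge0 ?mulr_ge0 ?sqr_ge0 //; lra.
Qed.

Lemma cos_lt1_circ x : 0 < x < 2 * pi -> cos x < 1.
Proof.
move=> /andP[x0 x2]; have -> : x = (x / 2) *+ 2 by rewrite -mulr_natr; field.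
rewrite cos_mulr2n.
have s0 : 0 < sin (x / 2) by apply: sin_gt0_pi; lra.
have s2 : 0 < sin (x / 2) ^+ 2 by exact: exprn_gt0.
by have := cos2Dsin2 (x / 2); rewrite mulr2n; lra.
Qed.

Lemma circ_off s t x : 0 <= s -> 0 < t -> 0 < x < 2 * pi -> s%:C != circ t x.
Proof.
move=> s0 t0 xx; have c1 := cos_lt1_circ xx.
apply/eqP => e; have := dist_circ_ge_cos x s0 (ltW t0).
rewrite e subrr cabs0 expr0n /= leNgt mulr_gt0 ?exprn_gt0 //; lra.
Qed.

End Circle.

(** * The Cauchy transform of s^z off the segment *)

Section CauchyIntegral.
Variable R : realType.
Notation mu := (@lebesgue_measure R).
Implicit Types (s t x : R) (z w : R[i]).

Definition cauchyJ z w : R[i] := cintegral `[0, 1] (fun s => cpow s z * (s%:C - w)^-1).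

Lemma ccvg_real_id s : ccvg (nbhs s) (fun u : R => u%:C) s%:C.
Proof. by apply: ccvg_real; exact: cvg_id. Qed.

Lemma is_cderive_real_id s : is_cderive s (fun u : R => u%:C) 1.
Proof. apply: (@is_cderive_real _ _ (fun u : R => u) 1); exact: is_derive_id. Qed.

Lemma ccvg_resolvent s w : s%:C != w -> ccvg (nbhs s) (fun u : R => (u%:C - w)^-1) (s%:C - w)^-1.
Proof.
move=> sw; apply: ccvgV; first by rewrite subr_eq0.
by apply: ccvgB; [exact: ccvg_real_id|exact: ccvg_cst].
Qed.

Lemma is_cderive_resolvent s w : s%:C != w ->
  is_cderive s (fun u : R => (u%:C - w)^-1) (- (s%:C - w) ^- 2).
Proof.
move=> sw; have d1 := is_cderiveB (is_cderive_real_id s) (is_cderive_cst s w).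
have sw0 : s%:C - w != 0 by rewrite subr_eq0.
by apply: is_cderive_eq (is_cderiveV sw0 d1) _; rewrite subr0 mulN1r.
Qed.

Section OffSegment.
Variables (z w : R[i]).
Hypotheses (z1 : -1 < Re z) (w_off : forall s, 0 <= s <= 1 -> s%:C != w).

Lemma cintegrable_resolvent : cintegrable `[0, 1] (fun s => cpow s z * (s%:C - w)^-1).
Proof. by apply: cintegrable_cpow_mul => // s ss; apply: ccvg_resolvent; exact: w_off. Qed.

Lemma cintegrable_resolvent2 :
  cintegrable `[0, 1] (fun s => cpow s z * (w / (s%:C - w) ^+ 2)).
Proof.
apply: cintegrable_cpow_mul => // s ss; apply: ccvgMl.
under [X in ccvg _ X]eq_fun do rewrite -exprVn.
by rewrite -exprVn; apply: ccvgX; apply: ccvg_resolvent; exact: w_off.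
Qed.

(** Integration by parts turns the double pole into the simple one. *)
Lemma cauchyJ_double_pole :
  cintegral `[0, 1] (fun s => cpow s z * (w / (s%:C - w) ^+ 2)) =
  z * cauchyJ z w - (1 - w)^-1.
Proof.
pose k s : R[i] := (s%:C - w)^-1; pose dk s : R[i] := - (s%:C - w) ^- 2.
have dkk s : 0 <= s <= 1 -> is_cderive s k (dk s).
  by move=> ss; apply: is_cderive_resolvent; exact: w_off.
have cdk s : 0 <= s <= 1 -> ccvg (nbhs s) dk (dk s).
  move=> ss; rewrite /dk; apply: ccvgN.
  under [X in ccvg _ X]eq_fun do rewrite -exprVn.
  by rewrite -exprVn; apply: ccvgX; apply: ccvg_resolvent; exact: w_off.
have := cpow_parts z1 dkk cdk; rewrite /k => <-.
rewrite /cauchyJ -cintegralZ //; last exact: cintegrable_resolvent.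
rewrite -cintegralB //; last 2 first.
- by apply: cintegrableZ => //; exact: cintegrable_resolvent.
- apply: (@cintegrable_cpow_mul _ z (fun s => s%:C * dk s + (z + 1) * k s)) => // s ss.
  apply: ccvgD; first by apply: ccvgM; [exact: ccvg_real_id|exact: cdk].
  by apply: ccvgMl; apply: ccvg_resolvent; exact: w_off.
apply: eq_cintegral => s; rewrite inE /= in_itv /= => /w_off sw.
have sw0 : s%:C - w != 0 by rewrite subr_eq0.
by rewrite /dk; field.
Qed.

End OffSegment.

Section FixedRadius.
Variables (z : R[i]) (t : R).
Hypotheses (z1 : -1 < Re z) (t0 : 0 < t) (t1 : t < 1).

Let circ_off01 x s : 0 < x < 2 * pi -> 0 <= s <= 1 -> s%:C != circ t x.
Proof. by move=> xx /andP[s0 _]; exact: circ_off. Qed.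

(** The derivative in the angle has a double pole, which [cauchyJ_double_pole]
    expresses by J again: J solves a linear equation of first order. *)
Lemma cauchyJ_derive x : 0 < x < 2 * pi ->
  is_cderive x (fun y => cauchyJ z (circ t y))
    ('i * (z * cauchyJ z (circ t x) - (1 - circ t x)^-1)).
Proof.
move=> xx; rewrite -cauchyJ_double_pole //; last by move=> s; exact: circ_off01.
rewrite -cintegralZ //; last first.
  by apply: cintegrable_resolvent2 => // s; exact: circ_off01.
pose df y s : R[i] := 'i * (cpow s z * (circ t y / (s%:C - circ t y) ^+ 2)).
have c1 := cos_lt1_circ xx.
pose m := (1 - cos x) / 2; have m0 : 0 < m by rewrite /m; lra.
have near_x : \forall y \near x, 0 < y < 2 * pi /\ m < 1 - cos y.
  have n1 : \forall y \near x, y \in `]0, 2 * pi[.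
    by apply: near_in_itvoo; rewrite in_itv.
  have n2 : \forall y \near x, cos y < 1 - m.
    have cx : cos y @[y --> x] --> cos x by exact: continuous_cos.
    by apply: (cvgr_lt (cos x) cx); rewrite /m; lra.
  near=> y; split.
    have : y \in `]0, 2 * pi[ by near: y.
    by rewrite in_itv.
  have : cos y < 1 - m by near: y.
  lra.
have [e /= e0 eP] := near_x.
have xe : x - e < x < x + e by apply/andP; split; lra.
have nI y : x - e < y < x + e -> 0 < y < 2 * pi /\ m < 1 - cos y.
  by move=> /andP[y1 y2]; apply: eP; rewrite /ball_ /= ltr_norml; apply/andP; split; lra.
pose M := t / (t ^+ 2 * (m / 2)).
have M0 : 0 <= M.
  by apply: divr_ge0; [exact: ltW|apply: mulr_ge0; [exact: sqr_ge0|lra]].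
pose f y s : R[i] := cpow s z * (s%:C - circ t y)^-1.
pose G s : R := M * expR (Re z * ln s).
have mI : measurable (`[0, 1]%classic : set R) by exact: measurable_itv.
apply: (@cdiff_under R `[0, 1]%classic f df x (x - e) (x + e) G mI xe).
- move=> y /nI[y2 _]; apply: cintegrable_resolvent => // s; exact: circ_off01.
- move=> y s /nI[y2 _]; rewrite /= in_itv /= => ss.
  have sw : s%:C - circ t y != 0 by rewrite subr_eq0; exact: circ_off01.
  have d1 := is_cderiveB (is_cderive_cst y s%:C) (is_cderive_circ t y).
  apply: is_cderive_eq (is_cderiveMl _ (is_cderiveV sw d1)) _.
  by rewrite /df; field.
- by move=> s; rewrite mulr_ge0 ?expR_ge0.
- by apply: integrable_scale => //; exact: integrable_pow.
- move=> y s /nI[y2 my] ss.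
  have {ss} /andP[s0 s1] : 0 <= s <= 1 by move: ss; rewrite /= in_itv.
  rewrite /df cabsM cabsM cabs_cpow cabsM cabsV cabsX (cabs_circ _ (ltW t0)).
  rewrite cabs_i mul1r.
  rewrite mulrC ler_wpM2r ?expR_ge0 // /M ler_pM2l //.
  rewrite lef_pV2 ?posrE; last 2 first.
  + rewrite exprn_gt0 // cabs_gt0 subr_eq0; apply: circ_off01 => //; exact/andP.
  + by rewrite mulr_gt0 ?exprn_gt0 // divr_gt0.
  apply: le_trans (dist_circ_ge_cos y s0 (ltW t0)); rewrite ler_pM2l ?exprn_gt0 //; lra.
Unshelve. all: by end_near. Qed.

Variable N : nat.
Hypothesis zN : forall k : nat, k%:R != z.

(** The exponential is the integrating factor of the equation for J, and the sum
    is its formal power series solution, truncated. *)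
Definition cauchyE (x : R) : R[i] :=
  (cauchyJ z (circ t x) + \sum_(k < N) circ t x ^+ k / (k%:R - z)) *
  cexp (- ('i * z) * x%:C).

Lemma is_cderive_sum (I : Type) (r : seq I) (f : I -> R -> R[i]) (l : I -> R[i]) x :
  (forall i, is_cderive x (f i) (l i)) ->
  is_cderive x (fun u => \sum_(i <- r) f i u) (\sum_(i <- r) l i).
Proof.
move=> fl; elim: r => [|i r IH].
  by rewrite big_nil; under [X in is_cderive _ X]eq_fun do rewrite big_nil;
    exact: is_cderive_cst.
by rewrite big_cons; under [X in is_cderive _ X]eq_fun do rewrite big_cons;
  exact: is_cderiveD.
Qed.

Lemma is_cderiveX x (f : R -> R[i]) l n : is_cderive x f l ->
  is_cderive x (fun u => f u ^+ n) (n%:R * f x ^+ n.-1 * l).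
Proof.
move=> fl; elim: n => [|[|n] IH].
- by rewrite !mul0r; exact: is_cderive_cst.
- by rewrite expr0 !mul1r.
- under [X in is_cderive _ X]eq_fun do rewrite exprS.
  apply: is_cderive_eq (is_cderiveM fl IH) _.
  by rewrite [n.+1.-1]/= [n.+2.-1]/= -(natr1 n.+1) exprS; ring.
Qed.

(** The sum cancels the first N terms of the geometric series 1 / (1 - w), the
    inhomogeneous term of the equation for J. *)
Lemma cauchyE_derive x : 0 < x < 2 * pi ->
  is_cderive x cauchyE
    (- ('i * circ t x ^+ N / (1 - circ t x)) * cexp (- ('i * z) * x%:C)).
Proof.
move=> xx; have dJ := cauchyJ_derive xx.
have dS : is_cderive x (fun y => \sum_(k < N) circ t y ^+ k / (k%:R - z))
    (\sum_(k < N) 'i * (k%:R * circ t x ^+ k / (k%:R - z))).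
  apply: is_cderive_sum => k.
  have d1 := is_cderiveX k (is_cderive_circ t x).
  apply: is_cderive_eq (is_cderiveM d1 (is_cderive_cst x (k%:R - z)^-1)) _.
  rewrite mulr0 addr0; case: (k : nat) => [|m]; first by rewrite !mul0r mulr0.
  by rewrite exprS /=; ring.
have dE := is_cderive_cexp (is_cderiveMl (- ('i * z)) (is_cderive_real_id x)).
apply: is_cderive_eq (is_cderiveM (is_cderiveD dJ dS) dE) _.
have w1 : 1 - circ t x != 0.
  rewrite subr_eq0 -[1]/((1 : R)%:C); apply: circ_off => //; exact: ler01.
rewrite -mulr_sumr mulrA -mulrDl; congr (_ * _).
set J := cauchyJ _ _; set w := circ t x in w1 *.
have -> : \sum_(k < N) k%:R * w ^+ k / (k%:R - z) =
    \sum_(k < N) w ^+ k + z * \sum_(k < N) w ^+ k / (k%:R - z).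
  rewrite mulr_sumr -big_split /=; apply: eq_bigr => k _.
  by field; rewrite subr_eq0.
have -> : \sum_(k < N) w ^+ k = (1 - w ^+ N) / (1 - w).
  have h : 1 - w ^+ N = (1 - w) * \sum_(k < N) w ^+ k.
    by rewrite -opprB subrX1 -mulNr opprB.
  by rewrite h mulrAC divff // mul1r.
by field.
Qed.

(** |1 - w| >= 1 - t keeps the derivative O(t^N) up to both ends of ]0, 2 pi[,
    where J itself has different limits. *)
Lemma cauchyE_near_constant (a b : R) : 0 < a -> a <= b -> b < 2 * pi ->
  cabs (cauchyE b - cauchyE a) <=
    2 * (t ^+ N / (1 - t) * expR (`|Im z| * (2 * pi))) * (2 * pi).
Proof.
move=> a0 ab b2; set M := _ / _ * _.
have p0 : 0 <= 2 * pi :> R by rewrite mulr_ge0 ?pi_ge0.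
have M0 : 0 <= M.
  by rewrite mulr_ge0 ?expR_ge0 // divr_ge0 ?exprn_ge0 ?subr_ge0 ?ltW.
apply: le_trans (_ : 2 * M * (b - a) <= _); last first.
  by apply: ler_wpM2l; [exact: mulr_ge0|lra].
apply: (cmvt_bound ab) => [x /andP[xa xb]|x /andP[xa xb]].
  by apply: cauchyE_derive; apply/andP; split; lra.
rewrite cabsM cabsN cabsM cabsM cabsV cabsX (cabs_circ _ (ltW t0)).
rewrite cabs_i mul1r.
apply: ler_pM.
- by rewrite mulr_ge0 ?exprn_ge0 ?invr_ge0 ?cabs_ge0 // ltW.
- exact: cabs_ge0.
- have h : 1 - t <= cabs (1 - circ t x).
    rewrite -[1 in leRHS]/((1 : R)%:C).
    apply: le_trans (dist_circ_ge x ler01 (ltW t0)); exact: ler_norm.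
  have t1' := t1; apply: ler_wpM2l; first by rewrite exprn_ge0 // ltW.
  by rewrite lef_pV2 ?posrE; lra.
- rewrite cabs_cexp ler_expR.
  have -> : Re (- ('i * z) * x%:C) = Im z * x.
    by rewrite !(ReM, ImM, ReN, ImN) /=; ring.
  apply: le_trans (_ : `|Im z| * x <= _); last by rewrite ler_wpM2l //; lra.
  by rewrite ler_wpM2r ?ler_norm //; lra.
Qed.

End FixedRadius.

End CauchyIntegral.

(** * Splitting off the logarithmic singularity *)

Section Plemelj.
Variable R : realType.
Notation mu := (@lebesgue_measure R).
Variables (z : R[i]) (t : R).
Hypotheses (z1 : -1 < Re z) (t0 : 0 < t) (t1 : t < 1).
Implicit Types (s x : R) (w : R[i]).

Lemma measurable_Re_resolvent w (D : set R) :
  measurable_fun D (fun s : R => Re (s%:C - w)^-1).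
Proof.
apply: measurable_funTS; under eq_fun do rewrite ReV ReB ImB /=.
apply: measurable_funM; first by apply: measurable_funB.
apply: measurableT_comp (@measurable_invr R setT) _.
apply: measurable_funD => //.
by apply: measurable_funX; apply: measurable_funB.
Qed.

Lemma measurable_Im_resolvent w (D : set R) :
  measurable_fun D (fun s : R => Im (s%:C - w)^-1).
Proof.
apply: measurable_funTS; under eq_fun do rewrite ImV ReB ImB /=.
apply: (measurableT_comp (@oppr_measurable R setT)).
apply: measurable_funM; first by apply: measurable_funB.
apply: measurableT_comp (@measurable_invr R setT) _.
apply: measurable_funD => //.
by apply: measurable_funX; apply: measurable_funB.
Qed.

(** At s = t this is 0 and not the derivative of s^z, which no integral notices. *)
Definition divdiff s : R[i] := (cpow s z - cpow t z) / (s%:C - t%:C).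

Lemma divdiffK s : divdiff s * (s%:C - t%:C) = cpow s z - cpow t z.
Proof.
rewrite /divdiff; have [->|st] := eqVneq s t; first by rewrite !subrr mulr0.
by rewrite divfK // -rmorphB /= -[0]/((0 : R)%:C) (inj_eq (@complexI R)) subr_eq0.
Qed.

Lemma divdiff_real s : divdiff s = ((s - t)^-1)%:C * (cpow s z - cpow t z).
Proof. by rewrite /divdiff -rmorphB fmorphV mulrC. Qed.

(** Near 0 only s^z is singular, near t the mean value bound applies; t / 2
    separates the two regions. *)
Lemma divdiff_integrable : cintegrable `[0, 1] divdiff.
Proof.
have t2 : 0 < t / 2 by rewrite divr_gt0.
have [t0' t1'] := (t0, t1).
have t21 : t / 2 < 1 by lra.
have m1 : measurable (`[0, t / 2]%classic : set R) by exact: measurable_itv.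
have m2 : measurable (`[t / 2, 1]%classic : set R) by exact: measurable_itv.
have cst_int a b w : cintegrable `[a, b] (fun=> w).
  by apply: cintegrable_continuous => s _; exact: ccvg_cst.
have mR : measurable_fun [set: R] (fun s : R => (s - t)^-1).
  by apply: measurableT_comp (@measurable_invr R setT) _; exact: measurable_funB.
have i1 : cintegrable `[0, t / 2] divdiff.
  rewrite (_ : divdiff = fun s => (cpow s z - cpow t z) * ((s - t)^-1)%:C); last first.
    by apply/funext => s; rewrite mulrC divdiff_real.
  apply: (@cintegrable_bounded_mul _ _ _ _ (2 / t)) => //.
  - apply: cintegrableB => //.
    apply: cintegrableS (cintegrable_cpow z1) => //.
    by apply: subset_itvl; rewrite bnd_simp ltW.
  - exact: measurable_funTS.
  - move=> s; rewrite /= in_itv /= => /andP[s0 s1].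
    rewrite cabs_real normfV -[2 / t]invf_div lef_pV2 ?posrE //.
      by rewrite ler0_norm; lra.
    by rewrite normr_gt0 subr_eq0 lt_eqF //; lra.
have i2 : cintegrable `[t / 2, 1] divdiff.
  pose M := 2 * (cabs z * expR (`|Re z| * - ln (t / 2)) * (2 / t)).
  rewrite (_ : divdiff = fun s => 1 * divdiff s); last first.
    by apply/funext => s; rewrite mul1r.
  apply: (@cintegrable_bounded_mul _ _ _ _ M) => //.
  - apply: measurable_funTS; under eq_fun do rewrite divdiff_real Re_realM ReB.
    apply: measurable_funM => //; apply: measurable_funB => //.
    exact: measurable_Re_cpow.
  - apply: measurable_funTS; under eq_fun do rewrite divdiff_real Im_realM ImB.
    apply: measurable_funM => //; apply: measurable_funB => //.
    exact: measurable_Im_cpow.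
  - move=> s; rewrite /= in_itv /= => /andP[s0 s1].
    have M0 : 0 <= M by rewrite !mulr_ge0 ?cabs_ge0 ?expR_ge0 ?invr_ge0 // ltW.
    rewrite divdiff_real mulrC cabsM cabs_real normfV.
    have [->|st] := eqVneq s t; first by rewrite !subrr normr0 invr0 mulr0.
    rewrite ler_pdivrMr ?normr_gt0 ?subr_eq0 //.
    have dc x : t / 2 <= x <= 1 ->
        is_cderive x (fun u => cpow u z) (z * cpow x z / x%:C).
      by move=> /andP[x0 _]; apply: is_cderive_cpow; lra.
    have bd x : t / 2 <= x <= 1 -> cabs (z * cpow x z / x%:C) <=
        cabs z * expR (`|Re z| * - ln (t / 2)) * (2 / t).
      move=> /andP[x0 x1]; have xp : 0 < x by lra.
      rewrite cabsM cabsM cabsV cabs_real cabs_cpow gtr0_norm //.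
      apply: ler_pM.
      + by rewrite mulr_ge0 ?cabs_ge0 ?expR_ge0.
      + by rewrite invr_ge0 ltW.
      + rewrite ler_wpM2l ?cabs_ge0 // ler_expR.
        apply: le_trans (ler_norm _) _; rewrite normrM ler_wpM2l //.
        by rewrite ler0_norm ?lerN2 ?ler_ln ?posrE // ln_le0.
      + by rewrite -[2 / t]invf_div lef_pV2 ?posrE.
    have [st'|ts] := leP s t.
    + rewrite cabs_distC ler0_norm ?subr_le0 // opprB.
      rewrite /M; apply: (@cmvt_bound _ (fun u => cpow u z)
        (fun x => z * cpow x z / x%:C) s t _ st') => x /andP[xs xt].
      - by apply: dc; apply/andP; split; lra.
      - by apply: bd; apply/andP; split; lra.
    + rewrite ger0_norm ?subr_ge0; last exact: ltW.
      rewrite /M; apply: (@cmvt_bound _ (fun u => cpow u z)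
        (fun x => z * cpow x z / x%:C) t s _ (ltW ts)) => x /andP[xs xt].
      - by apply: dc; apply/andP; split; lra.
      - by apply: bd; apply/andP; split; lra.
apply: (cintegrableS _ _ _ (cintegrable_setU m1 m2 i1 i2)) => //.
- exact: measurableU.
- move=> s; rewrite /= !in_itv /= => /andP[-> ->]; rewrite andbT.
  by apply/orP; exact: le_total.
Qed.

Definition regular_part x : R[i] :=
  cintegral `[0, 1] (fun s => divdiff s * ((s%:C - t%:C) / (s%:C - circ t x))).

Lemma regular_part_bound s x : 0 <= s -> cabs ((s%:C - t%:C) / (s%:C - circ t x)) <= 1.
Proof.
move=> s0; rewrite cabsM cabsV -rmorphB cabs_real.
have h := dist_circ_ge x s0 (ltW t0).
have [->|c0] := eqVneq (cabs (s%:C - circ t x)) 0; first by rewrite invr0 mulr0.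
by rewrite ler_pdivrMr ?mul1r // lt_neqAle eq_sym c0 cabs_ge0.
Qed.

Lemma regular_part_integrable x :
  cintegrable `[0, 1] (fun s => divdiff s * ((s%:C - t%:C) / (s%:C - circ t x))).
Proof.
have ms : measurable_fun [set: R] (fun s : R => s - t) by exact: measurable_funB.
pose k s : R[i] := (s - t)%:C * (s%:C - circ t x)^-1.
rewrite (_ : (fun s => _) = fun s => divdiff s * k s); last first.
  by apply/funext => s; rewrite /k rmorphB.
apply: (@cintegrable_bounded_mul _ _ _ _ 1) => //.
- exact: divdiff_integrable.
- have -> : (fun s => Re (k s)) = (fun s => (s - t) * Re (s%:C - circ t x)^-1).
    by apply/funext => s; rewrite /k Re_realM.
  apply: measurable_funM; first exact: measurable_funTS.
  exact: measurable_Re_resolvent.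
- have -> : (fun s => Im (k s)) = (fun s => (s - t) * Im (s%:C - circ t x)^-1).
    by apply/funext => s; rewrite /k Im_realM.
  apply: measurable_funM; first exact: measurable_funTS.
  exact: measurable_Im_resolvent.
- move=> s; rewrite /= in_itv /= => /andP[s0 s1].
  by rewrite /k rmorphB; exact: regular_part_bound.
Qed.

Lemma regular_part0 : regular_part 0 = cintegral `[0, 1] divdiff.
Proof.
apply: eq_cintegral => s _; rewrite circ0 mulrA divdiffK.
by rewrite /divdiff.
Qed.

(** |s - t| <= |s - t e^(ix)| makes the family dominated, with no loss as x
    tends to 0. *)
Lemma regular_part_cvg : ccvg (nbhs 0) regular_part (regular_part 0).
Proof.
have [i1 i2] := divdiff_integrable.
have Gi : mu.-integrable `[0, 1] (EFin \o (fun s => `|Re (divdiff s)| + `|Im (divdiff s)|)).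
  rewrite (_ : _ \o _ = ((EFin \o (fun s => `|Re (divdiff s)|%R)) \+
    (EFin \o (fun s => `|Im (divdiff s)|%R)))%E) //.
  by apply: integrableD => //; exact: integrable_norm.
apply: (@ccont_under R _ _ 0 (-1) 1 _ _ _ _ _ Gi) => //.
- by rewrite ltrN10 ltr01.
- by move=> x _; exact: regular_part_integrable.
- move=> x s _; rewrite /= in_itv /= => /andP[s0 s1].
  have [->|st] := eqVneq s t.
    have e y : divdiff t * ((t%:C - t%:C) / (t%:C - circ t y)) = 0.
      by rewrite subrr mul0r mulr0.
    by rewrite e; under [X in ccvg _ X]eq_fun do rewrite e; exact: ccvg_cst.
  apply: ccvgMl; apply: ccvgMl; apply: ccvgV.
    rewrite -cabs_gt0; apply: lt_le_trans (dist_circ_ge x s0 (ltW t0)).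
    by rewrite normr_gt0 subr_eq0.
  apply: ccvgB; first exact: ccvg_cst.
  exact: is_cderive_ccvg (is_cderive_circ t x).
- move=> x s _; rewrite /= in_itv /= => /andP[s0 s1].
  rewrite cabsM; apply: (le_trans (y := cabs (divdiff s))); last exact: cabs_le.
  by rewrite ler_piMr ?cabs_ge0 ?regular_part_bound.
Qed.

Definition log_part x : R[i] := cintegral `[0, 1] (fun s : R => (s%:C - circ t x)^-1).

Lemma cauchyJ_split x : (forall s, 0 <= s <= 1 -> s%:C != circ t x) ->
  cauchyJ z (circ t x) = cpow t z * log_part x + regular_part x.
Proof.
move=> off.
have ir : cintegrable `[0, 1] (fun s : R => (s%:C - circ t x)^-1).
  by apply: cintegrable_continuous => s ss; apply: ccvg_resolvent; exact: off.
rewrite /log_part -cintegralZ // -cintegralD //; last 2 first.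
- exact: cintegrableZ.
- exact: regular_part_integrable.
apply: eq_cintegral => s _; rewrite mulrA divdiffK.
by rewrite -mulrDl (addrC (cpow t z)) subrK.
Qed.

(** An antiderivative of 1 / (s - w) is a logarithm. Its imaginary part is written
    with arctangents of quotients by sin x: their limits at x = 0 depend on the
    side, which is the jump of J across the segment. *)
Lemma log_partE x : sin x != 0 ->
  log_part x = (2^-1 * ln ((1 - t * cos x) ^+ 2 + (t * sin x) ^+ 2) - 2^-1 * ln (t ^+ 2))
   +i* (atan ((1 - t * cos x) / (t * sin x)) + atan (cos x / sin x)).
Proof.
move=> sx; have ts : t * sin x != 0 by rewrite mulf_neq0 // gt_eqF.
pose N s := (s - t * cos x) ^+ 2 + (t * sin x) ^+ 2.
have N0 s : 0 < N s by rewrite ltr_wpDl ?sqr_ge0 // exprn_even_gt0.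
pose F s : R[i] := (2^-1 * ln (N s)) +i* atan ((s - t * cos x) / (t * sin x)).
have off s : s%:C != circ t x.
  apply/eqP => /(congr1 (@complex.Im R)); rewrite Im_circ /= => /esym/eqP.
  by rewrite (negbTE ts).
have dF s : is_cderive s F ((s%:C - circ t x)^-1).
  have ds : is_derive s 1 (fun u : R => u - t * cos x) (1 : R).
    by apply: is_derive_eq (is_deriveB (is_derive_id s 1) (is_derive_cst (t * cos x) s 1)) _;
      rewrite subr0.
  split.
  - have dN : is_derive s 1 N (2 * (s - t * cos x)).
      apply: is_derive_eq (is_deriveD (is_deriveM ds ds)
         (is_derive_cst ((t * sin x) ^+ 2) s 1)) _.
      by rewrite /GRing.scale /=; ring.
    have dl := @is_derive1_comp R (@ln R) N s _ _ (is_derive1_ln (N0 s)) dN.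
    apply: is_derive_eq (is_deriveZ 2^-1 dl) _.
    rewrite ReV ReB ImB Re_circ Im_circ /= sub0r sqrrN -/(N s) /GRing.scale /=.
    by field; rewrite gt_eqF.
  - have dq := is_deriveM ds (is_derive_cst (t * sin x)^-1 s 1).
    have da := @is_derive1_comp R (@atan R) (fun u => (u - t * cos x) / (t * sin x)) s _ _
       (is_derive1_atan _) dq.
    apply: is_derive_eq da _.
    rewrite ImV ReB ImB Re_circ Im_circ /= sub0r sqrrN -/(N s) /GRing.scale /=.
    have := N0 s; rewrite /N => n0; field.
    by rewrite (gt_eqF n0) sx gt_eqF.
have -> : log_part x = F 1 - F 0.
  by apply: cFTC => // s _; exact: ccvg_resolvent.
apply: eqc; rewrite ?ReB ?ImB /= /N sub0r.
- rewrite sqrrN !exprMn -[X in _ - _ * ln X]mulrDr cos2Dsin2 mulr1 //.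
- congr (_ + _); rewrite -atanN; congr atan.
  by field; rewrite sx gt_eqF.
Qed.

End Plemelj.

(** * One-sided limits of the Cauchy transform *)

Section Values.
Variable R : realType.
Notation mu := (@lebesgue_measure R).

Lemma Re_imag (a : R) : Re ('i * a%:C) = 0.
Proof. by rewrite ReM /= mul0r mulr0 subr0. Qed.

Lemma Im_imag (a : R) : Im ('i * a%:C) = a.
Proof. by rewrite ImM /= mul0r mul1r add0r. Qed.

Lemma csinE (a : R[i]) : 2 * 'i * csin a = cexp ('i * a) - (cexp ('i * a))^-1.
Proof.
rewrite /csin -cexpN mulrC divfK // mulf_neq0 ?two_neq0 ?i_neq0 //.
Qed.

Lemma ccosE (a : R[i]) : 2 * ccos a = cexp ('i * a) + (cexp ('i * a))^-1.
Proof. by rewrite /ccos -cexpN mulrC divfK ?two_neq0. Qed.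

Lemma cexp_2pi_int (m : int) : cexp ('i * (2 * pi%:C * m%:~R)) = 1 :> R[i].
Proof.
have e1 : cexp ('i * (2 * pi%:C)) = 1 :> R[i].
  have -> : 2 * pi%:C = (2 * pi)%:C :> R[i] by rewrite rmorphM rmorph_nat.
  by rewrite cexp_i mulr_natl cos2pi sin2pi.
have en (n : nat) : cexp ('i * (2 * pi%:C * n%:R)) = 1 :> R[i].
  by rewrite mulrA [_ * n%:R]mulrC cexpMn e1 expr1n.
case: m => n; first exact: en.
by rewrite NegzE mulrNz !mulrN cexpN en invr1.
Qed.

(** A unimodular exponential has a real exponent, and only its fractional part matters. *)
Lemma cexp_2pi_eq1 (z : R[i]) : cexp ('i * (2 * pi%:C * z)) = 1 -> exists m : int, z = m%:~R.
Proof.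
move=> e1.
have y0 : Im z = 0.
  have := congr1 (fun u => ComplexField.Normc.normc u) e1.
  rewrite cabs_cexp cabs1 => /eqP; rewrite -expR0 (inj_eq (@expR_inj R)) => /eqP.
  have -> : 'i * (2 * pi%:C * z) = (2 * pi)%:C * ('i * z) :> R[i].
    by rewrite rmorphM rmorph_nat; ring.
  rewrite Re_realM ReM /= mul0r mul1r sub0r => /eqP.
  by rewrite !mulf_eq0 pnatr_eq0 (gt_eqF (@pi_gt0 R)) /= oppr_eq0 => /eqP.
pose m := Num.floor (Re z); exists m.
have /andP[fl1 fl2] := real_floor_itv (num_real (Re z)).
rewrite -/m intrD1 in fl1 fl2; pose f := Re z - m%:~R.
have zE : z = m%:~R + f%:C.
  apply: eqc; rewrite ?(ReD, ImD) -(rmorph_int (real_complex R)) /=.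
    by rewrite /f addrC subrK.
  by rewrite y0 addr0.
have [f0|f0] : f = 0 \/ 0 < f.
- by have := fl1; rewrite -subr_ge0 -/f le_eqVlt => /orP[/eqP <-|]; [left|right].
- by rewrite zE f0 addr0.
have fI : 0 < 2 * pi * f < 2 * pi.
  have p0 : 0 < 2 * pi :> R by rewrite mulr_gt0 ?pi_gt0.
  rewrite mulr_gt0 //= -[ltRHS]mulr1 ltr_pM2l //; rewrite /f; lra.
have := cos_lt1_circ fI; clearbody f.
have : cexp ('i * (2 * pi * f)%:C) = 1 :> R[i].
  rewrite -[RHS]e1 zE.
  have -> : 'i * (2 * pi%:C * (m%:~R + f%:C)) =
      'i * (2 * pi%:C * m%:~R) + 'i * (2 * pi%:C * f%:C) :> R[i] by ring.
  rewrite cexpD cexp_2pi_int mul1r.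
  by congr cexp; rewrite !rmorphM rmorph_nat.
by rewrite cexp_i => /(congr1 (@complex.Re R)) /= ->; rewrite ltxx.
Qed.

End Values.

Section PlemeljLimits.
Variable R : realType.
Notation mu := (@lebesgue_measure R).
Variables (z : R[i]) (t : R).
Hypotheses (z1 : -1 < Re z) (t0 : 0 < t) (t1 : t < 1).
Implicit Types (s x : R) (w : R[i]).

Definition log_ratio : R := 2^-1 * ln ((1 - t) ^+ 2) - 2^-1 * ln (t ^+ 2).

Lemma sin_near0 : \forall x \near (0 : R)^'+, 0 < sin x.
Proof.
apply: filterS2 (nbhs_right_gt (0 : R)) (nbhs_right_lt (@pi_gt0 R)) => x x0 x1.
by apply: sin_gt0_pi; rewrite x0.
Qed.

Lemma cvg_atan_right (g : R -> R) (l : R) : 0 < l -> g x @[x --> 0^'+] --> l ->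
  atan (g x / sin x) @[x --> 0^'+] --> pi / 2.
Proof.
move=> l0 gl.
have s0 : sin x @[x --> (0 : R)^'+] --> (0 : R).
  by rewrite -[X in _ --> X](@sin0 R); apply: cvg_at_right_filter; exact: continuous_sin.
have g0 : \forall x \near (0 : R)^'+, 0 < g x by exact: (cvgr_gt l).
have h : (sin x / g x) @[x --> (0 : R)^'+] --> (0 : R).
  rewrite -[X in _ --> X](mul0r l^-1); apply: cvgM => //; apply: cvgV => //.
  by rewrite gt_eqF.
have gp : \forall x \near (0 : R)^'+, 0 < sin x / g x.
  by apply: filterS2 g0 sin_near0 => x gx sx; exact: divr_gt0.
have h2 := (cvgrVy gp).2 h.
have h3 : (g x / sin x) @[x --> (0 : R)^'+] --> +oo.
  have <- : (fun x => (sin x / g x)^-1) = (fun x => g x / sin x).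
    by apply/funext => x; rewrite invf_div.
  exact: h2.
exact: (cvg_comp _ _ h3 (@cvgy_atan R)).
Qed.

Lemma cos_right0 : cos x @[x --> (0 : R)^'+] --> (1 : R).
Proof.
by rewrite -[X in _ --> X](@cos0 R); apply: cvg_at_right_filter; exact: continuous_cos.
Qed.

Lemma sin_right0 : sin x @[x --> (0 : R)^'+] --> (0 : R).
Proof.
by rewrite -[X in _ --> X](@sin0 R); apply: cvg_at_right_filter; exact: continuous_sin.
Qed.

Lemma log_part_Re_right0 :
  2^-1 * ln ((1 - t * cos x) ^+ 2 + (t * sin x) ^+ 2) - 2^-1 * ln (t ^+ 2)
    @[x --> (0 : R)^'+] --> log_ratio.
Proof.
have t1' := t1.
apply: cvgB; last exact: cvg_cst.
apply: cvgM; first exact: cvg_cst.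
have h : ((1 - t * cos x) ^+ 2 + (t * sin x) ^+ 2) @[x --> (0 : R)^'+] --> (1 - t) ^+ 2.
  rewrite -[X in _ --> X]addr0 -[X in _ --> _ + X](_ : (t * 0) ^+ 2 = 0); last first.
    by rewrite mulr0 expr0n.
  apply: cvgD; apply: cvg_sqr.
    apply: cvgB; first exact: cvg_cst.
    rewrite -[X in _ --> X]mulr1; apply: cvgM; [exact: cvg_cst|exact: cos_right0].
  by apply: cvgM; [exact: cvg_cst|exact: sin_right0].
apply: (cvg_comp _ _ h); apply: continuous_ln; rewrite exprn_even_gt0 //=; lra.
Qed.

Lemma atan_right0 : (atan ((1 - t * cos x) / (t * sin x)) + atan (cos x / sin x))
    @[x --> (0 : R)^'+] --> (pi : R).
Proof.
have [t0' t1'] := (t0, t1).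
rewrite (_ : pi = pi / 2 + pi / 2 :> R); last by field.
apply: cvgD.
- have -> : (fun x => atan ((1 - t * cos x) / (t * sin x))) =
      (fun x => atan (((1 - t * cos x) / t) / sin x)).
    by apply/funext => x; rewrite invfM mulrA.
  apply: (@cvg_atan_right _ ((1 - t * 1) / t)); first by rewrite divr_gt0 //; lra.
  apply: cvgM; last exact: cvg_cst.
  apply: cvgB; first exact: cvg_cst.
  by apply: cvgM; [exact: cvg_cst|exact: cos_right0].
- exact: (@cvg_atan_right _ 1 ltr01 cos_right0).
Qed.

(** Each of the two arctangents tends to pi / 2 from one side and to - pi / 2 from
    the other. *)
Lemma log_part_right0 :
  ccvg 0^'+ (log_part t) (log_ratio%:C + 'i * pi%:C) /\
  ccvg 0^'+ (fun x => log_part t (- x)) (log_ratio%:C - 'i * pi%:C).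
Proof.
have e1 : \forall x \near (0 : R)^'+, log_part t x =
  (2^-1 * ln ((1 - t * cos x) ^+ 2 + (t * sin x) ^+ 2) - 2^-1 * ln (t ^+ 2))
   +i* (atan ((1 - t * cos x) / (t * sin x)) + atan (cos x / sin x)).
  by apply: filterS sin_near0 => x sx; rewrite log_partE // gt_eqF.
have e2 : \forall x \near (0 : R)^'+, log_part t (- x) =
  (2^-1 * ln ((1 - t * cos x) ^+ 2 + (t * sin x) ^+ 2) - 2^-1 * ln (t ^+ 2))
   +i* (- (atan ((1 - t * cos x) / (t * sin x)) + atan (cos x / sin x))).
  apply: filterS sin_near0 => x sx; rewrite log_partE ?sinN ?oppr_eq0 ?gt_eqF //.
  rewrite cosN mulrN sqrrN; congr (_ +i* _).
  by rewrite !invrN !mulrN !atanN opprD.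
split; split.
- rewrite ReD Re_imag addr0.
  apply: cvg_trans log_part_Re_right0; apply: near_eq_cvg.
  by apply: filterS e1 => x ->.
- rewrite ImD Im_imag add0r.
  apply: cvg_trans atan_right0; apply: near_eq_cvg.
  by apply: filterS e1 => x ->.
- rewrite ReB Re_imag subr0.
  apply: cvg_trans log_part_Re_right0; apply: near_eq_cvg.
  by apply: filterS e2 => x ->.
- rewrite ImB Im_imag sub0r.
  apply: cvg_trans (cvgN atan_right0); apply: near_eq_cvg.
  by apply: filterS e2 => x ->.
Qed.

(** The principal value of the integral of s^z / (s - t) over [0, 1]: see
    [pv_cvg]. *)
Definition pv_value : R[i] :=
  cpow t z * log_ratio%:C + cintegral `[0, 1] (divdiff z t).

(** The Plemelj formulas: only the logarithmic part distinguishes the two sides. *)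
Lemma cauchyJ_right0 :
  ccvg 0^'+ (fun x => cauchyJ z (circ t x)) (pv_value + 'i * pi%:C * cpow t z) /\
  ccvg 0^'+ (fun x => cauchyJ z (circ t (2 * pi - x)))
    (pv_value - 'i * pi%:C * cpow t z).
Proof.
have [l1 l2] := log_part_right0.
have [c1 c2] := regular_part_cvg z1 t0 t1.
have h1 : ccvg 0^'+ (regular_part z t) (cintegral `[0, 1] (divdiff z t)).
  by rewrite -regular_part0 //; split; exact: cvg_at_right_filter.
have h2 : ccvg 0^'+ (fun x => regular_part z t (- x)) (cintegral `[0, 1] (divdiff z t)).
  have n0 : (- x) @[x --> (0 : R)^'+] --> (0 : R).
    by rewrite -[X in _ --> X]oppr0; apply: cvgN; apply: cvg_at_right_filter; exact: cvg_id.
  by rewrite -regular_part0 //; split; [exact: (cvg_comp _ _ n0 c1)|exact: (cvg_comp _ _ n0 c2)].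
have off x : 0 < sin x -> forall y, y = x \/ y = - x -> forall s, 0 <= s <= 1 -> s%:C != circ t y.
  move=> sx y yx s _; apply/eqP => /(congr1 (@complex.Im R)); rewrite Im_circ /= => /esym/eqP.
  rewrite mulf_eq0 gt_eqF //=.
  by case: yx => ->; rewrite ?sinN ?oppr_eq0 gt_eqF.
split.
- have -> : pv_value + 'i * pi%:C * cpow t z =
     cpow t z * (log_ratio%:C + 'i * pi%:C) + cintegral `[0, 1] (divdiff z t).
    by rewrite /pv_value; ring.
  have [d1 d2] := ccvgD (ccvgMl (cpow t z) l1) h1.
  split; [apply: cvg_trans d1|apply: cvg_trans d2]; apply: near_eq_cvg;
    by apply: filterS sin_near0 => x sx; rewrite cauchyJ_split //; apply: (off x) => //; left.
- have -> : pv_value - 'i * pi%:C * cpow t z =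
     cpow t z * (log_ratio%:C - 'i * pi%:C) + cintegral `[0, 1] (divdiff z t).
    by rewrite /pv_value; ring.
  have [d1 d2] := ccvgD (ccvgMl (cpow t z) l2) h2.
  split; [apply: cvg_trans d1|apply: cvg_trans d2]; apply: near_eq_cvg;
    by apply: filterS sin_near0 => x sx; rewrite circ_2piB cauchyJ_split //;
      apply: (off x) => //; right.
Qed.

End PlemeljLimits.

(** * Summation of the power series with coefficients 1 / (k - z) *)

Section Mellin.
Variable R : realType.
Variables (z : R[i]) (t : R).
Hypotheses (z1 : -1 < Re z) (t0 : 0 < t) (t1 : t < 1).
Hypothesis zint : forall m : int, z <> m%:~R.
Implicit Types (x : R) (w : R[i]).

Definition mellin_sum w (N : nat) : R[i] := \sum_(k < N) w ^+ k / (k%:R - z).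

Lemma nat_neq (k : nat) : k%:R != z.
Proof. by apply/eqP => kz; apply: (zint (m := k)); rewrite -kz. Qed.

(* The ratio of the integrating factor at the two ends of ]0, 2 pi[. *)
Let eps : R[i] := cexp (- ('i * z) * (2 * pi)%:C).

Lemma eps_neq1 : 1 - eps != 0.
Proof.
apply/eqP => /eqP; rewrite subr_eq0 => /eqP e1.
have [m zm] : exists m : int, z = m%:~R.
  apply: cexp_2pi_eq1; apply: (mulfI (cexp_neq0 (- ('i * z) * (2 * pi)%:C))).
  rewrite mulr1 -[RHS]e1 -cexpD -[RHS]cexp0; congr cexp.
  by rewrite rmorphM rmorph_nat; ring.
exact: zint zm.
Qed.

Let bound (N : nat) : R :=
  2 * (t ^+ N / (1 - t) * expR (`|Im z| * (2 * pi))) * (2 * pi).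

Lemma bound_cvg0 : bound n @[n --> \oo] --> (0 : R).
Proof.
have -> : (0 : R) = 2 * (0 / (1 - t) * expR (`|Im z| * (2 * pi))) * (2 * pi).
  by rewrite mul0r mul0r mulr0 mul0r.
apply: cvgM; last exact: cvg_cst.
apply: cvgM; first exact: cvg_cst.
apply: cvgM; last exact: cvg_cst.
apply: cvgM; last exact: cvg_cst.
by apply: cvg_expr; rewrite gtr0_norm.
Qed.

Lemma ccvg_right (f : R -> R[i]) l : ccvg (nbhs 0) f l -> ccvg 0^'+ f l.
Proof. by move=> [f1 f2]; split; exact: cvg_at_right_filter. Qed.

Lemma ccvg_comp (h : R -> R) (f : R -> R[i]) (F : set_system R) (a : R) l :
  h x @[x --> F] --> a -> ccvg (nbhs a) f l -> ccvg F (fun x => f (h x)) l.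
Proof. by move=> ha [f1 f2]; split; [exact: (cvg_comp _ _ ha f1)|exact: (cvg_comp _ _ ha f2)]. Qed.

Lemma mellin_sum_cvg_circ N a : ccvg (nbhs a) (fun x => mellin_sum (circ t x) N) (mellin_sum (circ t a) N).
Proof.
apply: ccvg_sum => k; apply: ccvgM; last exact: ccvg_cst.
by apply: ccvgX; exact: is_cderive_ccvg (is_cderive_circ t a).
Qed.

Lemma cexp_lin_cvg (b : R[i]) (a : R) :
  ccvg (nbhs a) (fun x => cexp (b * x%:C)) (cexp (b * a%:C)).
Proof. by apply: ccvg_cexp; apply: ccvgMl; exact: ccvg_real_id. Qed.

(* The limits of J plus the truncated sum at angles 0 and 2 pi. *)
Let plus N := pv_value z t + 'i * pi%:C * cpow t z + mellin_sum t%:C N.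
Let minus N := pv_value z t - 'i * pi%:C * cpow t z + mellin_sum t%:C N.

Lemma cauchyE_right0 N : ccvg 0^'+ (cauchyE z t N) (plus N) /\
  ccvg 0^'+ (fun x => cauchyE z t N (2 * pi - x)) (minus N * eps).
Proof.
have [c1 c2] := cauchyJ_right0 z1 t0 t1.
have h : (2 * pi - x) @[x --> (0 : R)^'+] --> (2 * pi : R).
  rewrite -[X in _ --> X]subr0; apply: cvgB; first exact: cvg_cst.
  by apply: cvg_at_right_filter; exact: cvg_id.
have ct : circ t (2 * pi) = t%:C by rewrite -[2 * pi]subr0 circ_2piB oppr0 circ0.
split.
- rewrite /cauchyE -[plus N]mulr1; apply: ccvgM.
    apply: ccvgD => //; apply: ccvg_right; have := mellin_sum_cvg_circ N 0.
    by rewrite circ0.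
  apply: ccvg_right; have := cexp_lin_cvg (- ('i * z)) 0.
  by rewrite mulr0 cexp0.
- rewrite /cauchyE; apply: ccvgM.
    apply: ccvgD => //; have := ccvg_comp h (mellin_sum_cvg_circ N (2 * pi)).
    by rewrite ct.
  exact: ccvg_comp h (cexp_lin_cvg _ _).
Qed.

Lemma le_cabs_lim (T : Type) (F : set_system T) (FF : ProperFilter F) (f : T -> R[i]) l (b : R) :
  ccvg F f l -> (\forall x \near F, cabs (f x) <= b) -> cabs l <= b.
Proof.
move=> fl fb; pose proof (@ccvg_cabs _ T F _ f l fl) as h.
by rewrite -(cvg_lim (@Rhausdorff R) h); apply: limr_le => //; apply/cvg_ex; eexists; exact: h.
Qed.

Lemma cauchyE_near_plus N x : 0 < x < 2 * pi ->
  cabs (cauchyE z t N x - plus N) <= bound N.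
Proof.
move=> /andP[x0 x2]; have [c1 _] := cauchyE_right0 N.
pose proof (ccvgB (ccvg_cst (cauchyE z t N x)) c1) as c3.
apply: (le_cabs_lim _ c3).
apply: filterS2 (nbhs_right_gt (0 : R)) (nbhs_right_lt x0) => y y0 yx.
by apply: cauchyE_near_constant => //; [exact: nat_neq|exact: ltW].
Qed.

(** An almost constant function has almost equal limits at both ends. Since plus
    and minus contain the same sum, this is a linear equation for that sum, up to
    an error that vanishes with N; it is solvable because eps is not 1. *)
Lemma near_plus_minus N : cabs (minus N * eps - plus N) <= bound N.
Proof.
have [_ c2] := cauchyE_right0 N.
pose proof (ccvgB c2 (ccvg_cst (plus N))) as c3.
apply: (le_cabs_lim _ c3).
have p2 : 0 < 2 * pi :> R by rewrite mulr_gt0 ?pi_gt0.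
apply: filterS2 (nbhs_right_gt (0 : R)) (nbhs_right_lt p2) => y y0 yx.
by apply: cauchyE_near_plus; apply/andP; split; lra.
Qed.

Let half_turn : R[i] := cexp ('i * (pi%:C * z)).

Let half_turnE : eps = half_turn ^- 2 /\ half_turn != 0.
Proof.
split; last exact: cexp_neq0.
rewrite /eps /half_turn -exprVn -cexpN expr2 -cexpD; congr cexp.
by rewrite rmorphM rmorph_nat; ring.
Qed.

Let sinpi : 2 * 'i * csin (pi%:C * z) = half_turn - half_turn^-1.
Proof. exact: csinE. Qed.

Let cospi : 2 * ccos (pi%:C * z) = half_turn + half_turn^-1.
Proof. exact: ccosE. Qed.

Let sqr_half : half_turn ^+ 2 - 1 != 0.
Proof.
have [e h0] := half_turnE; have := eps_neq1; rewrite e; apply: contra_neq => h1.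
by move/eqP: h1; rewrite subr_eq0 => /eqP ->; rewrite invr1 subrr.
Qed.

Lemma csin_pi_neq0 : csin (pi%:C * z) != 0.
Proof.
apply/eqP => s0; move: sinpi; rewrite s0 mulr0 => /esym /eqP.
have [_ h0] := half_turnE.
rewrite subr_eq0 => /eqP h; have := sqr_half; rewrite expr2 {1}h mulVf // subrr eqxx //.
Qed.

Let pv_algebra (P p c i e h : R[i]) : e = h ^- 2 -> h != 0 -> h ^+ 2 - 1 != 0 ->
  - (1 - e)^-1 * (0 - ((P - i * p * c) * e - (P + i * p * c))) =
  - (p * (i * (h ^+ 2 + 1) / (h ^+ 2 - 1))) * c - P.
Proof.
move=> -> hn0 hn1; field.
by rewrite hn0 hn1.
Qed.

Lemma mellin_pv : ccvg \oo (mellin_sum t%:C)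
  (- (pi%:C * ccot (pi%:C * z)) * cpow t z - pv_value z t).
Proof.
have [ee h0] := half_turnE; have e1 := eps_neq1.
have c0 : ccvg \oo (fun N => minus N * eps - plus N) 0.
  apply: (@ccvg_squeeze _ _ _ _ _ bound); last exact: bound_cvg0.
  by apply: nearW => N; rewrite subr0; exact: near_plus_minus.
pose proof (ccvgMl (- (1 - eps)^-1) (ccvgB c0 (ccvg_cst ((pv_value z t - 'i * pi%:C * cpow t z) * eps - (pv_value z t + 'i * pi%:C * cpow t z))))) as c1.
move: c1; rewrite [X in ccvg _ X _](_ : _ = mellin_sum t%:C); last first.
  by apply/funext => N; rewrite /minus /plus; field.
suff -> : - (1 - eps)^-1 * (0 - ((pv_value z t - 'i * pi%:C * cpow t z) * eps -
    (pv_value z t + 'i * pi%:C * cpow t z))) =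
   - (pi%:C * ccot (pi%:C * z)) * cpow t z - pv_value z t by [].
have -> : ccot (pi%:C * z) = 'i * (half_turn ^+ 2 + 1) / (half_turn ^+ 2 - 1).
  have i0 := i_neq0 R; have t20 := two_neq0 R.
  have cE : ccos (pi%:C * z) = (half_turn + half_turn^-1) / 2.
    by rewrite -cospi; field.
  have sE : csin (pi%:C * z) = (half_turn - half_turn^-1) / (2 * 'i).
    by rewrite -sinpi; field.
  by rewrite /ccot cE sE; field; rewrite h0 sqr_half i0.
exact: pv_algebra.
Qed.

(** The almost constant function is close to its limit at angle 0, which
    [mellin_pv] makes explicit. *)
Lemma mellin_formula x : 0 < x < 2 * pi ->
  ccvg \oo (mellin_sum (circ t x))
    (- (pi%:C * ccsc (pi%:C * z)) * cexp ('i * (z * (x - pi)%:C)) * cpow t z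
     - cauchyJ z (circ t x)).
Proof.
move=> xx.
have [ee h0] := half_turnE; have e1 := eps_neq1.
have c0 : ccvg \oo (fun N => cauchyE z t N x - plus N) 0.
  apply: (@ccvg_squeeze _ _ _ _ _ bound); last exact: bound_cvg0.
  by apply: nearW => N; rewrite subr0; exact: cauchyE_near_plus.
pose proof (ccvgD c0 (ccvgD (ccvg_cst (pv_value z t + 'i * pi%:C * cpow t z)) mellin_pv)) as c1.
pose proof (ccvgB (ccvgMl (cexp ('i * z * x%:C)) c1) (ccvg_cst (cauchyJ z (circ t x)))) as c2.
move: c2; rewrite [X in ccvg _ X _](_ : _ = mellin_sum (circ t x)); last first.
  apply/funext => N; rewrite /cauchyE -/(mellin_sum _ N).
  have := cexpN_mul ('i * z * x%:C); rewrite -mulNr => h.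
  transitivity (cexp ('i * z * x%:C) * cexp (- ('i * z) * x%:C) *
    (cauchyJ z (circ t x) + mellin_sum (circ t x) N) - cauchyJ z (circ t x)).
    by rewrite /plus; ring.
  by rewrite h; ring.
rewrite add0r.
suff -> : cexp ('i * z * x%:C) *
     (pv_value z t + 'i * pi%:C * cpow t z +
      (- (pi%:C * ccot (pi%:C * z)) * cpow t z - pv_value z t)) =
   - (pi%:C * ccsc (pi%:C * z)) * cexp ('i * (z * (x - pi)%:C)) * cpow t z by [].
have -> : cexp ('i * (z * (x - pi)%:C)) = cexp ('i * z * x%:C) * half_turn^-1.
  by rewrite /half_turn -cexpN -cexpD; congr cexp; rewrite rmorphB; ring.
have s0 := csin_pi_neq0.
have h1 : half_turn^-1 = ccos (pi%:C * z) - 'i * csin (pi%:C * z).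
  apply: (mulfI (two_neq0 R)); rewrite mulrBr cospi mulrA sinpi; ring.
by rewrite /ccot /ccsc h1; field.
Qed.

End Mellin.

(** * The principal value as a limit of truncated integrals *)

Section PrincipalValue.
Variable R : realType.
Notation mu := (@lebesgue_measure R).

Lemma cintegral_split (a x b : R) (f : R -> R[i]) : a <= x -> x <= b ->
  cintegrable `[a, b] f ->
  cintegral `[a, b] f = cintegral `[a, x] f + cintegral `[x, b] f.
Proof.
move=> ax xb [f1 f2].
have h (g : R -> R) : mu.-integrable `[a, b] (EFin \o g) ->
   \int[mu]_(s in `[a, b]) g s = \int[mu]_(s in `[a, x]) g s + \int[mu]_(s in `[x, b]) g s.
  move=> gi; apply/eqP; rewrite addrC -subr_eq; apply/eqP.
  rewrite Rintegral_itvB ?bnd_simp // Rintegral_itv_obnd_cbnd //.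
  by apply: integrableS gi => //; apply: subset_itvr; rewrite bnd_simp.
by apply: eqc; rewrite ?ReD ?ImD; exact: h.
Qed.

Lemma cintegral_cvg_right (a b : R) (f : R -> R[i]) : a < b -> cintegrable `[a, b] f ->
  ccvg b^'- (fun x => cintegral `[a, x] f) (cintegral `[a, b] f).
Proof.
by move=> ab [f1 f2]; split; exact: parameterized_integral_cvg_at_left.
Qed.

Variables (z : R[i]) (t : R).
Hypotheses (z1 : -1 < Re z) (t0 : 0 < t) (t1 : t < 1).
Implicit Types (s x e : R).

Definition own_leg e : set R := [set s | 0 <= s <= 1 /\ e <= `|t - s|].

Lemma own_legE e : own_leg e = `[0, 1] `&` (`]-oo, t - e] `|` `[t + e, +oo[).
Proof.
apply/seteqP; split => s; rewrite /own_leg /= !in_itv /= andbT ler_normr opprB.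
  by move=> [-> /orP[h|h]]; split => //; [left|right]; lra.
by move=> [-> [h|h]]; split => //; apply/orP; [left|right]; lra.
Qed.

Lemma measurable_own_leg e : measurable (own_leg e).
Proof. by rewrite own_legE; apply: measurableI => //; exact: measurableU. Qed.

Lemma cintegrable_own_leg e : 0 < e ->
  cintegrable (own_leg e) (fun s => cpow s z * (s%:C - t%:C)^-1).
Proof.
move=> e0; apply: (@cintegrable_bounded_mul _ _ _ _ e^-1).
- exact: measurable_own_leg.
- apply: cintegrableS (cintegrable_cpow z1) => //; first exact: measurable_own_leg.
  by move=> s [s01 _]; rewrite /= in_itv.
- exact: measurable_Re_resolvent.
- exact: measurable_Im_resolvent.
- move=> s [_ h]; rewrite -rmorphB -fmorphV cabs_real normfV distrC.
  by rewrite lef_pV2 ?posrE //; exact: lt_le_trans h.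
Qed.

(** The logarithm of the square serves on both sides of t. *)
Lemma log_derive s : s != t ->
  is_cderive s (fun u : R => (2^-1 * ln ((u - t) ^+ 2))%:C) (s%:C - t%:C)^-1.
Proof.
move=> st; have st0 : s - t != 0 by rewrite subr_eq0.
rewrite -rmorphB -fmorphV; apply: is_cderive_real.
have ds : is_derive s 1 (fun u : R => u - t) (1 : R).
  by apply: is_derive_eq (is_deriveB (is_derive_id s 1) (is_derive_cst t s 1)) _;
    rewrite subr0.
have dN : is_derive s 1 (fun u => (u - t) ^+ 2) (2 * (s - t)).
  have -> : (fun u => (u - t) ^+ 2) = (fun u => u - t) * (fun u => u - t).
    by apply/funext => u; rewrite expr2.
  by apply: is_derive_eq (is_deriveM ds ds) _; rewrite /GRing.scale /=; ring.
have n0 : 0 < (s - t) ^+ 2 by rewrite exprn_even_gt0.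
have dl := @is_derive1_comp R (@ln R) (fun u => (u - t) ^+ 2) s _ _ (is_derive1_ln n0) dN.
apply: is_derive_eq (is_deriveZ 2^-1 dl) _.
by rewrite /GRing.scale /=; field.
Qed.

(** After t^z is subtracted from s^z the integrand is integrable, and the
    logarithms contributed by t - e and t + e cancel. *)
Lemma pv_cvg : ccvg 0^'+
  (fun e => cintegral (own_leg e) (fun s => cpow s z * (s%:C - t%:C)^-1))
  (pv_value z t).
Proof.
have [t0' t1'] := (t0, t1).
have di := divdiff_integrable z1 t0 t1.
have diS a b : 0 <= a -> b <= 1 -> cintegrable `[a, b] (divdiff z t).
  by move=> a0 b1; apply: cintegrableS di => //; apply: subset_itv; rewrite bnd_simp.
have ptL : (t - e) @[e --> (0 : R)^'+] --> t^'-.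
  move=> A [d /= d0 dA]; exists d => // e; rewrite /= sub0r normrN => ed e0.
  apply: dA => /=; first by rewrite opprB addrC subrK.
  by lra.
have ptR : (t + e) @[e --> (0 : R)^'+] --> t^'+.
  move=> A [d /= d0 dA]; exists d => // e; rewrite /= sub0r normrN => ed e0.
  apply: dA => /=; first by rewrite opprD addrA subrr sub0r normrN.
  by lra.
have [A1 A2] := cintegral_cvg_right t0 (diS 0 t (lexx _) (ltW t1)).
have [B1 B2] := cintegral_cvg_left t1 (diS t 1 (ltW t0) (lexx _)).
have cA : ccvg 0^'+ (fun e => cintegral `[0, t - e] (divdiff z t))
    (cintegral `[0, t] (divdiff z t)).
  by split; [exact: (cvg_comp _ _ ptL A1)|exact: (cvg_comp _ _ ptL A2)].
have cB : ccvg 0^'+ (fun e => cintegral `[t + e, 1] (divdiff z t))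
    (cintegral `[t, 1] (divdiff z t)).
  by split; [exact: (cvg_comp _ _ ptR B1)|exact: (cvg_comp _ _ ptR B2)].
have [c1 c2] := ccvgD (ccvg_cst (F := (0 : R)^'+) (cpow t z * (log_ratio t)%:C)) (ccvgD cA cB).
rewrite /pv_value (cintegral_split (ltW t0) (ltW t1) di).
pose f s : R[i] := cpow s z * (s%:C - t%:C)^-1.
have main : \forall e \near (0 : R)^'+, cintegral (own_leg e) f =
    cpow t z * (log_ratio t)%:C + (cintegral `[0, t - e] (divdiff z t) +
      cintegral `[t + e, 1] (divdiff z t)).
  have m0 : 0 < Num.min t (1 - t) by rewrite lt_min t0 subr_gt0.
  apply: filterS2 (nbhs_right_gt (0 : R)) (nbhs_right_lt m0) => e e0.
  rewrite lt_min => /andP[et e1].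
  have oE : own_leg e = `[0, t - e] `|` `[t + e, 1].
    rewrite own_legE; apply/seteqP; split => s; rewrite /= !in_itv /= ?andbT.
      by move=> [/andP[s0 s1] [h|h]]; [left|right]; apply/andP.
    by move=> [|] /andP[h1 h2]; split; [apply/andP; split; lra|left|apply/andP; split; lra|right].
  have piece a b : 0 <= a -> a < b -> b <= 1 -> (forall s, a <= s <= b -> s != t) ->
      cintegrable `[a, b] f /\
      cintegral `[a, b] f = cpow t z * (2^-1 * ln ((b - t) ^+ 2) - 2^-1 * ln ((a - t) ^+ 2))%:C
        + cintegral `[a, b] (divdiff z t).
    move=> a0 ab b1 off.
    have offc s : a <= s <= b -> s%:C != t%:C :> R[i].
      by move=> /off st; rewrite (inj_eq (@complexI R)).
    have ir : cintegrable `[a, b] (fun s : R => (s%:C - t%:C)^-1).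
      by apply: cintegrable_continuous => s /offc; exact: ccvg_resolvent.
    have iz := cintegrableZ (cpow t z) (measurable_itv `[a, b]) ir.
    have fE : {in `[a, b]%classic, (fun s => cpow t z * (s%:C - t%:C)^-1 + divdiff z t s) =1 f}.
      move=> s /[!inE] /=; rewrite in_itv /= => ss; have := offc s ss.
      by rewrite -subr_eq0 => d0; rewrite /f /divdiff; field.
    split.
      by apply: (eq_cintegrable _ fE) => //; apply: cintegrableD => //; exact: diS.
    rewrite -(eq_cintegral fE) cintegralD //; last exact: diS.
    rewrite cintegralZ // (@cFTC _ (fun u : R => (2^-1 * ln ((u - t) ^+ 2))%:C)) //.
    - by rewrite rmorphB.
    - by move=> s /off; exact: log_derive.
    - by move=> s /offc; exact: ccvg_resolvent.
  have te : 0 < t - e by lra.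
  have te1 : t + e < 1 by lra.
  have off1 s : 0 <= s <= t - e -> s != t.
    by move=> /andP[_ h]; rewrite lt_eqF //; lra.
  have off2 s : t + e <= s <= 1 -> s != t.
    by move=> /andP[h _]; rewrite gt_eqF //; lra.
  have te2 : t - e <= 1 by lra.
  have te3 : 0 <= t + e by lra.
  have [i1 v1] := piece 0 (t - e) (lexx _) te te2 off1.
  have [i2 v2] := piece (t + e) 1 te3 te1 (lexx _) off2.
  rewrite oE cintegral_setU //; last first.
    apply/disj_setPS => s; rewrite /= !in_itv /= => -[/andP[_ h1] /andP[h2 _]]; lra.
  rewrite v1 v2 /log_ratio.
  have -> : (t - e - t) ^+ 2 = (t + e - t) ^+ 2 by ring.
  rewrite sub0r sqrrN !rmorphB; ring.
split; [apply: cvg_trans c1|apply: cvg_trans c2]; apply: near_eq_cvg;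
  by apply: filterS main => e ->.
Qed.

End PrincipalValue.

(** * One linear form for the matrices and the kernel *)

(** A constant of its own, because pi unfolds to a multiple of another number and
    algebraic normalization would expose that. *)
Definition pic (R : realType) : R[i] := (pi : R)%:C.

Section KernelMatrix.
Variable R : realType.
Variables (l1 l2 : R) (theta : R).
Implicit Types (a b c d e : R[i]).
Let c1 : R[i] := l1%:C.
Let c2 : R[i] := l2%:C.
Let u : R[i] := cexp ('i * theta%:C).

(** The block between different legs. For the kernel itself b and Q are the
    conjugates of a and P, so that im, re, qre, qim are imaginary and real parts;
    without conjugation the block is linear in a, b, P, Q, which lets it be
    integrated and summed argument by argument. *)
Definition cross_block (sg a b P Q : R[i]) : seq (seq R[i]) :=
  let im := (a - b) / (2 * 'i) in
  let re := (a + b) / 2 in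
  let qre := (P + Q) / 2 in
  let qim := (P - Q) / (2 * 'i) in
  [:: [:: - (c1 / pic R * im) - c2 / pic R * (im / 2 + qre / 2);
          sg * (c1 / pic R * re) - c2 / pic R * (qim / 2)];
      [:: - (sg * (c1 / pic R * re)) - c2 / pic R * (qim / 2);
          - (c1 / pic R * im) - c2 / pic R * (im / 2 - qre / 2)]].

Definition crossAB a b c d : seq (seq R[i]) :=
  cross_block 1 a b ((sin theta)%:C * u * c) ((sin theta)%:C / u * d).
Definition crossBA a b c d : seq (seq R[i]) :=
  cross_block (-1) a b ((sin theta)%:C * u * d) ((sin theta)%:C / u * c).

(** The diagonal blocks carry the pole of the kernel at the target on the same leg
    (argument e), the others the pair of poles on the rotated leg: simple ones
    (a, b) and double ones (c, d). *)
Definition kernel_mx a b c d e : 'M[R[i]]_4 :=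
  let X i j := (nth [::] (crossAB a b c d) i)`_j in
  let Y i j := (nth [::] (crossBA a b c d) i)`_j in
  let D := c1 / pic R * e in
  \matrix_(i, j) (nth [::]
  [:: [:: 0; - D; X 0%N 0%N; X 0%N 1%N];
      [:: D; 0; X 1%N 0%N; X 1%N 1%N];
      [:: Y 0%N 0%N; Y 0%N 1%N; 0; D];
      [:: Y 1%N 0%N; Y 1%N 1%N; - D; 0]] i)`_j.

Lemma mx4P (M N : 'M[R[i]]_4) :
  (forall i j : nat, (i < 4)%N -> (j < 4)%N -> M (inord i) (inord j) = N (inord i) (inord j)) -> M = N.
Proof.
by move=> h; apply/matrixP => i j; rewrite -(inord_val i) -(inord_val j); apply: h.
Qed.

Ltac mx4 := apply: mx4P => -[|[|[|[|//]]]] [|[|[|[|//]]]] _ _;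
  rewrite ?mxE -?val_eqE /= ?inordK //=.

Lemma kernel_mxD a b c d e a' b' c' d' e' :
  kernel_mx a b c d e + kernel_mx a' b' c' d' e' =
  kernel_mx (a + a') (b + b') (c + c') (d + d') (e + e').
Proof. mx4; ring. Qed.

Lemma kernel_mxZ x a b c d e :
  x *: kernel_mx a b c d e = kernel_mx (x * a) (x * b) (x * c) (x * d) (x * e).
Proof. mx4; ring. Qed.

Let un0 : u != 0. Proof. exact: cexp_neq0. Qed.

Lemma cos_cexpE (x : R) : (cos x)%:C = (cexp ('i * x%:C) + (cexp ('i * x%:C))^-1) / 2 :> R[i].
Proof.
rewrite -cexpN cexp_i cexp_Ni; apply: (mulIf (two_neq0 R)); rewrite divfK ?two_neq0 //.
by rewrite mulr_natr mulr2n; apply: eqc => /=; ring.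
Qed.

Lemma sin_cexpE (x : R) : (sin x)%:C = (cexp ('i * x%:C) - (cexp ('i * x%:C))^-1) / (2 * 'i) :> R[i].
Proof.
have n0 : 2 * 'i != 0 :> R[i] by rewrite mulf_neq0 ?two_neq0 ?i_neq0.
rewrite -cexpN cexp_i cexp_Ni; apply: (mulIf n0); rewrite divfK //.
rewrite (mulrC 2) mulrA mulr_natr mulr2n.
by apply: eqc; rewrite ?(ReD, ImD, ReB, ImB, Re_realM, Im_realM) /=; ring.
Qed.

Lemma i2 : 'i ^+ 2 = -1 :> R[i]. Proof. by rewrite expr2 mulii. Qed.

(** Every entry is a rational function of z, of u = e^(i theta) and of
    v = e^(i z (pi - theta)); the identity is one of rational functions. *)
Lemma wedgeA_kernel (lambda mu : R) (z : R[i]) :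
  lame_c1 lambda mu = l1 -> lame_c2 lambda mu = l2 -> csin (pic R * z) != 0 ->
  let q := ccsc (pic R * z) in
  let ap := - (pic R * q) * cexp ('i * (z * (theta - pi)%:C)) in
  let am := - (pic R * q) * cexp ('i * (z * (pi - theta)%:C)) in
  wedgeA lambda mu z theta =
   (- 2^-1)%:M + kernel_mx ap am (z * ap) (z * am) (- (pic R * ccot (pic R * z))).
Proof.
move=> e1 e2 s0 q ap am; rewrite /wedgeA e1 e2.
have pi0 : pic R != 0 by rewrite eq_complex /= gt_eqF ?pi_gt0.
pose v : R[i] := cexp ('i * (z * (pi - theta)%:C)).
have v0 : v != 0 by exact: cexp_neq0.
have apE : ap = - (pic R * q) * v^-1.
  rewrite /ap /v -cexpN; congr (_ * cexp _); rewrite !rmorphB; ring.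
have amE : am = - (pic R * q) * v by [].
have SE : csin (z * (pi - theta)%:C) = (v - v^-1) / (2 * 'i).
  by rewrite /csin cexpN.
have CE : ccos (z * (pi - theta)%:C) = (v + v^-1) / 2.
  by rewrite /ccos cexpN.
have shift (k : R[i]) (m : R[i]) : cexp ('i * (k * theta%:C)) = m ->
   csin (pic R * z - (z - k) * theta%:C) = (v * m - (v * m)^-1) / (2 * 'i).
  move=> km; rewrite /csin cexpN; suff -> : cexp ('i * (pic R * z - (z - k) * theta%:C)) = v * m by [].
  by rewrite -km /v -cexpD; congr cexp; rewrite /pic !rmorphB; ring.
have m1 : cexp ('i * (1 * theta%:C)) = u by rewrite mul1r.
have m2 : cexp ('i * (2 * theta%:C)) = u ^+ 2.
  by rewrite /u -cexpMn; congr cexp; ring.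
have mN1 : cexp ('i * ((-1) * theta%:C)) = u^-1.
  by rewrite mulN1r mulrN cexpN.
have mN2 : cexp ('i * ((-2) * theta%:C)) = u ^- 2.
  by rewrite mulNr mulrN cexpN m2.
have sh1 := shift _ _ m1; have sh2 := shift _ _ m2.
have shN1 := shift _ _ mN1; have shN2 := shift _ _ mN2.
rewrite !opprK in shN1 shN2.
have sE := sin_cexpE theta; rewrite -/u in sE.
have n2 := two_neq0 R; have i0 := i_neq0 R; have ii := i2.
have pE : (pi : R)%:C = pic R by [].
mx4; rewrite ?pE;
  rewrite ?mulr0n ?mulr1n ?add0r ?addr0 //;
  rewrite ?SE ?CE ?sh1 ?sh2 ?shN1 ?shN2 ?sE ?apE ?amE -/q -?/c1 -?/c2.
all: move: pi0; generalize (pic R) => P P0; field: ii.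
all: by rewrite ?P0 ?n2 ?i0 ?un0 ?v0.
Qed.

(** The double-pole integral is w dJ/dw, hence the factor k in the corresponding
    arguments. *)
Lemma wedgeF_kernel (lambda mu : R) (k : nat) (z : R[i]) :
  lame_c1 lambda mu = l1 -> lame_c2 lambda mu = l2 -> k%:R - z != 0 ->
  wedgeF lambda mu k z theta = - kernel_mx (u ^+ k / (k%:R - z)) (u ^- k / (k%:R - z))
    (k%:R * (u ^+ k / (k%:R - z))) (k%:R * (u ^- k / (k%:R - z))) (k%:R - z)^-1.
Proof.
move=> e1 e2 kz; rewrite /wedgeF /wedgeF0 e1 e2.
have pi0 : pic R != 0 by rewrite eq_complex /= gt_eqF ?pi_gt0.
have pE : (pi : R)%:C = pic R by [].
have n2 := two_neq0 R; have i0 := i_neq0 R; have ii := i2.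
case: k kz => [|k] kz.
  have z0 : z != 0 by move: kz; rewrite sub0r oppr_eq0.
  rewrite sub0r expr0 invr1; mx4; rewrite ?pE -?/c1 -?/c2;
    move: pi0; generalize (pic R) => P P0; field: ii.
  all: rewrite ?P0 ?n2 ?i0 ?un0 ?z0 ?kz ?oppr_eq0 //.
pose v : R[i] := u ^+ k.+1.
have v0 : v != 0 by rewrite expf_neq0.
have kE (n : R) (m : R[i]) : cexp ('i * (n * theta)%:C) = m ->
    ((sin (n * theta))%:C = (m - m^-1) / (2 * 'i)) /\ ((cos (n * theta))%:C = (m + m^-1) / 2).
  by move=> <-; rewrite sin_cexpE cos_cexpE.
have uk : cexp ('i * (k.+1%:R * theta)%:C) = v.
  by rewrite /v /u -cexpMn; congr cexp; rewrite rmorphM rmorph_nat; ring.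
have u2 : cexp ('i * (2 * theta)%:C) = u ^+ 2.
  by rewrite /u -cexpMn; congr cexp; rewrite rmorphM rmorph_nat; ring.
have [s0 c0] := kE _ _ uk.
have [s1 _] : ((sin ((k.+1%:R - 2) * theta))%:C = (v / u ^+ 2 - (v / u ^+ 2)^-1) / (2 * 'i)) /\ True.
  split=> //; apply: (kE _ _ _).1; rewrite -uk -u2 -cexpN -cexpD; congr cexp.
  by rewrite mulrBl rmorphB; ring.
have [s2 _] : ((sin ((k.+1%:R + 2) * theta))%:C = (v * u ^+ 2 - (v * u ^+ 2)^-1) / (2 * 'i)) /\ True.
  split=> //; apply: (kE _ _ _).1; rewrite -uk -u2 -cexpD; congr cexp.
  by rewrite mulrDl rmorphD; ring.
have [s3 _] : ((sin ((1 - k.+1%:R) * theta))%:C = (u / v - (u / v)^-1) / (2 * 'i)) /\ True.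
  split=> //; apply: (kE _ _ _).1; rewrite -uk -cexpN -cexpD; congr cexp.
  by rewrite mulrBl rmorphB mul1r; ring.
have [s4 _] : ((sin ((1 + k.+1%:R) * theta))%:C = (u * v - (u * v)^-1) / (2 * 'i)) /\ True.
  split=> //; apply: (kE _ _ _).1; rewrite -uk -cexpD; congr cexp.
  by rewrite mulrDl rmorphD mul1r; ring.
have s5 : (sin theta)%:C = (u - u^-1) / (2 * 'i) by exact: sin_cexpE.
rewrite /wedgeF_form.
mx4; rewrite ?pE; rewrite ?(rmorphD, rmorphB, rmorphM, rmorphN, rmorph_nat) /=.
all: rewrite ?s0 ?c0 ?s1 ?s2 ?s3 ?s4 ?s5.
all: move: pi0; generalize (pic R) => P P0; rewrite -?/v -?/c1 -?/c2.
all: field: ii.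
all: have kz1 : 1 + k%:R - z != 0 by rewrite nat1r.
all: by rewrite ?P0 ?n2 ?i0 ?un0 ?v0 ?kz1.
Qed.

End KernelMatrix.

Section Kernel.
Variable R : realType.
Variables (lambda mu : R).
Hypothesis lm : lambda + 2 * mu != 0.

Lemma dotE (a b c d : R) : dot (vec2 a b) (vec2 c d) = a * c + b * d.
Proof. by rewrite /dot mxE !big_ord_recl big_ord0 !mxE addr0. Qed.

Lemma vec2B (a b c d : R) : vec2 a b - vec2 c d = vec2 (a - c) (b - d).
Proof. by apply/matrixP => i j; rewrite !mxE; case: i => -[|[|]]. Qed.

Lemma enorm_sqr (a b : R) : enorm (vec2 a b) ^+ 2 = a ^+ 2 + b ^+ 2.
Proof. by rewrite /enorm dotE sqr_sqrtr -?expr2 ?addr_ge0 ?sqr_ge0. Qed.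

Lemma kernelDE (x0 x1 y0 y1 n0 n1 t0 t1 : R) :
  let K := kernelD lambda mu (vec2 x0 x1) (vec2 y0 y1) (vec2 n0 n1) (vec2 t0 t1) in
  let c1 := lame_c1 lambda mu in let c2 := lame_c2 lambda mu in
  let r0 := x0 - y0 in let r1 := x1 - y1 in
  let nr := n0 * r0 + n1 * r1 in let tr := t0 * r0 + t1 * r1 in
  let N := r0 ^+ 2 + r1 ^+ 2 in
  [/\ K 0 0 = 2 * c1 * (nr / (2 * pi * N)) + c2 * (nr / (pi * N ^+ 2)) * (r0 * r0),
      K 0 1 = 2 * c1 * (tr / (2 * pi * N)) + c2 * (nr / (pi * N ^+ 2)) * (r0 * r1),
      K 1 0 = - (2 * c1 * (tr / (2 * pi * N))) + c2 * (nr / (pi * N ^+ 2)) * (r0 * r1) &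
      K 1 1 = 2 * c1 * (nr / (2 * pi * N)) + c2 * (nr / (pi * N ^+ 2)) * (r1 * r1)].
Proof.
move=> K c1 c2 r0 r1 nr tr N.
have e1 : mu / (lambda + 2 * mu) = 2 * c1.
  by rewrite /c1 /lame_c1; field; rewrite lm.
have e4 : enorm (vec2 r0 r1) ^+ 4 = N ^+ 2.
  by rewrite -[4%N]/(2 * 2)%N exprM enorm_sqr.
rewrite /K /kernelD vec2B !dotE e1 e4 enorm_sqr -/N -/nr -/tr -/(lame_c2 lambda mu) -/c2.
have LE : Lmx R = \matrix_(i, j) (nth [::] [:: [:: 0; 1]; [:: -1; 0]] i)`_j.
  apply/matrixP => i j; rewrite /Lmx !mxE; case: splitP => k ->; rewrite !mxE !ord1 /=;
    by case: i => -[|[|]].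
by split; rewrite LE !mxE big_ord_recl big_ord0 !mxE /= /r0 /r1; ring.
Qed.

Lemma ord2P (P : 'I_2 -> Prop) : P 0 -> P 1 -> forall i, P i.
Proof.
by move=> P0 P1 [[|[|//]] h]; [move: P0|move: P1]; congr P; apply: val_inj.
Qed.

End Kernel.

(** * Convergence of complex matrices *)

Section MatrixCvg.
Variable R : realType.

(** A ball of R[i] has a complex radius; positivity forces it to be real. *)
Lemma entourage_complexP (A : set (R[i] * R[i])) :
  entourage A <-> exists2 e : R, 0 < e & forall x y, cabs (x - y) < e -> A (x, y).
Proof.
have E (x y : R[i]) (e : R) : ball x e%:C y <-> cabs (x - y) < e.
  by rewrite -ball_normE /ball_ /= ltcR.
rewrite -entourage_ballE; split.
- move=> [[e e'] /=]; rewrite ltcE /= => /andP[/eqP -> e0] sA.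
  by exists e => // x y xy; apply: sA; apply/E.
- move=> [e e0 sA]; exists e%:C => /=; first by rewrite ltcR.
  by move=> [x y] /= /E; exact: sA.
Qed.

Lemma cvg_mxP (T : Type) (F : set_system T) (FF : Filter F) (m n : nat)
    (f : T -> 'M[R[i]]_(m, n)) (M : 'M[R[i]]_(m, n)) :
  f x @[x --> F] --> M <-> forall i j, ccvg F (fun x => f x i j) (M i j).
Proof.
split.
- move=> /cvg_mx_entourageP h i j.
  have hc (g : R[i] -> R) : (forall x y, `|g x - g y| <= cabs (x - y)) ->
      g (f x i j) @[x --> F] --> g (M i j).
    move=> gl; apply/cvgrPdist_lt => e e0.
    have ent : entourage [set xy : R[i] * R[i] | cabs (xy.1 - xy.2) < e].
      by apply/entourage_complexP; exists e.
    have hn : \forall x \near F, forall i j, (M i j, f x i j) \in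
        [set xy : R[i] * R[i] | cabs (xy.1 - xy.2) < e] := h _ ent.
    by apply: filterS hn => x /(_ i j); rewrite inE /=; apply: le_lt_trans.
  by split; apply: hc => x y; rewrite -(ReB, ImB) ?normRe_le ?normIm_le.
- move=> h; apply/cvg_mx_entourageP => A /entourage_complexP[e e0 eA].
  have e2 : 0 < e / 2 by rewrite divr_gt0.
  apply: filter_forall => i; apply: filter_forall => j.
  have [h1 h2] := h i j.
  have n1 := (cvgrPdist_lt _ _).1 h1 _ e2; have n2 := (cvgrPdist_lt _ _).1 h2 _ e2.
  suff : \forall x \near F, (M i j, f x i j) \in A by [].
  refine (@filterS2 T F FF (fun x => `|Re (M i j) - Re (f x i j)| < e / 2)
    (fun x => `|Im (M i j) - Im (f x i j)| < e / 2) _ _ (n1 FF) (n2 FF)) => x x1 x2.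
  rewrite inE; apply: eA.
  rewrite (le_lt_trans (cabs_le _)) // ReB ImB (splitr e); exact: ltrD.
Qed.

Lemma cvg_mx_lim (T : Type) (F : set_system T) (FF : ProperFilter F) (m n : nat)
    (f : T -> 'M[R[i]]_(m, n)) (M : 'M[R[i]]_(m, n)) :
  (forall i j, ccvg F (fun x => f x i j) (M i j)) ->
  cvg (f x @[x --> F]) /\ lim (f x @[x --> F]) = M.
Proof.
move=> h; have fM : f x @[x --> F] --> M by apply/cvg_mxP.
have cf : cvg (f x @[x --> F]) by apply/cvg_ex; exists M.
split => //; have fl : f x @[x --> F] --> lim (f x @[x --> F]) := cf.
apply/matrixP => i j; move/cvg_mxP : fl => /(_ i j) fl.
exact: ccvg_unique fl (h i j).
Qed.

End MatrixCvg.

(** * The integrand of the layer potential *)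

Section Integrand.
Variable R : realType.
Variables (lambda mu theta : R) (z : R[i]) (p : 'cV[R[i]]_4).
Hypothesis lm : lambda + 2 * mu != 0.
Let l1 := lame_c1 lambda mu.
Let l2 := lame_c2 lambda mu.

Definition mx2 (l : seq (seq R[i])) : 'M[R[i]]_2 := \matrix_(i, j) (nth [::] l i)`_j.

Definition own_block (l : R) (e : R[i]) : 'M[R[i]]_2 :=
  mx2 [:: [:: 0; - (l%:C / pic R * e)]; [:: l%:C / pic R * e; 0]].

Lemma kernel_mx_block (k1 k2 : R) (a b c d e : R[i]) :
  kernel_mx k1 k2 theta a b c d e =
  block_mx (own_block k1 e) (mx2 (crossAB k1 k2 theta a b c d))
    (mx2 (crossBA k1 k2 theta a b c d)) (- own_block k1 e) :> 'M[R[i]]_(2 + 2).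
Proof.
apply/matrixP => i j; rewrite !mxE.
case: splitP => i' ei; rewrite !mxE; case: splitP => j' ej; rewrite !mxE ei ej.
all: case: i' {ei} => -[|[|//]] ?; case: j' {ej} => -[|[|//]] ?.
all: by rewrite /= ?oppr0 ?opprK.
Qed.

Lemma usubmx_kernel (k1 k2 : R) (a b c d e : R[i]) :
  usubmx ((kernel_mx k1 k2 theta a b c d e : 'M[R[i]]_(2 + 2)) *m (p : 'cV[R[i]]_(2 + 2))) =
  own_block k1 e *m usubmx (p : 'cV[R[i]]_(2 + 2))
    + mx2 (crossAB k1 k2 theta a b c d) *m dsubmx (p : 'cV[R[i]]_(2 + 2)).
Proof.
by rewrite kernel_mx_block -[in LHS](vsubmxK (p : 'cV[R[i]]_(2 + 2))) mul_block_col col_mxKu.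
Qed.

Lemma dsubmx_kernel (k1 k2 : R) (a b c d e : R[i]) :
  dsubmx ((kernel_mx k1 k2 theta a b c d e : 'M[R[i]]_(2 + 2)) *m (p : 'cV[R[i]]_(2 + 2))) =
  mx2 (crossBA k1 k2 theta a b c d) *m usubmx (p : 'cV[R[i]]_(2 + 2))
    - own_block k1 e *m dsubmx (p : 'cV[R[i]]_(2 + 2)).
Proof.
by rewrite kernel_mx_block -[in LHS](vsubmxK (p : 'cV[R[i]]_(2 + 2))) mul_block_col col_mxKd mulNmx.
Qed.

Lemma cross0 (k1 k2 : R) :
  mx2 (crossAB k1 k2 theta 0 0 0 0) = 0 /\ mx2 (crossBA k1 k2 theta 0 0 0 0) = 0.
Proof.
by split; apply/matrixP; do 2![apply: ord2P]; rewrite !mxE /=; ring.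
Qed.

Lemma own_block0 (k1 : R) : own_block k1 0 = 0.
Proof.
by apply/matrixP; do 2![apply: ord2P]; rewrite !mxE /= ?mulr0 ?oppr0.
Qed.

Let u : R[i] := cexp ('i * theta%:C).
Let ub : R[i] := u^-1.

Lemma circE t : circ t theta = t%:C * u. Proof. by []. Qed.
Lemma circNE t : circ t (- theta) = t%:C * ub.
Proof. by rewrite /circ rmorphN mulrN cexpN. Qed.

Let trig : [/\ (cos theta)%:C = (u + ub) / 2, (sin theta)%:C = (u - ub) / (2 * 'i) & u * ub = 1].
Proof. by split; rewrite ?cos_cexpE ?sin_cexpE // divff // cexp_neq0. Qed.

(** The squared distance between points of different legs splits over the complex
    numbers, which is where the two poles come from. *)
Lemma dist_factor (s t : R) :
  (s ^+ 2 - 2 * s * t * cos theta + t ^+ 2)%:C = (s%:C - circ t theta) * (s%:C - circ t (- theta)).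
Proof.
have [cE sE uu] := trig; rewrite circE circNE.
have c2 : 2 * (cos theta)%:C = u + ub by rewrite cE mulrC divfK ?two_neq0.
transitivity (s%:C ^+ 2 - s%:C * t%:C * (2 * (cos theta)%:C) + t%:C ^+ 2); first by ring.
by rewrite c2; ring: uu.
Qed.

(** The partial fractions of the kernel are hypotheses, so that the two orders of
    the legs share the assembly of the block. *)
Lemma cross_mx (k1 k2 : R) (sg a b P Q : R[i]) (K : 'M[R]_2) (nr tr r0 r1 N : R) :
  [/\ K 0 0 = 2 * k1 * (nr / (2 * pi * N)) + k2 * (nr / (pi * N ^+ 2)) * (r0 * r0),
      K 0 1 = 2 * k1 * (tr / (2 * pi * N)) + k2 * (nr / (pi * N ^+ 2)) * (r0 * r1),
      K 1 0 = - (2 * k1 * (tr / (2 * pi * N))) + k2 * (nr / (pi * N ^+ 2)) * (r0 * r1) &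
      K 1 1 = 2 * k1 * (nr / (2 * pi * N)) + k2 * (nr / (pi * N ^+ 2)) * (r1 * r1)] ->
  N != 0 ->
  [/\ nr%:C / N%:C = - ((a - b) / (2 * 'i)),
      tr%:C / N%:C = sg * ((a + b) / 2),
      nr%:C * r0%:C ^+ 2 / N%:C ^+ 2 = - ((a - b) / (2 * 'i) / 2 + (P + Q) / 2 / 2),
      nr%:C * (r0%:C * r1%:C) / N%:C ^+ 2 = - ((P - Q) / (2 * 'i) / 2) &
      nr%:C * r1%:C ^+ 2 / N%:C ^+ 2 = - ((a - b) / (2 * 'i) / 2 - (P + Q) / 2 / 2)] ->
  map_mx (real_complex R) K = mx2 (cross_block k1 k2 sg a b P Q).
Proof.
move=> [k00 k01 k10 k11] N0 [e1 e2 e3 e4 e5].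
have p0 : (pi : R) != 0 by rewrite gt_eqF ?pi_gt0.
have h1 (x : R) : (2 * k1 * (x / (2 * pi * N)))%:C = k1%:C / pic R * (x%:C / N%:C).
  have aux q : q != 0 -> 2 * k1 * (x / (2 * q * N)) = k1 * q^-1 * (x / N).
    by move=> q0; field; rewrite q0 N0.
  rewrite (aux _ p0).
  by rewrite rmorphM !fmorph_div.
have h2 (x y y' : R) : (k2 * (x / (pi * N ^+ 2)) * (y * y'))%:C =
    k2%:C / pic R * (x%:C * (y%:C * y'%:C) / N%:C ^+ 2).
  have aux q : q != 0 -> k2 * (x / (q * N ^+ 2)) * (y * y') = k2 * q^-1 * (x * (y * y') / N ^+ 2).
    by move=> q0; field; rewrite q0 N0.
  rewrite (aux _ p0).
  by rewrite rmorphM !fmorph_div rmorphXn !rmorphM.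
have D (x y : R) : (x + y)%:C = x%:C + y%:C by exact: rmorphD.
have O (x : R) : (- x)%:C = - x%:C by exact: rmorphN.
rewrite (expr2 r0%:C) in e3; rewrite (expr2 r1%:C) in e5.
apply/matrixP; do 2![apply: ord2P]; rewrite !mxE /= ?k00 ?k01 ?k10 ?k11.
- by rewrite D h1 h2 e1 e3; ring.
- by rewrite D h1 h2 e2 e4; ring.
- by rewrite D O h1 h2 e2 e4; ring.
- by rewrite D h1 h2 e1 e5; ring.
Qed.

Section CrossBlocks.
Variables s t : R.
Hypotheses (s_off : s%:C != circ t theta) (s_offN : s%:C != circ t (- theta)).
Let a : R[i] := (s%:C - circ t theta)^-1.
Let b : R[i] := (s%:C - circ t (- theta))^-1.
Let c : R[i] := circ t theta / (s%:C - circ t theta) ^+ 2.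
Let d : R[i] := circ t (- theta) / (s%:C - circ t (- theta)) ^+ 2.
Let N : R := s ^+ 2 - 2 * s * t * cos theta + t ^+ 2.

Let NE : N%:C = (s%:C - circ t theta) * (s%:C - circ t (- theta)).
Proof. exact: dist_factor. Qed.

Let N0 : N != 0.
Proof. by rewrite -(inj_eq (@complexI R)) NE mulf_neq0 // subr_eq0. Qed.

Lemma cross_kernelAB :
  map_mx (real_complex R)
    (kernelD lambda mu (vec2 t 0) (vec2 (s * cos theta) (s * sin theta))
      (vec2 (- sin theta) (cos theta)) (vec2 (- cos theta) (- sin theta))) =
  mx2 (crossAB l1 l2 theta a b c d).
Proof.
have k := @kernelDE R lambda mu lm t 0 (s * cos theta) (s * sin theta)
  (- sin theta) (cos theta) (- cos theta) (- sin theta).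
cbv zeta in k; have cs := cos2Dsin2 theta.
have nrE : - sin theta * (t - s * cos theta) + cos theta * (0 - s * sin theta) =
    - (t * sin theta) by ring.
have trE : - cos theta * (t - s * cos theta) + - sin theta * (0 - s * sin theta) =
    s - t * cos theta.
  transitivity (s * (cos theta ^+ 2 + sin theta ^+ 2) - t * cos theta); first by ring.
  by rewrite cs mulr1.
have NE' : (t - s * cos theta) ^+ 2 + (0 - s * sin theta) ^+ 2 = N.
  rewrite /N; transitivity (t ^+ 2 - 2 * s * t * cos theta +
    s ^+ 2 * (cos theta ^+ 2 + sin theta ^+ 2)); first by ring.
  by rewrite cs; ring.
rewrite nrE trE NE' sub0r in k.
apply: (cross_mx k N0).
have [cE sE uu] := trig; have ii := i2 R; have n2 := two_neq0 R; have i0 := i_neq0 R.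
rewrite NE /a /b /c /d !circE circNE !(rmorphN, rmorphB, rmorphM) /= cE sE.
move: s_off s_offN; rewrite -subr_eq0 circE => so; rewrite -subr_eq0 circNE => soN.
move: (s%:C) (t%:C) uu so soN; rewrite -/u -/ub.
move: (u) (ub) => v vb S T uu so soN.
split; field: ii uu.
all: by rewrite ?n2 ?i0 ?so ?soN.
Qed.

Lemma cross_kernelBA :
  map_mx (real_complex R)
    (kernelD lambda mu (vec2 (t * cos theta) (t * sin theta)) (vec2 s 0)
      (vec2 0 (-1)) (vec2 1 0)) =
  mx2 (crossBA l1 l2 theta a b c d).
Proof.
have k := @kernelDE R lambda mu lm (t * cos theta) (t * sin theta) s 0 0 (-1) 1 0.
cbv zeta in k; have cs := cos2Dsin2 theta.
have nrE : 0 * (t * cos theta - s) + -1 * (t * sin theta - 0) = - (t * sin theta) by ring.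
have trE : 1 * (t * cos theta - s) + 0 * (t * sin theta - 0) = t * cos theta - s by ring.
have NE' : (t * cos theta - s) ^+ 2 + (t * sin theta - 0) ^+ 2 = N.
  rewrite /N; transitivity (s ^+ 2 - 2 * s * t * cos theta +
    t ^+ 2 * (cos theta ^+ 2 + sin theta ^+ 2)); first by ring.
  by rewrite cs; ring.
rewrite nrE trE NE' subr0 in k.
apply: (cross_mx k N0).
have [cE sE uu] := trig; have ii := i2 R; have n2 := two_neq0 R; have i0 := i_neq0 R.
rewrite NE /a /b /c /d !circE circNE !(rmorphN, rmorphB, rmorphM) /= cE sE.
move: s_off s_offN; rewrite -subr_eq0 circE => so; rewrite -subr_eq0 circNE => soN.
move: (s%:C) (t%:C) uu so soN; rewrite -/u -/ub.
move: (u) (ub) => v vb S T uu so soN.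
split; field: ii uu.
all: by rewrite ?n2 ?i0 ?so ?soN.
Qed.

End CrossBlocks.

Lemma own_block_kernel (K : 'M[R]_2) (x r0 r1 : R) :
  [/\ K 0 0 = 2 * l1 * (0 / (2 * pi * x ^+ 2)) + l2 * (0 / (pi * (x ^+ 2) ^+ 2)) * (r0 * r0),
      K 0 1 = 2 * l1 * (- x / (2 * pi * x ^+ 2)) + l2 * (0 / (pi * (x ^+ 2) ^+ 2)) * (r0 * r1),
      K 1 0 = - (2 * l1 * (- x / (2 * pi * x ^+ 2))) + l2 * (0 / (pi * (x ^+ 2) ^+ 2)) * (r0 * r1) &
      K 1 1 = 2 * l1 * (0 / (2 * pi * x ^+ 2)) + l2 * (0 / (pi * (x ^+ 2) ^+ 2)) * (r1 * r1)] ->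
  map_mx (real_complex R) K = own_block l1 (x^-1)%:C.
Proof.
move=> [k00 k01 k10 k11].
have p0 : (pi : R) != 0 by rewrite gt_eqF ?pi_gt0.
have h : 2 * l1 * (- x / (2 * pi * x ^+ 2)) = - (l1 / pi * x^-1).
  have [->|x0] := eqVneq x 0; first by rewrite oppr0 mul0r mulr0 invr0 mulr0 oppr0.
  move: (pi : R) p0 => q q0; field; by rewrite q0 x0.
have hC : (l1 / pi * x^-1)%:C = l1%:C / pic R * (x^-1)%:C by rewrite rmorphM fmorph_div.
rewrite h !mul0r !(mulr0, mul0r) ?(addr0, opprK) in k00 k01 k10 k11.
apply/matrixP; do 2![apply: ord2P]; rewrite !mxE /= ?k00 ?k01 ?k10 ?k11 -?hC //.
by rewrite -[RHS](rmorphN (real_complex R)).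
Qed.

Let pos_pt (s : R) : 0 < s -> [/\ wedge_pt theta s = vec2 s 0,
  wedge_tangent theta s = vec2 1 0 & wedge_normal theta s = vec2 0 (-1)].
Proof. by move=> s0; rewrite /wedge_pt /wedge_tangent /wedge_normal ltW. Qed.

Let neg_pt (s : R) : 0 < s -> [/\ wedge_pt theta (- s) = vec2 (s * cos theta) (s * sin theta),
  wedge_tangent theta (- s) = vec2 (- cos theta) (- sin theta)
  & wedge_normal theta (- s) = vec2 (- sin theta) (cos theta)].
Proof.
by move=> s0; rewrite /wedge_pt /wedge_tangent /wedge_normal oppr_ge0 leNgt s0 /= opprK.
Qed.

Let pos_density (s : R) : 0 < s ->
  wedge_density z p s = cpow s z *: usubmx (p : 'cV[R[i]]_(2 + 2)).
Proof. by move=> s0; rewrite /wedge_density ltW. Qed.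

Let neg_density (s : R) : 0 < s ->
  wedge_density z p (- s) = cpow s z *: dsubmx (p : 'cV[R[i]]_(2 + 2)).
Proof. by move=> s0; rewrite /wedge_density oppr_ge0 leNgt s0 /= opprK. Qed.

Local Notation phi := (wedge_density z p).

Definition far_kernel (s t : R) : 'M[R[i]]_(2 + 2) :=
  kernel_mx l1 l2 theta (s%:C - circ t theta)^-1 (s%:C - circ t (- theta))^-1
    (circ t theta / (s%:C - circ t theta) ^+ 2)
    (circ t (- theta) / (s%:C - circ t (- theta)) ^+ 2) 0.

Definition near_kernel (s t : R) : 'M[R[i]]_(2 + 2) :=
  kernel_mx l1 l2 theta 0 0 0 0 (s%:C - t%:C)^-1.

Section Points.
Variables (s t : R).
Hypotheses (s0 : 0 < s) (t0 : 0 < t).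

Lemma integrand_near_pos : layer_integrand lambda mu theta phi t s =
  cpow s z *: usubmx (near_kernel s t *m (p : 'cV[R[i]]_(2 + 2))).
Proof.
have [a1 a2 a3] := pos_pt s0; have [b1 _ _] := pos_pt t0.
rewrite /layer_integrand a1 a2 a3 b1 pos_density //.
rewrite /near_kernel usubmx_kernel (cross0 l1 l2).1 mul0mx addr0 -scalemxAr.
congr (_ *: (_ *m _)).
rewrite -rmorphB -fmorphV.
have k := @kernelDE R lambda mu lm t 0 s 0 0 (-1) 1 0; cbv zeta in k.
have nrE : 0 * (t - s) + -1 * (0 - 0) = 0 :> R by ring.
have trE : 1 * (t - s) + 0 * (0 - 0) = - (s - t) :> R by ring.
have NE : (t - s) ^+ 2 + (0 - 0) ^+ 2 = (s - t) ^+ 2 :> R by ring.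
by rewrite nrE trE NE in k; exact: own_block_kernel k.
Qed.

Lemma integrand_near_neg : layer_integrand lambda mu theta phi (- t) (- s) =
  cpow s z *: dsubmx (near_kernel s t *m (p : 'cV[R[i]]_(2 + 2))).
Proof.
have [a1 a2 a3] := neg_pt s0; have [b1 _ _] := neg_pt t0.
rewrite /layer_integrand a1 a2 a3 b1 neg_density //.
rewrite /near_kernel dsubmx_kernel (cross0 l1 l2).2 mul0mx add0r -scalemxAr -mulNmx.
congr (_ *: (_ *m _)).
have k := @kernelDE R lambda mu lm (t * cos theta) (t * sin theta) (s * cos theta)
  (s * sin theta) (- sin theta) (cos theta) (- cos theta) (- sin theta); cbv zeta in k.
have cs := cos2Dsin2 theta.
have nrE : - sin theta * (t * cos theta - s * cos theta) +
    cos theta * (t * sin theta - s * sin theta) = 0 by ring.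
have trE : - cos theta * (t * cos theta - s * cos theta) +
    - sin theta * (t * sin theta - s * sin theta) = - (t - s).
  transitivity (- (t - s) * (cos theta ^+ 2 + sin theta ^+ 2)); first by ring.
  by rewrite cs mulr1.
have NE : (t * cos theta - s * cos theta) ^+ 2 + (t * sin theta - s * sin theta) ^+ 2 =
    (t - s) ^+ 2.
  transitivity ((t - s) ^+ 2 * (cos theta ^+ 2 + sin theta ^+ 2)); first by ring.
  by rewrite cs mulr1.
rewrite nrE trE NE in k; rewrite (own_block_kernel k) fmorphV rmorphB -opprB invrN.
by apply/matrixP; do 2![apply: ord2P]; rewrite !mxE /=; ring.
Qed.

Hypothesis th : 0 < theta < 2 * pi.

Let off : s%:C != circ t theta. Proof. by apply: circ_off => //; exact: ltW. Qed.

Let offN : s%:C != circ t (- theta).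
Proof.
by rewrite -circ_2piB; apply: circ_off => //; [exact: ltW|case/andP: th => *; apply/andP; split; lra].
Qed.

Lemma integrand_far_pos : layer_integrand lambda mu theta phi t (- s) =
  cpow s z *: usubmx (far_kernel s t *m (p : 'cV[R[i]]_(2 + 2))).
Proof.
have [a1 a2 a3] := neg_pt s0; have [b1 _ _] := pos_pt t0.
rewrite /layer_integrand a1 a2 a3 b1 neg_density //.
rewrite /far_kernel usubmx_kernel own_block0 mul0mx add0r -scalemxAr.
by rewrite cross_kernelAB.
Qed.

Lemma integrand_far_neg : layer_integrand lambda mu theta phi (- t) s =
  cpow s z *: dsubmx (far_kernel s t *m (p : 'cV[R[i]]_(2 + 2))).
Proof.
have [a1 a2 a3] := pos_pt s0; have [b1 _ _] := neg_pt t0.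
rewrite /layer_integrand a1 a2 a3 b1 pos_density //.
rewrite /far_kernel dsubmx_kernel own_block0 mul0mx subr0 -scalemxAr.
by rewrite cross_kernelBA.
Qed.

End Points.

End Integrand.

(** * Existence and value of the layer potential *)

Lemma ccvg_near (R : realType) (T : Type) (F : set_system T) (FF : Filter F)
    (f g : T -> R[i]) (l : R[i]) :
  (\forall x \near F, f x = g x) -> ccvg F f l -> ccvg F g l.
Proof.
move=> fg [f1 f2]; split; [apply: cvg_trans f1|apply: cvg_trans f2];
  by apply: near_eq_cvg; apply: filterS fg => x ->.
Qed.

Section Legs.
Variable R : realType.
Notation mu := (@lebesgue_measure R).
Implicit Types (D : set R) (f : R -> R[i]) (s t e : R).

Lemma cintegral_set1 (a : R) f : cintegrable [set a] f /\ cintegral [set a] f = 0.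
Proof.
have h (g : R -> R) : mu.-integrable [set a] (EFin \o g).
  apply/integrableP; split; first exact: measurable_fun_set1.
  by rewrite integral_set1 ltry.
by split; [split; exact: h|rewrite /cintegral !Rintegral_set1].
Qed.

Lemma cintegral_set0 f : cintegrable set0 f /\ cintegral set0 f = 0.
Proof.
split; first by split; exact: integrable_set0.
by rewrite /cintegral !Rintegral_set0.
Qed.

Definition pos_leg D : set R := [set s | 0 < s /\ D s].
Definition neg_leg D : set R := [set s | 0 < s /\ D (- s)].

(** The corner is a null set, so both legs can be parameterized by s > 0. *)
Lemma two_legs D f : measurable (pos_leg D) -> measurable (neg_leg D) ->
  cintegrable (pos_leg D) f -> cintegrable (neg_leg D) (fun s => f (- s)) ->
  cintegrable D f /\
  cintegral D f = cintegral (pos_leg D) f + cintegral (neg_leg D) (fun s => f (- s)).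
Proof.
move=> mP mN iP iN.
pose E : set R := [set s | s < 0 /\ D s]; pose Z : set R := D `&` [set 0].
have preE : -%R @^-1` E = neg_leg D.
  by apply/seteqP; split => s; rewrite /E /neg_leg /= oppr_lt0.
have mE : measurable E.
  have -> : E = -%R @^-1` neg_leg D.
    by apply/seteqP; split => s; rewrite /E /neg_leg /= oppr_gt0 opprK.
  by rewrite -[X in measurable X]setTI; apply: (@oppr_measurable R).
have [iE vE] : cintegrable E f /\ cintegral E f = cintegral (neg_leg D) (fun s => f (- s)).
  by rewrite -preE; apply: cintegral_reflect => //; rewrite preE.
have [mZ iZ vZ] : [/\ measurable Z, cintegrable Z f & cintegral Z f = 0].
  have [D0|D0] := pselect (D 0).
    have -> : Z = [set 0] by apply/seteqP; split => s /=; [by case|by move=> ->; split].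
    by have [? ?] := cintegral_set1 0 f; split.
  have -> : Z = set0 by apply/seteqP; split => s //= [+ s0]; rewrite s0.
  by have [? ?] := cintegral_set0 f; split.
have DE : D = (pos_leg D `|` E) `|` Z.
  apply/seteqP; split => s; rewrite /pos_leg /E /Z /=.
    move=> Ds; have [s0|s0|s0] := ltgtP s 0; first by left; right.
      by left; left.
    by right; split.
  by move=> [[[]|[]]|[]].
have mPE : measurable (pos_leg D `|` E) by exact: measurableU.
have iPE := cintegrable_setU mP mE iP iE.
have dPE : [disjoint pos_leg D & E].
  by apply/disj_setPS => s [[s0 _] [s1 _]]; move: (lt_trans s0 s1); rewrite ltxx.
have dZ : [disjoint pos_leg D `|` E & Z].
  by apply/disj_setPS => s [[[s0 _]|[s0 _]] [_ /= e0]]; move: s0; rewrite e0 ltxx.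
split; first by rewrite DE; exact: cintegrable_setU.
by rewrite [in LHS]DE cintegral_setU // cintegral_setU // vE vZ addr0.
Qed.

Definition near_leg t e : set R := [set s | 0 < s <= 1 /\ e <= `|t - s|].
Definition far_leg theta t e : set R :=
  [set s | 0 < s <= 1 /\ e <= cabs (s%:C - circ t theta)].

Lemma pos_own_leg t e : pos_leg (own_leg t e) = near_leg t e.
Proof.
apply/seteqP; split => s; rewrite /pos_leg /own_leg /near_leg /=.
  by move=> [s0 [/andP[_ s1] h]]; rewrite s0 s1.
by move=> [/andP[s0 s1] h]; rewrite s0 (ltW s0) s1.
Qed.

Lemma measurable_near_leg t e : measurable (near_leg t e).
Proof.
rewrite (_ : near_leg t e = own_leg t e `&` `]0, 1]).
  by apply: measurableI => //; exact: measurable_own_leg.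
apply/seteqP; split => s; rewrite /near_leg /own_leg /= in_itv /=.
  by move=> [/andP[s0 s1] h]; rewrite s0 (ltW s0) s1.
by move=> [[_ h] ->].
Qed.

Lemma near_leg_integral t e f : cintegrable (own_leg t e) f ->
  cintegrable (near_leg t e) f /\ cintegral (own_leg t e) f = cintegral (near_leg t e) f.
Proof.
move=> fi; have inear : cintegrable (near_leg t e) f.
  apply: cintegrableS fi; [exact: measurable_near_leg|exact: measurable_own_leg|].
  by move=> s [/andP[s0 s1] h]; rewrite /own_leg /= (ltW s0) s1.
split=> //.
have n0 : neg_leg (own_leg t e) = set0.
  apply/seteqP; split => s //; rewrite /neg_leg /own_leg /= => -[s0 [/andP[h _] _]].
  by move: h; rewrite oppr_ge0 leNgt s0.
have [] := @two_legs (own_leg t e) f _ _ _ _.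
- by rewrite pos_own_leg; exact: measurable_near_leg.
- by rewrite n0.
- by rewrite pos_own_leg.
- by rewrite n0; case: (cintegral_set0 (fun s => f (- s))).
- by move=> _ ->; rewrite pos_own_leg n0 (cintegral_set0 _).2 addr0.
Qed.

Lemma full_leg_integral f : cintegrable `[0, 1] f ->
  cintegrable `]0, 1] f /\ cintegral `]0, 1] f = cintegral `[0, 1] f.
Proof.
move=> [i1 i2]; have sub : `]0, 1]%classic `<=` (`[0, 1]%classic : set R).
  by apply: subset_itv; rewrite bnd_simp.
have i' : cintegrable `]0, 1] f.
  by apply: (cintegrableS _ _ sub (conj i1 i2)).
split=> //; case: i' => [j1 j2].
by rewrite /cintegral !Rintegral_itv_obnd_cbnd.
Qed.

Lemma measurable_far_leg theta t e : measurable (far_leg theta t e).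
Proof.
pose g s : R := cabs (s%:C - circ t theta).
have mg : measurable_fun [set: R] g.
  rewrite (_ : g = fun s => Num.sqrt ((s - t * cos theta) ^+ 2 + (t * sin theta) ^+ 2)).
    apply: (measurableT_comp (continuous_measurable_fun (@sqrt_continuous R))).
    apply: measurable_funD => //; apply: measurable_funX; exact: measurable_funB.
  by apply/funext => s; rewrite /g cabsE ReB ImB Re_circ Im_circ /= sub0r sqrrN.
rewrite (_ : far_leg theta t e = `]0, 1] `&` ([set: R] `&` g @^-1` `[e, +oo[)).
  by apply: measurableI => //; apply: mg.
apply/seteqP; split => s; rewrite /far_leg /= !in_itv /= andbT.
  by move=> [-> ->].
by move=> [-> [_ ->]].
Qed.

End Legs.

Section LayerValue.
Variable R : realType.
Variables (lambda mu theta : R) (z : R[i]) (p : 'cV[R[i]]_4).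
Hypothesis lm : lambda + 2 * mu != 0.
Hypothesis th : 0 < theta < 2 * pi.
Hypothesis z1 : -1 < Re z.
Let l1 := lame_c1 lambda mu.
Let l2 := lame_c2 lambda mu.
Local Notation phi := (wedge_density z p).
Variable t : R.
Hypotheses (t0 : 0 < t) (t1 : t < 1).
Implicit Types (s e : R).

Let thN : 0 < 2 * pi - theta < 2 * pi.
Proof. by case/andP: th => *; apply/andP; split; lra. Qed.

Let off s : 0 <= s -> s%:C != circ t theta.
Proof. by move=> s0; exact: circ_off. Qed.

Let offN s : 0 <= s -> s%:C != circ t (- theta).
Proof. by move=> s0; rewrite -circ_2piB; exact: circ_off. Qed.

(** The value found in [cauchyJ_double_pole]. *)
Definition double_pole (w : R[i]) : R[i] := z * cauchyJ z w - (1 - w)^-1.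

Definition layer_mx : 'M[R[i]]_4 :=
  kernel_mx l1 l2 theta (cauchyJ z (circ t theta)) (cauchyJ z (circ t (- theta)))
    (double_pole (circ t theta)) (double_pole (circ t (- theta))) (pv_value z t).

Let near_int (i : 'I_(2 + 2)) s : R[i] :=
  cpow s z * (near_kernel lambda mu theta s t *m (p : 'cV[R[i]]_(2 + 2))) i 0.

Let far_int (i : 'I_(2 + 2)) s : R[i] :=
  cpow s z * (far_kernel lambda mu theta s t *m (p : 'cV[R[i]]_(2 + 2))) i 0.

Let K (a b c d e : R[i]) (i : 'I_(2 + 2)) : R[i] :=
  ((kernel_mx l1 l2 theta a b c d e : 'M[R[i]]_(2 + 2)) *m (p : 'cV[R[i]]_(2 + 2))) i 0.

Let KE (a b c d e : R[i]) (i : 'I_(2 + 2)) : K a b c d e i =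
  a * K 1 0 0 0 0 i + b * K 0 1 0 0 0 i + c * K 0 0 1 0 0 i + d * K 0 0 0 1 0 i
  + e * K 0 0 0 0 1 i.
Proof.
have Z x y : x * ((y : 'M[R[i]]_4) *m (p : 'cV[R[i]]_4)) i 0 = ((x *: y) *m p) i 0.
  by rewrite -scalemxAl [in RHS]mxE.
have D (x y : 'M[R[i]]_4) : (x *m p) i 0 + (y *m p) i 0 = ((x + y) *m p) i 0.
  by rewrite mulmxDl [in RHS]mxE.
rewrite /K !Z !kernel_mxZ !D !kernel_mxD.
by rewrite !mulr0 !mulr1 !addr0 !add0r.
Qed.

Let KD (a b c d e : R[i]) i : K a b c d e i = K 0 0 0 0 e i + K a b c d 0 i.
Proof. by rewrite (KE a b c d e) (KE 0 0 0 0 e) (KE a b c d 0); ring. Qed.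

Lemma near_int_integrable i e : 0 < e -> cintegrable (near_leg t e) (near_int i).
Proof.
move=> e0; have h := @cintegrable_own_leg R z t z1 e e0.
have [h2 _] := near_leg_integral h.
apply: (@eq_cintegrable _ _ (fun s => K 0 0 0 0 1 i * (cpow s z * (s%:C - t%:C)^-1))).
- exact: measurable_near_leg.
- move=> s _; rewrite /near_int -/(K 0 0 0 0 (s%:C - t%:C)^-1 i) [in RHS]KE; ring.
- by apply: cintegrableZ => //; exact: measurable_near_leg.
Qed.

Lemma near_int_cvg i :
  ccvg 0^'+ (fun e => cintegral (near_leg t e) (near_int i)) (K 0 0 0 0 (pv_value z t) i).
Proof.
have [c1 c2] := ccvgMl (K 0 0 0 0 1 i) (pv_cvg z1 t0 t1).
have -> : K 0 0 0 0 (pv_value z t) i = K 0 0 0 0 1 i * pv_value z t.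
  by rewrite KE; ring.
have nE : \forall e \near (0 : R)^'+, K 0 0 0 0 1 i *
    cintegral (own_leg t e) (fun s => cpow s z * (s%:C - t%:C)^-1) =
    cintegral (near_leg t e) (near_int i).
  apply: filterS (nbhs_right_gt (0 : R)) => e e0.
  have h := @cintegrable_own_leg R z t z1 e e0.
  have [h2 ->] := near_leg_integral h.
  rewrite -cintegralZ //; last exact: measurable_near_leg.
  by apply: eq_cintegral => s _; rewrite /near_int -/(K 0 0 0 0 (s%:C - t%:C)^-1 i) [in RHS]KE; ring.
by refine (ccvg_near _ nE _); split.
Qed.

Lemma far_int_full i : cintegrable `[0, 1] (far_int i) /\
  cintegral `[0, 1] (far_int i) =
    K (cauchyJ z (circ t theta)) (cauchyJ z (circ t (- theta)))
      (double_pole (circ t theta)) (double_pole (circ t (- theta))) 0 i.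
Proof.
have m01 : measurable (`[0, 1]%classic : set R) by exact: measurable_itv.
have o1 s : 0 <= s <= 1 -> s%:C != circ t theta by move=> /andP[s0 _]; exact: off.
have o2 s : 0 <= s <= 1 -> s%:C != circ t (- theta) by move=> /andP[s0 _]; exact: offN.
have ia := cintegrable_resolvent z1 o1; have ib := cintegrable_resolvent z1 o2.
have ic := cintegrable_resolvent2 z1 o1; have id := cintegrable_resolvent2 z1 o2.
have ia' := cintegrableZ (K 1 0 0 0 0 i) m01 ia.
have ib' := cintegrableZ (K 0 1 0 0 0 i) m01 ib.
have ic' := cintegrableZ (K 0 0 1 0 0 i) m01 ic.
have id' := cintegrableZ (K 0 0 0 1 0 i) m01 id.
have iab := cintegrableD m01 ia' ib'; have icd := cintegrableD m01 ic' id'.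
have iall := cintegrableD m01 iab icd.
have eF : {in `[0, 1]%classic, (fun s =>
     K 1 0 0 0 0 i * (cpow s z * (s%:C - circ t theta)^-1) +
     K 0 1 0 0 0 i * (cpow s z * (s%:C - circ t (- theta))^-1) +
     (K 0 0 1 0 0 i * (cpow s z * (circ t theta / (s%:C - circ t theta) ^+ 2)) +
     K 0 0 0 1 0 i * (cpow s z * (circ t (- theta) / (s%:C - circ t (- theta)) ^+ 2)))) =1
   far_int i}.
  move=> s _; rewrite /far_int -/(K (s%:C - circ t theta)^-1 (s%:C - circ t (- theta))^-1
    (circ t theta / (s%:C - circ t theta) ^+ 2)
    (circ t (- theta) / (s%:C - circ t (- theta)) ^+ 2) 0 i) [in RHS]KE.
  ring.
split; first exact: (eq_cintegrable m01 eF).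
rewrite -(eq_cintegral eF) cintegralD // cintegralD // cintegralD // !cintegralZ //.
rewrite !cauchyJ_double_pole // [in RHS]KE /double_pole /cauchyJ.
ring.
Qed.

Lemma far_int_integrable i e : cintegrable (far_leg theta t e) (far_int i).
Proof.
apply: (cintegrableS _ _ _ (far_int_full i).1).
- exact: measurable_far_leg.
- exact: measurable_itv.
- by move=> s [/andP[s0 s1] _]; rewrite /= in_itv /= ltW.
Qed.

(** The other leg stays at a positive distance from the target, so that small
    truncations do not reach it. *)
Lemma far_int_cvg i : ccvg 0^'+ (fun e => cintegral (far_leg theta t e) (far_int i))
  (K (cauchyJ z (circ t theta)) (cauchyJ z (circ t (- theta)))
      (double_pole (circ t theta)) (double_pole (circ t (- theta))) 0 i).
Proof.
have [fi fv] := far_int_full i; have [gi gv] := full_leg_integral fi.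
pose m := t * Num.sqrt ((1 - cos theta) / 2).
have c1 := cos_lt1_circ th.
have m0 : 0 < m by rewrite mulr_gt0 // sqrtr_gt0 divr_gt0 // subr_gt0.
have nE : \forall e \near (0 : R)^'+, K (cauchyJ z (circ t theta)) (cauchyJ z (circ t (- theta)))
      (double_pole (circ t theta)) (double_pole (circ t (- theta))) 0 i =
    cintegral (far_leg theta t e) (far_int i).
  apply: filterS2 (nbhs_right_gt (0 : R)) (nbhs_right_lt m0) => e e0 em.
  rewrite -fv -gv; congr (cintegral _ _).
  apply/seteqP; split => s; rewrite /far_leg /= in_itv /=; last by case.
  move=> ss; split=> //; apply: (le_trans (ltW em)).
  rewrite -(@ler_pXn2r _ 2) ?nnegrE ?cabs_ge0 ?(ltW m0) // /m exprMn sqr_sqrtr.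
    by apply: dist_circ_ge_cos; [case/andP: ss => /ltW|exact: ltW].
  by rewrite divr_ge0 // subr_ge0 ltW.
by refine (ccvg_near _ nE _); exact: ccvg_cst.
Qed.

Let enormE (a b : R) : enorm (vec2 a b) = Num.sqrt (a ^+ 2 + b ^+ 2).
Proof. by rewrite /enorm dotE -!expr2. Qed.

Let enorm_near_pos s : 0 < s -> enorm (wedge_pt theta t - wedge_pt theta s) = `|t - s|.
Proof.
move=> s0; rewrite /wedge_pt !ltW // vec2B enormE subrr expr0n addr0.
by rewrite sqrtr_sqr.
Qed.

Let enorm_far_pos s : 0 < s ->
  enorm (wedge_pt theta t - wedge_pt theta (- s)) = cabs (s%:C - circ t theta).
Proof.
move=> s0; rewrite /wedge_pt ltW // oppr_ge0 leNgt s0 /= opprK vec2B enormE.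
rewrite -[RHS]ger0_norm ?cabs_ge0 // -sqrtr_sqr sqr_dist_circ; congr Num.sqrt.
have cs := cos2Dsin2 theta.
transitivity (t ^+ 2 - 2 * s * t * cos theta + s ^+ 2 * (cos theta ^+ 2 + sin theta ^+ 2)).
  by ring.
by rewrite cs; ring.
Qed.

Let enorm_near_neg s : 0 < s -> enorm (wedge_pt theta (- t) - wedge_pt theta (- s)) = `|t - s|.
Proof.
move=> s0; rewrite /wedge_pt !oppr_ge0 !leNgt s0 t0 /= !opprK vec2B enormE.
have cs := cos2Dsin2 theta.
rewrite (_ : _ + _ = (t - s) ^+ 2) ?sqrtr_sqr //.
transitivity ((t - s) ^+ 2 * (cos theta ^+ 2 + sin theta ^+ 2)); first by ring.
by rewrite cs mulr1.
Qed.

Let enorm_far_neg s : 0 < s ->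
  enorm (wedge_pt theta (- t) - wedge_pt theta s) = cabs (s%:C - circ t theta).
Proof.
move=> s0; rewrite /wedge_pt (ltW s0) oppr_ge0 leNgt t0 /= opprK vec2B enormE.
rewrite -[RHS]ger0_norm ?cabs_ge0 // -sqrtr_sqr sqr_dist_circ; congr Num.sqrt.
have cs := cos2Dsin2 theta.
transitivity (s ^+ 2 - 2 * s * t * cos theta + t ^+ 2 * (cos theta ^+ 2 + sin theta ^+ 2)).
  by ring.
by rewrite cs; ring.
Qed.

Let pos_leg_pos e : pos_leg (punctured_wedge theta t e) = near_leg t e.
Proof.
apply/seteqP; split => s; rewrite /pos_leg /near_leg /punctured_wedge /=.
  by move=> [s0 [/andP[_ s1]]]; rewrite enorm_near_pos // s0 s1.
by move=> [/andP[s0 s1] h]; rewrite enorm_near_pos // s0 s1 (le_trans _ (ltW s0)) ?lerN10.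
Qed.

Let neg_leg_pos e : neg_leg (punctured_wedge theta t e) = far_leg theta t e.
Proof.
apply/seteqP; split => s; rewrite /neg_leg /far_leg /punctured_wedge /=.
  by move=> [s0 [/andP[s1 _]]]; rewrite lerN2 in s1; rewrite enorm_far_pos // s0 s1.
move=> [/andP[s0 s1] h]; rewrite enorm_far_pos // s0 lerN2 s1.
by rewrite (le_trans _ ler01) // oppr_le0 ltW.
Qed.

Let pos_leg_neg e : pos_leg (punctured_wedge theta (- t) e) = far_leg theta t e.
Proof.
apply/seteqP; split => s; rewrite /pos_leg /far_leg /punctured_wedge /=.
  by move=> [s0 [/andP[_ s1]]]; rewrite enorm_far_neg // s0 s1.
by move=> [/andP[s0 s1] h]; rewrite enorm_far_neg // s0 s1 (le_trans _ (ltW s0)) ?lerN10.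
Qed.

Let neg_leg_neg e : neg_leg (punctured_wedge theta (- t) e) = near_leg t e.
Proof.
apply/seteqP; split => s; rewrite /neg_leg /near_leg /punctured_wedge /=.
  by move=> [s0 [/andP[s1 _]]]; rewrite lerN2 in s1; rewrite enorm_near_neg // s0 s1.
move=> [/andP[s0 s1] h]; rewrite enorm_near_neg // s0 lerN2 s1.
by rewrite (le_trans _ ler01) // oppr_le0 ltW.
Qed.

(** The own leg and the other leg exchange their roles with the position of the
    target, hence the sets B1 and B2. *)
Lemma layer_of_legs (x : R) (B1 B2 : R -> set R) (f1 f2 : 'I_2 -> R -> R[i]) (L1 L2 : 'I_2 -> R[i]) :
  (forall e, pos_leg (punctured_wedge theta x e) = B1 e) ->
  (forall e, neg_leg (punctured_wedge theta x e) = B2 e) ->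
  (forall e, measurable (B1 e)) -> (forall e, measurable (B2 e)) ->
  (forall e i, 0 < e -> cintegrable (B1 e) (f1 i)) ->
  (forall e i, 0 < e -> cintegrable (B2 e) (f2 i)) ->
  (forall s i, 0 < s -> layer_integrand lambda mu theta phi x s i 0 = f1 i s) ->
  (forall s i, 0 < s -> layer_integrand lambda mu theta phi x (- s) i 0 = f2 i s) ->
  (forall i, ccvg 0^'+ (fun e => cintegral (B1 e) (f1 i)) (L1 i)) ->
  (forall i, ccvg 0^'+ (fun e => cintegral (B2 e) (f2 i)) (L2 i)) ->
  layer_exists lambda mu theta phi x /\
  layer lambda mu theta phi x = \col_i (L1 i + L2 i).
Proof.
move=> hB1 hB2 mB1 mB2 i1 i2 e1 e2 c1 c2.
pose g i s := layer_integrand lambda mu theta phi x s i 0.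
have pos1 e s : s \in B1 e -> 0 < s by rewrite -hB1 inE => -[].
have pos2 e s : s \in B2 e -> 0 < s by rewrite -hB2 inE => -[].
have main e i : 0 < e -> cintegrable (punctured_wedge theta x e) (g i) /\
    cintegral (punctured_wedge theta x e) (g i) =
    cintegral (B1 e) (f1 i) + cintegral (B2 e) (f2 i).
  move=> e0.
  have E1 : {in B1 e, f1 i =1 g i} by move=> s /pos1 s0; rewrite /g e1.
  have E2 : {in B2 e, f2 i =1 (fun s => g i (- s))} by move=> s /pos2 s0; rewrite /g e2.
  rewrite (eq_cintegral E1) (eq_cintegral E2).
  have h := @two_legs R (punctured_wedge theta x e) (g i); rewrite hB1 hB2 in h; apply: h => //.
    exact: eq_cintegrable (mB1 e) E1 (i1 e i e0).
  exact: eq_cintegrable (mB2 e) E2 (i2 e i e0).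
have cv (i : 'I_2) (j : 'I_1) : ccvg 0^'+ (fun e => layer_trunc lambda mu theta phi x e i j)
    ((\col_i (L1 i + L2 i)) i j).
  have [d1 d2] := ccvgD (c1 i) (c2 i).
  have nE : \forall e \near (0 : R)^'+, cintegral (B1 e) (f1 i) + cintegral (B2 e) (f2 i) =
      layer_trunc lambda mu theta phi x e i j.
    by apply: filterS (nbhs_right_gt (0 : R)) => e e0; rewrite mxE (main e i e0).2.
  by rewrite mxE; refine (ccvg_near _ nE _); split.
pose proof (cvg_mx_lim _ cv) as [cc ll].
by split=> //; split=> // e i e0; exact: (main e i e0).1.
Qed.

Let K_layer (i : 'I_(2 + 2)) : (layer_mx *m p) i 0 =
  K 0 0 0 0 (pv_value z t) i + K (cauchyJ z (circ t theta)) (cauchyJ z (circ t (- theta)))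
      (double_pole (circ t theta)) (double_pole (circ t (- theta))) 0 i.
Proof.
exact: KD.
Qed.

Lemma layer_pos : layer_exists lambda mu theta phi t /\
  layer lambda mu theta phi t = usubmx ((layer_mx : 'M[R[i]]_(2 + 2)) *m (p : 'cV[R[i]]_(2 + 2))).
Proof.
have [] := @layer_of_legs t (near_leg t) (far_leg theta t)
  (fun i => near_int (lshift 2 i)) (fun i => far_int (lshift 2 i)) _ _
  pos_leg_pos neg_leg_pos _ _ _ _ _ _ (fun i => near_int_cvg (lshift 2 i))
  (fun i => far_int_cvg (lshift 2 i)).
- by move=> e; exact: measurable_near_leg.
- by move=> e; exact: measurable_far_leg.
- by move=> e i e0; exact: near_int_integrable.
- by move=> e i e0; exact: far_int_integrable.
- by move=> s i s0; rewrite integrand_near_pos // 2!mxE.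
- by move=> s i s0; rewrite integrand_far_pos // 2!mxE.
move=> h v; split=> //; rewrite v; apply/matrixP => i j.
by rewrite mxE [RHS]mxE ord1 K_layer.
Qed.

Lemma layer_neg : layer_exists lambda mu theta phi (- t) /\
  layer lambda mu theta phi (- t) = dsubmx ((layer_mx : 'M[R[i]]_(2 + 2)) *m (p : 'cV[R[i]]_(2 + 2))).
Proof.
have [] := @layer_of_legs (- t) (far_leg theta t) (near_leg t)
  (fun i => far_int (rshift 2 i)) (fun i => near_int (rshift 2 i)) _ _
  pos_leg_neg neg_leg_neg _ _ _ _ _ _ (fun i => far_int_cvg (rshift 2 i))
  (fun i => near_int_cvg (rshift 2 i)).
- by move=> e; exact: measurable_far_leg.
- by move=> e; exact: measurable_near_leg.
- by move=> e i e0; exact: far_int_integrable.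
- by move=> e i e0; exact: near_int_integrable.
- by move=> s i s0; rewrite integrand_far_neg // 2!mxE.
- by move=> s i s0; rewrite integrand_near_neg // 2!mxE.
move=> h v; split=> //; rewrite v; apply/matrixP => i j.
by rewrite mxE [RHS]mxE ord1 K_layer addrC.
Qed.

End LayerValue.

(** * The expansion on the wedge *)

Section Expansion.
Variable R : realType.

Lemma ccvg_geometric (w : R[i]) : cabs w < 1 ->
  ccvg \oo (fun N => \sum_(k < N) w ^+ k) (1 - w)^-1.
Proof.
move=> w1; have w0 : 1 - w != 0.
  rewrite subr_eq0; apply/eqP => e; move: w1; rewrite -e cabs1 ltxx //.
have wN : ccvg \oo (fun N => w ^+ N) 0.
  apply: (@ccvg_squeeze _ _ _ _ _ (fun N => cabs w ^+ N)).
    by apply: nearW => N; rewrite subr0 cabsX.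
  by apply: cvg_expr; rewrite ger0_norm ?cabs_ge0.
pose proof (ccvgMl (1 - w)^-1 (ccvgB (ccvg_cst (1 : R[i])) wN)) as h.
rewrite subr0 mulr1 in h.
have E : (fun N => (1 - w)^-1 * (1 - w ^+ N)) = (fun N => \sum_(k < N) w ^+ k).
  apply/funext => N; apply: (mulfI w0); rewrite mulrA divff // mul1r.
  by rewrite -[X in X - _](expr1n _ N) subrXX; congr (_ * _); apply: eq_bigr => k _;
    rewrite expr1n mul1r.
by rewrite E in h.
Qed.

Variables (lambda mu theta : R) (z : R[i]) (p : 'cV[R[i]]_4).
Hypothesis lm : lambda + 2 * mu != 0.
Hypothesis th : 0 < theta < 2 * pi.
Hypothesis z1 : -1 < Re z.
Hypothesis zint : forall m : int, z <> m%:~R.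
Let l1 := lame_c1 lambda mu.
Let l2 := lame_c2 lambda mu.
Local Notation phi := (wedge_density z p).
Variable t : R.
Hypotheses (t0 : 0 < t) (t1 : t < 1).
Local Notation K := (kernel_mx l1 l2 theta).

Let wa := circ t theta.
Let wb := circ t (- theta).
Let geo (w : R[i]) N : R[i] := \sum_(k < N) w ^+ k.
Let ms (w : R[i]) N : R[i] := mellin_sum z w N.

(** Because of k w^k / (k - z) = w^k + z w^k / (k - z), the double-pole
    arguments sum to a geometric series plus z times the simple-pole sum, just as
    the double-pole integral is - 1 / (1 - w) plus z times the Cauchy transform. *)
Lemma wedge_series_kernel N :
  series (fun k => t%:C ^+ k *: wedgeF lambda mu k z theta) N =
  - K (ms wa N) (ms wb N) (geo wa N + z * ms wa N) (geo wb N + z * ms wb N) (ms t%:C N).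
Proof.
have KN (a b c d e : R[i]) : - K a b c d e = K (- a) (- b) (- c) (- d) (- e).
  by rewrite -scaleN1r kernel_mxZ !mulN1r.
have Kc (a b c d e a' b' c' d' e' : R[i]) :
    a = a' -> b = b' -> c = c' -> d = d' -> e = e' -> K a b c d e = K a' b' c' d' e'.
  by move=> -> -> -> -> ->.
have ms0 w : ms w 0 = 0 by rewrite /ms /mellin_sum big_ord0.
have geo0 w : geo w 0 = 0 by rewrite /geo big_ord0.
have msS w n : ms w n.+1 = ms w n + w ^+ n / (n%:R - z).
  by rewrite /ms /mellin_sum big_ord_recr.
have geoS w n : geo w n.+1 = geo w n + w ^+ n by rewrite /geo big_ord_recr.
rewrite seriesEord /=; elim: N => [|N IH].
  rewrite big_ord0 !ms0 !geo0 mulr0 addr0.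
  have -> : (0 : R[i]) = 0 * 0 by rewrite mulr0.
  by rewrite -kernel_mxZ scale0r oppr0.
have kz : N%:R - z != 0 by rewrite subr_eq0; exact: nat_neq.
rewrite big_ord_recr /= IH (@wedgeF_kernel R l1 l2) // scalerN -opprD; congr (- _).
rewrite kernel_mxZ kernel_mxD !msS !geoS.
have waN : wa ^+ N = t%:C ^+ N * cexp ('i * theta%:C) ^+ N by rewrite -exprMn.
have wbN : wb ^+ N = t%:C ^+ N * cexp ('i * theta%:C) ^- N.
  by rewrite /wb circNE exprMn exprVn.
by apply: Kc; rewrite ?waN ?wbN; field; rewrite ?kz ?expf_neq0 ?cexp_neq0.
Qed.

Lemma ccvg_kernel (a b c d e : nat -> R[i]) (a' b' c' d' e' : R[i]) i j :
  ccvg \oo a a' -> ccvg \oo b b' -> ccvg \oo c c' -> ccvg \oo d d' -> ccvg \oo e e' ->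
  ccvg \oo (fun N => K (a N) (b N) (c N) (d N) (e N) i j) (K a' b' c' d' e' i j).
Proof.
have KE (x1 x2 x3 x4 x5 : R[i]) : K x1 x2 x3 x4 x5 i j =
    K 1 0 0 0 0 i j * x1 + K 0 1 0 0 0 i j * x2 + K 0 0 1 0 0 i j * x3 +
    K 0 0 0 1 0 i j * x4 + K 0 0 0 0 1 i j * x5.
  have Z x (M : 'M[R[i]]_4) : M i j * x = (x *: M) i j by rewrite mxE mulrC.
  have D (M M' : 'M[R[i]]_4) : M i j + M' i j = (M + M') i j by rewrite mxE.
  by rewrite !Z !kernel_mxZ !D !kernel_mxD !mulr0 !mulr1 !addr0 !add0r.
move=> ha hb hc hd he; rewrite KE; under eq_fun do rewrite KE.
pose proof (ccvgMl (K 1 0 0 0 0 i j) ha) as ha'; pose proof (ccvgMl (K 0 1 0 0 0 i j) hb) as hb'.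
pose proof (ccvgMl (K 0 0 1 0 0 i j) hc) as hc'; pose proof (ccvgMl (K 0 0 0 1 0 i j) hd) as hd'.
pose proof (ccvgMl (K 0 0 0 0 1 i j) he) as he'.
by pose proof (ccvgD (ccvgD (ccvgD (ccvgD ha' hb') hc') hd') he') as h.
Qed.

Let q := ccsc (pic R * z).
Let ap := - (pic R * q) * cexp ('i * (z * (theta - pi)%:C)).
Let am := - (pic R * q) * cexp ('i * (z * (pi - theta)%:C)).
Let kap := - (pic R * ccot (pic R * z)).
Let Ma := ap * cpow t z - cauchyJ z wa.
Let Mb := am * cpow t z - cauchyJ z wb.
Let Me := kap * cpow t z - pv_value z t.

Let cvg_a : ccvg \oo (ms wa) Ma. Proof. exact: mellin_formula. Qed.

Let cvg_b : ccvg \oo (ms wb) Mb.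
Proof.
have thN : 0 < 2 * pi - theta < 2 * pi by case/andP: th => *; apply/andP; split; lra.
have := mellin_formula z1 t0 t1 zint thN; rewrite circ_2piB.
by have -> : 2 * pi - theta - pi = pi - theta by ring.
Qed.

Let cvg_e : ccvg \oo (ms t%:C) Me. Proof. exact: mellin_pv. Qed.

Lemma cabs_circ_lt1 x : cabs (circ t x) < 1.
Proof. by rewrite cabs_circ // ltW. Qed.

Lemma wedge_series_lim :
  cvgn (series (fun k => t%:C ^+ k *: wedgeF lambda mu k z theta)) /\
  limn (series (fun k => t%:C ^+ k *: wedgeF lambda mu k z theta)) =
  - K Ma Mb ((1 - wa)^-1 + z * Ma) ((1 - wb)^-1 + z * Mb) Me.
Proof.
apply: cvg_mx_lim => i j.
have -> : (fun N => series (fun k => t%:C ^+ k *: wedgeF lambda mu k z theta) N i j) =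
  (fun N => - (K (ms wa N) (ms wb N) (geo wa N + z * ms wa N) (geo wb N + z * ms wb N)
     (ms t%:C N) i j)).
  by apply/funext => N; rewrite wedge_series_kernel mxE.
rewrite mxE; apply: ccvgN; apply: ccvg_kernel => //.
- by pose proof (ccvgD (ccvg_geometric (cabs_circ_lt1 theta)) (ccvgMl z cvg_a)) as h.
- by pose proof (ccvgD (ccvg_geometric (cabs_circ_lt1 (- theta))) (ccvgMl z cvg_b)) as h.
Qed.

(** All matrices involved are [kernel_mx], apart from the diagonal term - 1/2;
    their arguments agree by [mellin_formula] at theta and at 2 pi - theta and by
    [mellin_pv]. *)
Theorem wedge_expansion :
  [/\ layer_exists lambda mu theta phi t,
      layer_exists lambda mu theta phi (- t),
      cvgn (series (fun k => t%:C ^+ k *: wedgeF lambda mu k z theta))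
    & fold_wedge (bie_lhs lambda mu theta phi) t
      = (cpow t z *: wedgeA lambda mu z theta
         + limn (series (fun k => t%:C ^+ k *: wedgeF lambda mu k z theta))) *m p].
Proof.
have Kc (a b c d e a' b' c' d' e' : R[i]) :
    a = a' -> b = b' -> c = c' -> d = d' -> e = e' -> K a b c d e = K a' b' c' d' e'.
  by move=> -> -> -> -> ->.
have [cs ls] := wedge_series_lim.
have [e1 v1] := layer_pos p lm th z1 t0 t1.
have [e2 v2] := layer_neg p lm th z1 t0 t1.
split=> //; rewrite ls (@wedgeA_kernel R l1 l2) //; last exact: csin_pi_neq0.
rewrite -/q -/ap -/am -/kap.
have -> : cpow t z *: ((- 2^-1)%:M + K ap am (z * ap) (z * am) kap)
  - K Ma Mb ((1 - wa)^-1 + z * Ma) ((1 - wb)^-1 + z * Mb) Me =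
  (- 2^-1 * cpow t z)%:M + layer_mx lambda mu theta z t.
  rewrite scalerDr scale_scalar_mx (mulrC (cpow t z)) -addrA; congr (_ + _).
  rewrite -scaleN1r !kernel_mxZ kernel_mxD /layer_mx -/wa -/wb /double_pole.
  by apply: Kc; rewrite /Ma /Mb /Me; ring.
rewrite /fold_wedge /bie_lhs v1 v2 mulmxDl mul_scalar_mx.
have -> : phi t = cpow t z *: usubmx (p : 'cV[R[i]]_(2 + 2)) by rewrite /wedge_density ltW.
have -> : phi (- t) = cpow t z *: dsubmx (p : 'cV[R[i]]_(2 + 2)).
  by rewrite /wedge_density oppr_ge0 leNgt t0 /= opprK.
apply: (etrans _ (@vsubmxK _ 2 2 1 _)); congr (col_mx _ _).
- by rewrite scalerA; apply/matrixP => i j; rewrite !mxE.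
- by rewrite scalerA; apply/matrixP => i j; rewrite !mxE.
Qed.

End Expansion.

(** * Asymptotics at the corner *)

Section Asymptotics.
Variable R : realType.
Implicit Types (f g : R -> R[i]) (a b c : nat -> R[i]).

Definition bigO0 n f := exists C T : R,
  [/\ 0 <= C, 0 < T & forall t, 0 < t < T -> cabs (f t) <= C * t ^+ n].

Definition partial_sum n a (t : R) : R[i] := \sum_(k < n) a k * t%:C ^+ k.

Lemma bigO0B n f g : bigO0 n f -> bigO0 n g -> bigO0 n (fun t => f t - g t).
Proof.
move=> [C [T [C0 T0 fC]]] [D [U [D0 U0 gD]]].
exists (C + D), (Num.min T U); split; first exact: addr_ge0.
  by rewrite lt_min T0.
move=> t /andP[t0]; rewrite lt_min => /andP[tT tU].
rewrite (le_trans (cabsD _ _)) // cabsN mulrDl lerD //.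
  by apply: fC; rewrite t0.
by apply: gD; rewrite t0.
Qed.

Lemma eq_bigO0 n f g : (forall t, 0 < t < 1 -> f t = g t) -> bigO0 n f -> bigO0 n g.
Proof.
move=> fg [C [T [C0 T0 fC]]]; exists C, (Num.min T 1); split=> //.
  by rewrite lt_min T0 /=.
move=> t /andP[t0]; rewrite lt_min => /andP[tT t1].
by rewrite -fg ?t0 // fC // t0.
Qed.

Lemma right_near0 (P : R -> Prop) : (\forall t \near (0 : R)^'+, P t) ->
  exists2 T : R, 0 < T & forall t, 0 < t < T -> P t.
Proof.
move=> /nbhs_right0P; rewrite /prop_near1 => -[T T0 h].
exists T => // t /andP[t0 tT]; rewrite -[t]addr0.
have := h t; rewrite /ball_ /= sub0r normrN gtr0_norm // add0r addr0.
by apply.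
Qed.

Lemma ccvg_bigO0 f l : ccvg 0^'+ f l -> bigO0 0 f.
Proof.
move=> fl; pose proof (ccvg_cabs fl) as h.
have l1 : cabs l < cabs l + 1 by rewrite ltrDl.
have [T T0 hT] := right_near0 (cvgr_le _ h _ l1).
exists (cabs l + 1), T; split=> //; first by rewrite addr_ge0 ?cabs_ge0.
by move=> t /hT; rewrite expr0 mulr1.
Qed.

(** The coefficients of an antiderivative with constant term l. *)
Definition shifted_coeffs (l : R[i]) a (k : nat) : R[i] :=
  if k is m.+1 then a m / m.+1%:R else l.

Lemma is_cderive_partial_sum n l a t :
  is_cderive t (partial_sum n.+1 (shifted_coeffs l a)) (partial_sum n a t).
Proof.
have -> : partial_sum n.+1 (shifted_coeffs l a) =
    fun t => l + \sum_(k < n) a k / k.+1%:R * t%:C ^+ k.+1.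
  by apply/funext => s; rewrite /partial_sum big_ord_recl /= expr0 mulr1.
rewrite -[partial_sum _ _ _]add0r; apply: is_cderiveD; first exact: is_cderive_cst.
apply: is_cderive_sum => k.
have d := is_cderiveMl (a k / k.+1%:R) (is_cderiveX k.+1 (is_cderive_real_id t)).
apply: is_cderive_eq d _; rewrite mulr1 /= mulrA divfK // pnatr_eq0.
Qed.

Lemma ccvg_partial_sum n l a :
  ccvg 0^'+ (partial_sum n.+1 (shifted_coeffs l a)) l.
Proof.
have h := is_cderive_ccvg (is_cderive_partial_sum n l a 0).
have e : partial_sum n.+1 (shifted_coeffs l a) 0 = l.
  rewrite /partial_sum big_ord_recl /= expr0 mulr1 big1 ?addr0 // => k _.
  by rewrite expr0n /= mulr0.
by rewrite e in h; exact: ccvg_right.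
Qed.

(** Nothing is known at 0 but one-sided limits of the derivatives. The expansion
    of the next derivative is integrated from 0, where the limit of the present
    one is the constant term; the remainder gains a factor t by the mean value
    bound. *)
Lemma taylor_bigO0 (f : nat -> R -> R[i]) :
  (forall n t, 0 < t < 1 -> is_cderive t (f n) (f n.+1 t)) ->
  (forall n, exists l, ccvg 0^'+ (f n) l) ->
  forall m n, exists a, bigO0 m (fun t => f n t - partial_sum m a t).
Proof.
move=> df fl; elim=> [|m IH] n.
  exists (fun=> 0); have [l nl] := fl n; have h := ccvg_bigO0 nl.
  by apply: eq_bigO0 h => t _; rewrite /partial_sum big_ord0 subr0.
have [a [C [T [C0 T0 aC]]]] := IH n.+1; have [l nl] := fl n.
exists (shifted_coeffs l a); pose g t := f n t - partial_sum m.+1 (shifted_coeffs l a) t.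
exists (2 * C), (Num.min T 1); split; first by rewrite mulr_ge0.
  by rewrite lt_min T0 /=.
move=> t /andP[t0]; rewrite lt_min => /andP[tT t1]; rewrite -/(g t).
have gl : ccvg 0^'+ (fun s => g t - g s) (g t).
  have h := ccvg_partial_sum m l a.
  pose proof (ccvgB (ccvg_cst (g t)) (ccvgB nl h)) as k.
  have e : g t - (l - l) = g t by rewrite subrr subr0.
  by rewrite e in k; exact: k.
apply: (le_cabs_lim _ gl).
apply: filterS2 (nbhs_right_gt (0 : R)) (nbhs_right_lt t0) => s s0 st.
have hb : cabs (g t - g s) <= 2 * (C * t ^+ m) * (t - s).
  apply: (@cmvt_bound _ g (fun x => f n.+1 x - partial_sum m a x)) => [|x|x] /=; first exact: ltW.
    move=> /andP[sx xt]; apply: is_cderiveB; last exact: is_cderive_partial_sum.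
    by apply: df; rewrite (lt_le_trans s0 sx) (le_lt_trans xt t1).
  move=> /andP[sx xt]; have x0 := lt_le_trans s0 sx.
  apply: (le_trans (aC x _)); first by rewrite x0 (le_lt_trans xt tT).
  by rewrite ler_wpM2l // lerXn2r // nnegrE ltW.
apply: (le_trans hb); rewrite exprSr !mulrA ler_wpM2l //.
  by rewrite !mulr_ge0 // exprn_ge0 // ltW.
by rewrite gerBl ltW.
Qed.

Lemma sum_half_lt2 m : \sum_(j < m) (2^-1 : R) ^+ j <= 2.
Proof.
suff -> : \sum_(j < m) (2^-1 : R) ^+ j = 2 - 2 * 2^-1 ^+ m.
  by rewrite gerBl mulr_ge0 // exprn_ge0.
elim: m => [|m IH]; first by rewrite big_ord0 expr0 mulr1 subrr.
by rewrite big_ord_recr /= IH exprS; field.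
Qed.

(** Convergence at 1/2 bounds c_k 2^-k, so that for t < 1/4 the tail is dominated
    by a geometric series of ratio 1/2. *)
Lemma power_series_bigO0 c (S : R -> R[i]) :
  (forall t, 0 < t < 1 -> ccvg \oo (fun N => partial_sum N c t) (S t)) ->
  forall n, bigO0 n (fun t => S t - partial_sum n c t).
Proof.
move=> cS n; pose x : nat -> R := fun k => cabs (c k * (2^-1 : R)%:C ^+ k).
have h0 : 0 < (2^-1 : R) < 1 by rewrite invr_gt0 ltr0n invf_lt1 ?ltr1n.
have [B [B0 xB]] : exists B : R, 0 <= B /\ forall k, x k <= B.
  have h1 := cS _ h0.
  have h2 : ccvg \oo (fun N => partial_sum N.+1 c 2^-1) (S 2^-1).
    by case: h1 => r1 r2; split; [rewrite -cvg_shiftS in r1|rewrite -cvg_shiftS in r2].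
  pose proof (ccvg_cabs (ccvgB h2 h1)) as h3; rewrite subrr cabs0 in h3.
  have xE : (fun N => cabs (partial_sum N.+1 c 2^-1 - partial_sum N c 2^-1)) = x.
    by apply/funext => k; rewrite /partial_sum big_ord_recr /= addrAC subrr add0r.
  rewrite xE in h3.
  have [N0 _ hN] := cvgr_le _ h3 _ (ltr01 : 0 < 1 :> R).
  have x0 k : 0 <= x k by exact: cabs_ge0.
  exists (1 + \sum_(k < N0) x k); split; first by rewrite addr_ge0 // sumr_ge0.
  move=> k; have [kN|kN] := ltnP k N0.
    rewrite (bigD1 (Ordinal kN)) //= addrCA lerDl addr_ge0 // sumr_ge0 //.
  by rewrite (le_trans (hN k kN)) // lerDl sumr_ge0.
exists (2 * (B * 2 ^+ n)), 4^-1; split; first by apply: mulr_ge0 => //; apply: mulr_ge0 => //; exact: exprn_ge0.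
  by rewrite invr_gt0.
move=> t /andP[t0 t4].
have t1 : t < 1 by rewrite (lt_trans t4) // invf_lt1 ?ltr1n.
have ht : 0 < t < 1 by rewrite t0.
pose proof (ccvgB (cS t ht) (ccvg_cst (partial_sum n c t))) as hl.
apply: (le_cabs_lim _ hl).
apply: filterS (nbhs_infty_ge n) => N nN.
rewrite -(subnKC nN); move: (N - n)%N => m.
rewrite /partial_sum big_split_ord /= addrAC subrr add0r.
have sb : cabs (\sum_(j < m) c (n + j)%N * t%:C ^+ (n + j)) <=
    \sum_(j < m) B * 2 ^+ n * t ^+ n * 2^-1 ^+ j.
  elim: m => [|m IH]; first by rewrite !big_ord0 cabs0.
  rewrite !big_ord_recr /= (le_trans (cabsD _ _)) // lerD //.
  have t4' : t * 2 <= 2^-1 by have := t4; lra.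
  (* t^(n+j) = 2^-(n+j) (2t)^(n+j): one factor for c, the other for the decay. *)
  have -> : t = 2^-1 * (t * 2) by field.
  rewrite rmorphM exprMn mulrA cabsM.
  have -> : cabs ((t * 2)%:C ^+ (n + m)) = (t * 2) ^+ (n + m).
    by rewrite cabsX cabs_real ger0_norm // mulr_ge0 // ltW.
  have -> : B * 2 ^+ n * (2^-1 * (t * 2)) ^+ n * 2^-1 ^+ m = B * ((t * 2) ^+ n * 2^-1 ^+ m).
    rewrite exprMn -!mulrA; congr (_ * _); rewrite mulrA -exprMn divff ?expr1n ?mul1r //.
  have t2 : 0 <= t * 2 by rewrite mulr_ge0 // ltW.
  apply: ler_pM => //; first exact: cabs_ge0.
  - exact: exprn_ge0.
  - exact: xB.
  - by rewrite exprD; apply: ler_wpM2l; [exact: exprn_ge0|rewrite lerXn2r // nnegrE].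
apply: (le_trans sb); rewrite -mulr_sumr.
rewrite (_ : 2 * (B * 2 ^+ n) * t ^+ n = B * 2 ^+ n * t ^+ n * 2); last by ring.
apply: ler_wpM2l; last exact: sum_half_lt2.
by apply: mulr_ge0; [apply: mulr_ge0 => //; exact: exprn_ge0|exact/exprn_ge0/ltW].
Qed.

Lemma Re_nat (n : nat) : Re (n%:R : R[i]) = n%:R.
Proof. by rewrite -(rmorph_nat (real_complex R)). Qed.

Lemma Im_nat (n : nat) : Im (n%:R : R[i]) = 0.
Proof. by rewrite -(rmorph_nat (real_complex R)). Qed.

Section Exponent.
Variable z : R[i].
Hypothesis zint : forall m : int, z <> m%:~R.

Let s : R := (1 + `|Im z|)^-1.
Let la : R := expR (- s).

Let s0 : 0 < s. Proof. by rewrite invr_gt0 ltr_pwDl. Qed.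
Let la0 : 0 < la. Proof. exact: expR_gt0. Qed.
Let la1 : la < 1. Proof. by rewrite -expR0 ltr_expR oppr_lt0. Qed.

(** With la = e^(-s) the equality means that s (z - k) is a multiple of 2 pi i.
    Since s |Im z| < 1 the multiple is 0, and z = k. For a general la, such as
    1/2, some nonintegral z would satisfy it. *)
Lemma dilation_neq k : cpow la z != la%:C ^+ k.
Proof.
have -> : la%:C ^+ k = cexp (- (k%:R * s)%:C).
  rewrite -rmorphXn /= -expRM_natl -rmorphN /cexp /= cos0 sin0.
  by rewrite (_ : (_ +i* _) = 1) ?mulr1 // mulrN.
have -> : cpow la z = cexp (- (z * s%:C)) by rewrite /cpow expRK rmorphN mulrN.
apply/eqP => e.
have e1 : cexp ((k%:R - z) * s%:C) = 1.
  have -> : (k%:R - z) * s%:C = - (z * s%:C) - (- (k%:R * s)%:C).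
    by rewrite rmorphM rmorph_nat; ring.
  by rewrite cexpD cexpN -e divff // cexp_neq0.
set w := (k%:R - z) * s%:C in e1.
have wR : Re w = (k%:R - Re z) * s by rewrite /w mulrC Re_realM ReB Re_nat mulrC.
have wI : Im w = - Im z * s by rewrite /w mulrC Im_realM ImB Im_nat sub0r mulrC.
have r1 := congr1 (@ComplexField.Normc.normc R) e1; rewrite cabs_cexp cabs1 in r1.
have /expR_inj /eqP : expR (Re w) = expR 0 by rewrite r1 expR0.
rewrite wR mulf_eq0 (gt_eqF s0) orbF subr_eq0 => /eqP r0.
have := congr1 (@complex.Im R) e1; rewrite /cexp r1 Im_realM mul1r /= => sin0'.
have y1 : `|Im w| < pi.
  rewrite wI normrM normrN (gtr0_norm s0) (@lt_le_trans _ _ 1) //.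
    by rewrite ltr_pdivrMr ?mul1r ?ltr_pwDl // ltrDr.
  by rewrite (le_trans _ (pi_ge2 R)) // ler1n.
have y0 : Im w = 0.
  have [yn|yp|//] := ltgtP (Im w) 0.
    have : 0 < sin (- Im w) by apply: sin_gt0_pi; rewrite oppr_gt0 yn -(ltr0_norm yn) y1.
    by rewrite sinN sin0' oppr0 ltxx.
  have : 0 < sin (Im w) by apply: sin_gt0_pi; rewrite yp -(gtr0_norm yp) y1.
  by rewrite sin0' ltxx.
move/eqP: y0; rewrite wI mulf_eq0 (gt_eqF s0) orbF oppr_eq0 => /eqP z0.
by apply: (zint (m := k)); apply: eqc; rewrite ?Re_nat ?Im_nat.
Qed.

Lemma cpow_bigO0_eq0 (v : R[i]) n : Re z < n%:R ->
  bigO0 n (fun t => v * cpow t z) -> v = 0.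
Proof.
move=> zn [C [T [C0 T0 vC]]].
have w0 : 0 < Re (n%:R - z) by rewrite ReB Re_nat subr_gt0.
pose proof (ccvgMl C%:C (cpow_cvg0 w0)) as h; rewrite mulr0 in h.
pose proof (ccvg_cabs h) as h1; rewrite cabs0 in h1.
apply/eqP; rewrite -cabs_eq0 eq_le cabs_ge0 andbT.
rewrite -(cvg_lim (@Rhausdorff R) h1); apply: limr_ge.
  by apply/cvg_ex; eexists; exact: h1.
apply: filterS2 (nbhs_right_gt (0 : R)) (nbhs_right_lt T0) => t t0 tT /=.
have := vC t; rewrite t0 tT => /(_ isT).
rewrite (cabsM v) (cabsM C%:C) cabs_real (ger0_norm C0) !cabs_cpow ReB Re_nat mulrBl expRB.
have -> : expR (n%:R * ln t) = t ^+ n by rewrite expRM_natl lnK.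
by rewrite mulrA ler_pdivlMr ?expR_gt0.
Qed.

(** The operation f(la t) - la^m f(t) removes the monomial t^m, keeps the other
    monomials and multiplies the coefficient of t^z by a nonzero number. *)
Lemma cpow_partial_sum_eq0 n : Re z < n%:R -> forall m (v : R[i]) a,
  bigO0 n (fun t => v * cpow t z - partial_sum m a t) -> v = 0.
Proof.
move=> zn; elim=> [|m IH] v a vO.
  apply: (cpow_bigO0_eq0 zn); apply: eq_bigO0 vO => t _.
  by rewrite /partial_sum big_ord0 subr0.
pose f t := v * cpow t z - partial_sum m.+1 a t.
have fO : bigO0 n (fun t => f (la * t) - la%:C ^+ m * f t).
  apply: bigO0B.
    have [C [T [C0 T0 vC]]] := vO; exists C, T; split; [exact: C0|exact: T0|].
    move=> t /andP[t0 tT].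
    have lt0 : 0 < la * t by rewrite mulr_gt0.
    have ltt : la * t <= t by rewrite ger_pMl // ltW.
    rewrite (le_trans (vC _ _)) ?lt0 ?(le_lt_trans ltt) //.
    by rewrite ler_wpM2l // lerXn2r // nnegrE ltW.
  have [C [T [C0 T0 vC]]] := vO; exists C, T; split; [exact: C0|exact: T0|].
  move=> t tT.
  rewrite cabsM cabsX cabs_real (gtr0_norm la0).
  apply: le_trans (vC t tT); apply: ler_piMl; first exact: cabs_ge0.
  by apply: exprn_ile1; exact: ltW.
have v0 : (cpow la z - la%:C ^+ m) * v = 0.
  apply: (IH _ (fun k => (la%:C ^+ k - la%:C ^+ m) * a k)).
  apply: eq_bigO0 fO => t /andP[t0 _]; rewrite /f.
  have -> : cpow (la * t) z = cpow la z * cpow t z.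
    by rewrite /cpow lnM ?posrE // rmorphD mulrDr cexpD.
  rewrite /partial_sum big_ord_recr [in X in _ - _ * (_ - X)]big_ord_recr /=.
  have -> : \sum_(k < m) (la%:C ^+ k - la%:C ^+ m) * a k * t%:C ^+ k =
      \sum_(k < m) a k * (la * t)%:C ^+ k - la%:C ^+ m * \sum_(k < m) a k * t%:C ^+ k.
    rewrite mulr_sumr -sumrB; apply: eq_bigr => k _.
    by rewrite rmorphM exprMn; ring.
  by rewrite rmorphM exprMn; ring.
by move/eqP: v0; rewrite mulf_eq0 subr_eq0 (negPf (dilation_neq m)) => /eqP.
Qed.

End Exponent.
End Asymptotics.

(** * The determinant, by reflection *)

Section Reflection.
Variable F : fieldType.
Lemma det2_eq0 (m11 m12 m21 m22 x y : F) :
  m11 * x + m12 * y = 0 -> m21 * x + m22 * y = 0 ->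
  m11 * m22 - m12 * m21 <> 0 -> x = 0 /\ y = 0.
Proof.
move=> e1 e2 /eqP d0.
have ex : (m11 * m22 - m12 * m21) * x = 0.
  transitivity (m22 * (m11 * x + m12 * y) - m12 * (m21 * x + m22 * y)); first by ring.
  by rewrite e1 e2 !mulr0 subrr.
have ey : (m11 * m22 - m12 * m21) * y = 0.
  transitivity (m11 * (m21 * x + m22 * y) - m21 * (m11 * x + m12 * y)); first by ring.
  by rewrite e1 e2 !mulr0 subrr.
by split; apply/eqP; [move/eqP: ex|move/eqP: ey]; rewrite mulf_eq0 (negPf d0).
Qed.

End Reflection.

Section Determinant.
Variable R : realType.

(** The 2 x 2 blocks of A on the vectors that the reflection in the bisector of the
    wedge fixes (eps = 1) or negates (eps = -1), with all trigonometric functions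
    written in u = e^(i theta), E = e^(i pi z) and V = e^(i theta z). *)
Lemma det_factor (j u E V z l k P eps : R[i]) :
  j ^+ 2 = -1 -> eps ^+ 2 = 1 -> u != 0 -> E != 0 -> V != 0 -> P != 0 -> E ^+ 2 - 1 != 0 ->
  k = 1 - 2 * l ->
  let si := (u - u^-1) / (2 * j) in
  let co := (u + u^-1) / 2 in
  let sg := (E - E^-1) / (2 * j) in
  let X := (E ^+ 2 / V - V / E ^+ 2) / (2 * j) in
  let Y := (V - V^-1) / (2 * j) in
  let a := - (P / sg) * (V / E) in
  let b := - (P / sg) * (E / V) in
  let e := - (P * ((E + E^-1) / 2 / sg)) in
  let im := (a - b) / (2 * j) in
  let re := (a + b) / 2 in
  let PP := si * u * (z * a) in
  let QQ := si / u * (z * b) in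
  let qre := (PP + QQ) / 2 in
  let qim := (PP - QQ) / (2 * j) in
  let X00 := - (l / P * im) - k / P * (im / 2 + qre / 2) in
  let X01 := 1 * (l / P * re) - k / P * (qim / 2) in
  let X10 := - (1 * (l / P * re)) - k / P * (qim / 2) in
  let X11 := - (l / P * im) - k / P * (im / 2 - qre / 2) in
  let D := l / P * e in
  let m11 := - 2^-1 + eps * (X00 * co + X01 * si) in
  let m12 := - D + eps * (X00 * si - X01 * co) in
  let m21 := D + eps * (X10 * co + X11 * si) in
  let m22 := - 2^-1 + eps * (X10 * si - X11 * co) in
  4 * sg ^+ 2 * (m11 * m22 - m12 * m21) =
  (k * si * z - eps * k * X) * (k * si * z - eps * (1 + 2 * l) * Y).
Proof.
move=> jj ee u0 E0 V0 P0 E1 kE.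
have n2 := two_neq0 R; have j0 : j != 0.
  by apply/eqP => e; move/eqP: jj; rewrite e expr0n /= eq_sym oppr_eq0 oner_eq0.
cbv zeta; rewrite kE.
field: jj ee.
all: by rewrite ?n2 ?j0 ?u0 ?E0 ?V0 ?P0 ?E1.
Qed.

(** A commutes with the reflection in the bisector, which exchanges the legs and
    acts on vectors by the matrix with rows (co, si) and (si, - co). So the row
    combinations on the right involve p only through the two coordinates w1, w2 of
    its symmetric or antisymmetric part. *)
Lemma reflect_rows (j u z l k P eps a b e x1 x2 x3 x4 : R[i]) :
  j ^+ 2 = -1 -> eps ^+ 2 = 1 -> u != 0 -> P != 0 ->
  let si := (u - u^-1) / (2 * j) in
  let co := (u + u^-1) / 2 in
  let im := (a - b) / (2 * j) in
  let re := (a + b) / 2 in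
  let PP := si * u * (z * a) in
  let QQ := si / u * (z * b) in
  let qre := (PP + QQ) / 2 in
  let qim := (PP - QQ) / (2 * j) in
  let PP' := si * u * (z * b) in
  let QQ' := si / u * (z * a) in
  let qre' := (PP' + QQ') / 2 in
  let qim' := (PP' - QQ') / (2 * j) in
  let X00 := - (l / P * im) - k / P * (im / 2 + qre / 2) in
  let X01 := 1 * (l / P * re) - k / P * (qim / 2) in
  let X10 := - (1 * (l / P * re)) - k / P * (qim / 2) in
  let X11 := - (l / P * im) - k / P * (im / 2 - qre / 2) in
  let Y00 := - (l / P * im) - k / P * (im / 2 + qre' / 2) in
  let Y01 := -1 * (l / P * re) - k / P * (qim' / 2) in
  let Y10 := - (-1 * (l / P * re)) - k / P * (qim' / 2) in
  let Y11 := - (l / P * im) - k / P * (im / 2 - qre' / 2) in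
  let D := l / P * e in
  let m11 := - 2^-1 + eps * (X00 * co + X01 * si) in
  let m12 := - D + eps * (X00 * si - X01 * co) in
  let m21 := D + eps * (X10 * co + X11 * si) in
  let m22 := - 2^-1 + eps * (X10 * si - X11 * co) in
  let w1 := x1 + eps * (co * x3 + si * x4) in
  let w2 := x2 + eps * (si * x3 - co * x4) in
  let r0 := - 2^-1 * x1 - D * x2 + X00 * x3 + X01 * x4 in
  let r1 := D * x1 + - 2^-1 * x2 + X10 * x3 + X11 * x4 in
  let r2 := Y00 * x1 + Y01 * x2 + - 2^-1 * x3 + D * x4 in
  let r3 := Y10 * x1 + Y11 * x2 - D * x3 + - 2^-1 * x4 in
  m11 * w1 + m12 * w2 = r0 + eps * (co * r2 + si * r3) /\
  m21 * w1 + m22 * w2 = r1 + eps * (si * r2 - co * r3).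
Proof.
move=> jj ee u0 P0.
have n2 := two_neq0 R; have j0 : j != 0.
  by apply/eqP => h; move/eqP: jj; rewrite h expr0n /= eq_sym oppr_eq0 oner_eq0.
cbv zeta; split; field: jj ee.
all: by rewrite ?n2 ?j0 ?u0 ?P0.
Qed.

Lemma kernel_rows (l1 l2 theta : R) (a b c d e h : R[i]) (p : 'cV[R[i]]_4) :
  let X i j := (nth [::] (crossAB l1 l2 theta a b c d) i)`_j in
  let Y i j := (nth [::] (crossBA l1 l2 theta a b c d) i)`_j in
  let D := l1%:C / pic R * e in
  let x k := p (inord k) 0 in
  (h%:M + kernel_mx l1 l2 theta a b c d e) *m p = 0 ->
  [/\ h * x 0%N - D * x 1%N + X 0%N 0%N * x 2%N + X 0%N 1%N * x 3%N = 0,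
      D * x 0%N + h * x 1%N + X 1%N 0%N * x 2%N + X 1%N 1%N * x 3%N = 0,
      Y 0%N 0%N * x 0%N + Y 0%N 1%N * x 1%N + h * x 2%N + D * x 3%N = 0 &
      Y 1%N 0%N * x 0%N + Y 1%N 1%N * x 1%N - D * x 2%N + h * x 3%N = 0].
Proof.
move=> X Y D x /matrixP h0.
have row (i : nat) : (i < 4)%N ->
    \sum_(k < 4) (h *+ (i == k) + kernel_mx l1 l2 theta a b c d e (inord i) k) * p k 0 = 0.
  move=> i4; have := h0 (inord i) 0; rewrite !mxE => {2}<-.
  by apply: eq_bigr => k _; rewrite !mxE -val_eqE /= inordK.
have xE (k : 'I_4) : p k 0 = x k by rewrite /x inord_val.
split.
- have := row 0%N isT; rewrite !big_ord_recr big_ord0 /= !mxE !inordK //= !xE /= => <-;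
    rewrite /X /Y /D /crossAB /crossBA /cross_block /= ?mulr0n ?mulr1n; ring.
- have := row 1%N isT; rewrite !big_ord_recr big_ord0 /= !mxE !inordK //= !xE /= => <-;
    rewrite /X /Y /D /crossAB /crossBA /cross_block /= ?mulr0n ?mulr1n; ring.
- have := row 2%N isT; rewrite !big_ord_recr big_ord0 /= !mxE !inordK //= !xE /= => <-;
    rewrite /X /Y /D /crossAB /crossBA /cross_block /= ?mulr0n ?mulr1n; ring.
- have := row 3%N isT; rewrite !big_ord_recr big_ord0 /= !mxE !inordK //= !xE /= => <-;
    rewrite /X /Y /D /crossAB /crossBA /cross_block /= ?mulr0n ?mulr1n; ring.
Qed.

(** If the product were nonzero, both 2 x 2 blocks would be invertible, so that the
    symmetric and the antisymmetric part of p would vanish. The constant c enters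
    through 1 + 2 c1 = c2 c. *)
Lemma wedge_transcendental (lambda mu theta : R) (z : R[i]) (p : 'cV[R[i]]_4) :
  lambda + 2 * mu != 0 -> lambda + mu != 0 -> csin (pic R * z) != 0 ->
  p <> 0 -> wedgeA lambda mu z theta *m p = 0 ->
  (z ^+ 2 * (sin theta)%:C ^+ 2 - csin ((2 * pi - theta)%:C * z) ^+ 2)
  * (z ^+ 2 * (sin theta)%:C ^+ 2
     - ((lambda + 3 * mu) / (lambda + mu))%:C ^+ 2 * csin (theta%:C * z) ^+ 2) = 0.
Proof.
move=> lm lm1 s0 p0 Ap.
pose l1 := lame_c1 lambda mu; pose l2 := lame_c2 lambda mu.
rewrite (@wedgeA_kernel R l1 l2) // in Ap.
pose u : R[i] := cexp ('i * theta%:C); pose E := cexp ('i * (pic R * z)).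
pose V := cexp ('i * (theta%:C * z)).
have u0 : u != 0 by exact: cexp_neq0.
have E0 : E != 0 by exact: cexp_neq0.
have V0 : V != 0 by exact: cexp_neq0.
have P0 : pic R != 0 by rewrite eq_complex /= gt_eqF ?pi_gt0.
pose sg := (E - E^-1) / (2 * 'i).
have sgE : csin (pic R * z) = sg by rewrite /csin cexpN.
have E1 : E ^+ 2 - 1 != 0.
  apply: contra s0 => /eqP h; rewrite sgE /sg.
  have -> : E - E^-1 = (E ^+ 2 - 1) / E by field.
  by rewrite h !mul0r.
have -> : csin (theta%:C * z) = (V - V^-1) / (2 * 'i) by rewrite /csin cexpN.
have -> : csin ((2 * pi - theta)%:C * z) = (E ^+ 2 / V - V / E ^+ 2) / (2 * 'i).
  rewrite /csin cexpN; have -> : cexp ('i * ((2 * pi - theta)%:C * z)) = E ^+ 2 / V.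
    rewrite /E /V expr2 -cexpN -!cexpD; congr cexp.
    by rewrite rmorphB rmorphM rmorph_nat -/(pic R); ring.
  by rewrite invf_div.
have aE : cexp ('i * (z * (theta - pi)%:C)) = V / E.
  by rewrite /E /V -cexpN -cexpD; congr cexp; rewrite rmorphB -/(pic R); ring.
have bE : cexp ('i * (z * (pi - theta)%:C)) = E / V.
  by rewrite /E /V -cexpN -cexpD; congr cexp; rewrite rmorphB -/(pic R); ring.
have eE : ccot (pic R * z) = (E + E^-1) / 2 / sg.
  by rewrite /ccot sgE /ccos cexpN.
rewrite aE bE eE /ccsc sgE in Ap.
have := kernel_rows Ap; cbv zeta.
set x1 := p _ 0; set x2 := p _ 0; set x3 := p _ 0; set x4 := p _ 0.
rewrite /crossAB /crossBA /cross_block /= !sin_cexpE -/u => -[r0 r1 r2 r3].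
have kE : l2%:C = 1 - 2 * l1%:C.
  have -> : l2 = 1 - 2 * l1 by rewrite /l2 /l1 /lame_c1 /lame_c2; field; rewrite lm.
  by rewrite rmorphB rmorphM rmorph_nat.
set c := (lambda + 3 * mu) / (lambda + mu).
have cE : 1 + 2 * l1%:C = l2%:C * c%:C.
  rewrite -[1]/((1 : R)%:C) -(rmorph_nat (real_complex R) 2) -!rmorphM -rmorphD /=; congr (_%:C).
  by rewrite /l2 /l1 /c /lame_c1 /lame_c2; field; rewrite lm lm1.
have l20 : l2%:C != 0.
  by rewrite -[0]/((0 : R)%:C) (inj_eq (@complexI R)) mulf_neq0 ?invr_neq0.
apply/eqP/negPn/negP; rewrite mulf_eq0 negb_or => /andP[n1 n2].
set si := (u - u^-1) / (2 * 'i) in r0 r1 r2 r3 n1 n2.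
pose co := (u + u^-1) / 2.
have main (eps : R[i]) : eps ^+ 2 = 1 ->
    x1 + eps * (co * x3 + si * x4) = 0 /\ x2 + eps * (si * x3 - co * x4) = 0.
  move=> ee.
  have [q1 q2] := reflect_rows z l1%:C l2%:C (- (pic R / sg) * (V / E)) (- (pic R / sg) * (E / V))
    (- (pic R * ((E + E^-1) / 2 / sg))) x1 x2 x3 x4 (i2 R) ee u0 P0.
  have z0 (x y r r' r'' : R[i]) : r = 0 -> r' = 0 -> r'' = 0 -> r + eps * (x * r' + y * r'') = 0.
    by move=> -> -> ->; rewrite !(mulr0, addr0).
  have z0' (x y r r' r'' : R[i]) : r = 0 -> r' = 0 -> r'' = 0 -> r + eps * (x * r' - y * r'') = 0.
    by move=> -> -> ->; rewrite !(mulr0, subr0, addr0).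
  apply: (det2_eq0 (etrans q1 (z0 _ _ _ _ _ r0 r2 r3)) (etrans q2 (z0' _ _ _ _ _ r1 r2 r3))) => d0.
  have := det_factor z (i2 R) ee u0 E0 V0 P0 E1 kE.
  cbv zeta; rewrite d0 mulr0 => /esym /eqP; rewrite -/si cE mulf_eq0 => /orP[] /eqP f0.
    move/negP: n1; apply; rewrite -(mulrI_eq0 _ (mulfI l20)); apply/eqP.
    set X := (_ - _) / _ in f0 *.
    transitivity ((l2%:C * si * z - eps * l2%:C * X) * (si * z + eps * X)); first by ring: ee.
    by rewrite f0 mul0r.
  move/negP: n2; apply; rewrite -(mulrI_eq0 _ (mulfI l20)); apply/eqP.
  set Y := (_ - _) / _ in f0 *.
  transitivity ((l2%:C * si * z - eps * (l2%:C * c%:C) * Y) * (si * z + eps * c%:C * Y)).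
    by ring: ee.
  by rewrite f0 mul0r.
have [p1 p2] := main 1 (expr1n _ _).
have [m1 m2] := main (-1) (etrans (sqrrN 1) (expr1n _ _)).
rewrite !mul1r in p1 p2; rewrite !mulN1r in m1 m2.
have x10 : x1 = 0 by apply: (mulfI (two_neq0 R)); rewrite mulr0 -[RHS]addr0 -{1}p1 -m1; ring.
have x20 : x2 = 0 by apply: (mulfI (two_neq0 R)); rewrite mulr0 -[RHS]addr0 -{1}p2 -m2; ring.
rewrite x10 add0r in p1; rewrite x20 add0r in p2.
have cs : co ^+ 2 + si ^+ 2 = 1.
  have ii := i2 R; have t2 := two_neq0 R; have j0 := i_neq0 R; rewrite /co /si; field: ii.
  by rewrite ?t2 ?j0 ?u0.
have x30 : x3 = 0.
  rewrite -[x3]mul1r -cs; transitivity (co * (co * x3 + si * x4) + si * (si * x3 - co * x4)).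
    by ring.
  by rewrite p1 p2 !mulr0 addr0.
have x40 : x4 = 0.
  rewrite -[x4]mul1r -cs; transitivity (si * (co * x3 + si * x4) - co * (si * x3 - co * x4)).
    by ring.
  by rewrite p1 p2 !mulr0 subr0.
apply: p0; apply/matrixP => i j; rewrite ord1 !mxE -(inord_val i).
by case: i => -[|[|[|[|//]]]] ? /=.
Qed.

End Determinant.

(** * Smooth right-hand sides *)

Section Smooth.
Variable R : realType.

Lemma smooth_is_derive (g : R -> R) (n : nat) (t : R) : smooth_up_to_0 g -> 0 < t < 1 ->
  is_derive t 1 (derive1n n g) (derive1n n.+1 g t).
Proof.
by move=> sg t01; rewrite derive1nS derive1E; apply: derivableP; exact: (sg n).1.
Qed.

(** Both g and the power series S are polynomials up to O(t^n), hence so is v t^z;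
    n > Re z suffices to conclude. *)
Lemma smooth_expansion_eq0 (z v : R[i]) (c : nat -> R[i]) (g S : R -> R[i]) :
  (forall m : int, z <> m%:~R) ->
  smooth_up_to_0 (fun t => Re (g t)) -> smooth_up_to_0 (fun t => Im (g t)) ->
  (forall t, 0 < t < 1 -> ccvg \oo (fun N => partial_sum N c t) (S t)) ->
  (forall t, 0 < t < 1 -> g t = v * cpow t z + S t) -> v = 0.
Proof.
move=> zint gR gI cS gE.
pose f n t : R[i] := derive1n n (fun t => Re (g t)) t +i* derive1n n (fun t => Im (g t)) t.
have df n t : 0 < t < 1 -> is_cderive t (f n) (f n.+1 t).
  by move=> t01; split; apply: smooth_is_derive.
have fl n : exists l, ccvg 0^'+ (f n) l.
  have /cvg_ex[x xl] := (gR n).2; have /cvg_ex[y yl] := (gI n).2.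
  by exists (x +i* y); split.
pose n := (Num.truncn `|Re z|).+1.
have zn : Re z < n%:R by rewrite (le_lt_trans (ler_norm _)) // truncnS_gt.
have [a aO] := taylor_bigO0 df fl n 0; have cO := power_series_bigO0 cS n.
apply: (@cpow_partial_sum_eq0 R z zint n zn n v (fun k => a k - c k)).
apply: eq_bigO0 (bigO0B aO cO) => t t01 /=.
have -> : f 0 t = g t by rewrite /f /=; case: (g t).
rewrite gE // /partial_sum.
have -> : \sum_(k < n) (a k - c k) * t%:C ^+ k =
    \sum_(k < n) a k * t%:C ^+ k - \sum_(k < n) c k * t%:C ^+ k.
  by rewrite -sumrB; apply: eq_bigr => k _; rewrite mulrBl.
by ring.
Qed.

Variables (lambda mu theta : R) (z : R[i]) (p : 'cV[R[i]]_4).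
Hypothesis lm : lambda + 2 * mu != 0.
Hypothesis th : 0 < theta < 2 * pi.
Hypothesis z1 : -1 < Re z.
Hypothesis zint : forall m : int, z <> m%:~R.

Lemma smooth_ker :
  wedge_smooth (bie_lhs lambda mu theta (wedge_density z p)) ->
  wedgeA lambda mu z theta *m p = 0.
Proof.
move=> hs; apply/matrixP => i j; rewrite ord1 [RHS]mxE.
have [sR sI] := hs i.
pose F k := wedgeF lambda mu k z theta.
pose S t := limn (series (fun k => t%:C ^+ k *: F k)).
apply: (@smooth_expansion_eq0 z _ (fun k => (F k *m p) i 0) _ (fun t => (S t *m p) i 0)
  zint sR sI) => t /andP[t0 t1].
- have [_ _ cs _] := wedge_expansion p lm th z1 zint t0 t1.
  have : series (fun k => t%:C ^+ k *: F k) @ \oo --> S t by exact: cs.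
  move=> /cvg_mxP h.
  have E : (fun N => partial_sum N (fun k => (F k *m p) i 0) t) =
      (fun N => \sum_j p j 0 * series (fun k => t%:C ^+ k *: F k) N i j).
    apply/funext => N; rewrite /partial_sum seriesEord /=.
    transitivity (((\sum_(k < N) t%:C ^+ k *: F k) *m p) i 0).
      rewrite mulmx_suml summxE; apply: eq_bigr => k _.
      by rewrite -scalemxAl [RHS]mxE mulrC.
    by rewrite mxE; apply: eq_bigr => k _; rewrite mulrC.
  rewrite E mxE.
  have -> : \sum_j S t i j * p j 0 = \sum_j p j 0 * S t i j.
    by apply: eq_bigr => k _; rewrite mulrC.
  apply: ccvg_sum => k; apply: ccvgMl; exact: h.
- have [_ _ _ ->] := wedge_expansion p lm th z1 zint t0 t1.
  by rewrite mulmxDl mxE -scalemxAl mxE mulrC.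
Qed.

End Smooth.

Lemma det_eq0_of_ker (F : fieldType) n (A : 'M[F]_n) (p : 'cV[F]_n) :
  p <> 0 -> A *m p = 0 -> \det A = 0.
Proof.
move=> p0 Ap; apply/eqP; rewrite -det_tr; apply/det0P; exists p^T.
  by apply/eqP => h; apply: p0; rewrite -[p]trmxK h trmx0.
by rewrite -trmx_mul Ap trmx0.
Qed.

Theorem theorem4p1 (R : realType) (lambda mu : R)
    (hmu : 0 < mu) (hlm : 0 < lambda + mu)
    (theta : R) (htheta : 0 < theta < 2 * pi)
    (z : R[i]) (hzint : forall m : int, z <> m%:~R)
    (hzre : -1 < complex.Re z)
    (p : 'cV[R[i]]_4) :
  let phi := wedge_density z p in
  let h := bie_lhs lambda mu theta phi in
  let A := wedgeA lambda mu z theta in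
  let F k := wedgeF lambda mu k z theta in
  (forall t : R, 0 < t < 1 ->
     [/\ layer_exists lambda mu theta phi t,
         layer_exists lambda mu theta phi (- t),
         cvgn (series (fun k => t%:C ^+ k *: F k))
       & fold_wedge h t
         = (cpow t z *: A + limn (series (fun k => t%:C ^+ k *: F k))) *m p])
  /\
  (p <> 0 -> wedge_smooth h ->
     [/\ \det A = 0,
         (z ^+ 2 * (sin theta)%:C ^+ 2
            - csin ((2 * pi - theta)%:C * z) ^+ 2)
         * (z ^+ 2 * (sin theta)%:C ^+ 2
            - ((lambda + 3 * mu) / (lambda + mu))%:C ^+ 2
              * csin (theta%:C * z) ^+ 2) = 0
       & A *m p = 0]).
Proof.
have lm : lambda + 2 * mu != 0 by rewrite gt_eqF // mulrDl mul1r addrA addr_gt0.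
move=> phi h A F; split=> [t /andP[t0 t1]|p0 hs].
  exact: wedge_expansion.
have Ap : A *m p = 0 by exact: smooth_ker.
split=> //; first exact: det_eq0_of_ker p0 Ap.
apply: wedge_transcendental p0 Ap => //; first by rewrite gt_eqF.
exact: csin_pi_neq0 hzint.
Qed.
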